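(* Let $q$ be a prime power and $n,s$ two relatively prime positive integers. Suppose that \[ n\geq\begin{cases} 4s+2 & \text{if } q=3 \text{ and } s>1, \text{ or } q=2 \text{ and } s>2;\\ 4s+1 & \text{otherwise}.\end{cases} \] Then for every $\delta\in\mathbb{F}_{q^{2n}}^*$, the $\mathbb{F}_q$-linear set $L_{\delta,s}$ in $\mathrm{PG}(1,q^{2n})$ is not scattered.
   Context: Let $f_{\delta,s}(x)=x^{q^s}+\delta x^{q^{n+s}}$, viewed as an $\mathbb{F}_q$-linear map of $\mathbb{F}_{q^{2n}}$, and $U_{\delta,s}=\{(x,f_{\delta,s}(x)) : x\in\mathbb{F}_{q^{2n}}\}$, an $\mathbb{F}_q$-subspace of $\mathbb{F}_{q^{2n}}^2$ of dimension $2n$. The linear set is $L_{\delta,s}=\{\langle \mathbf{u}\rangle_{\mathbb{F}_{q^{2n}}} : \mathbf{u}\in U_{\delta,s}\setminus\{\mathbf{0}\}\}\subseteq \mathrm{PG}(1,q^{2n})$. The weight of a point $P=\langle\mathbf{u}\rangle_{\mathbb{F}_{q^{2n}}}$ is $\dim_{\mathbb{F}_q}(U_{\delta,s}\cap\langle\mathbf{u}\rangle_{\mathbb{F}_{q^{2n}}})$. The linear set $L_{\delta,s}$ is called (maximum) scattered if every point of $L_{\delta,s}$ has weight one, equivalently $|L_{\delta,s}|=(q^{2n}-1)/(q-1)$. *)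

(* Defs.v *)
From mathcomp Require Import all_boot all_order all_algebra all_field.
Set Implicit Arguments. Unset Strict Implicit. Unset Printing Implicit Defensive.
Import GRing.Theory.
Local Open Scope ring_scope.

(* L plays the role of F_{q^{2n}} (a finite field with q^(2n) elements);
   F_q is its unique subfield of order q. *)

Definition f_ds (L : finFieldType) (q n s : nat) (delta : L) (x : L) : L :=
  x ^+ (q ^ s) + delta * x ^+ (q ^ (n + s)).

Definition U_ds (L : finFieldType) (q n s : nat) (delta : L) : {set L * L} :=
  [set u : L * L | u.2 == f_ds q n s delta u.1].

Definition Lspan (L : finFieldType) (u : L * L) : {set L * L} :=
  [set v : L * L | [exists l : L, v == (l * u.1, l * u.2)]].

(* weight of the point <u>: dim_{F_q} (U ∩ <u>).  U ∩ <u> is an F_q-subspace,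
   so it has exactly q^dim elements; the dimension is recovered as the
   base-q logarithm of its cardinality. *)
Definition weight (L : finFieldType) (q n s : nat) (delta : L) (u : L * L) : nat :=
  trunc_log q #|U_ds q n s delta :&: Lspan u|.

(* L_{delta,s} is scattered: every point of L_{delta,s} (i.e. <u> for
   u in U \ {0}) has weight one. *)
Definition scattered (L : finFieldType) (q n s : nat) (delta : L) : Prop :=
  forall u : L * L, u \in U_ds q n s delta -> u != 0 -> weight q n s delta u = 1%N.

(* Main.v *)
(* Write L for the field of order q^(2n), Q = q^n, bar x = x^Q, sigma x = x^(q^s), K for the
   subfield of order Q and f x = sigma x + delta sigma(bar x).
   If the linear set is scattered, then f(l x) = l f(x) with x nonzero forces l^q = l.  When
   c = delta bar(delta) is 1 f has a nonzero kernel, on which every l in K works, so c <> 1.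

   Fix omega in L outside K.  Two plane curves over K are attached to f; their points are
   pairs (b, y) with b in K and y in L of prescribed trace tau(b) and norm nu(b) over K:
   - for z = b + omega, the y for which f(bar z x) = a bar z f(x), where x solves
     sigma(bar x / x) = y / (delta sigma z) and a depends only on v = y / (delta sigma z);
   - for b <> 0, the y of norm c for which the same factor a attached to v = y / delta
     equals (1/b)^(sigma - 1).
   Every v has norm 1, so takes at most Q + 1 values.  Scatteredness makes (b, y) -> v
   injective on the first curve and at most (q-1)-to-one on the second, with disjoint
   images.  On the other hand each curve has about Q such points, with an error of order
   q^s sqrt Q by the Riemann hypothesis for the double cover Y^2 - tau Y + nu, and
   n >= 4 s + 1 is what makes these images too large to fit.

   The Riemann hypothesis is proved in this special case with no algebraic geometry: the
   L-function of the quadratic character of the cover is a polynomial, Stepanov's method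
   bounds the character sums over the extensions of even degree, and a recurrence
   argument turns this into the bound on its inverse roots. *)
From HB Require Import structures.
Require Import Defs.
From mathcomp Require Import all_boot all_order all_algebra all_field.
From mathcomp Require Import qpoly ring lra zify.
Set Implicit Arguments. Unset Strict Implicit. Unset Printing Implicit Defensive.
Import Order.TTheory GRing.Theory Num.Theory.
Local Open Scope ring_scope.

(** * L-series and power sums *)

(** The factor [a] is forced. Let [sigma (bar x) = v sigma x] with [v] of norm 1. Then
    [f x = (1 + delta v) sigma x] is nonzero since [c <> 1], and [g l = f (l x) / f x] is
    sigma-semilinear over [K] and fixes 1. On the alternating form [<l, l'> = l bar l' - bar l l']
    the cross terms cancel, so [<g l, g l'> = (1 - c) / N(1 + delta v) * sigma <l, l'>]. If
    [g (bar z) = a bar z] with [a] in [K], the pair [(1, bar z)] gives [a = (1 - c) sigma(theta) /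
    (theta N(1 + delta v))] with [theta = z - bar z]. Restricting [z] to [b + omega] keeps [theta]
    constant, which is why [a] depends on [v] alone. A coincidence of values [v] within the first
    curve, or between the two curves, produces a nonzero [d] in [K] with [sigma d = a d]; then
    [l = bar z / d] satisfies [f (l x) = l f x] and lies outside [K]. On the second curve
    [d = 1 / b] is unique up to a factor in [F_q], whence the fibres of size at most [q - 1]. The
    inequality to refute is roughly [Q + Q / (q - 1) <= Q + 1]. *)

Section MonicPolynomials.
Variable K : finFieldType.
Implicit Types (P R D : {poly K}) (k d i j : nat).

Definition mon k : seq {poly K} := [seq 'X^k + rVpoly v | v : 'rV[K]_k].
Definition Irr d : seq {poly K} := [seq P <- mon d | irreducibleb P].

Lemma mem_mon k P : (P \in mon k) = (P \is monic) && (size P == k.+1).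
Proof.
apply/mapP/andP => [[v _ ->]|[mP /eqP sP]].
  have s : (size (rVpoly v) < size ('X^k : {poly K}))%N.
    by rewrite size_polyXn ltnS size_poly.
  by rewrite monicE lead_coefDl // lead_coefXn size_polyDl // size_polyXn.
exists (poly_rV (P - 'X^k)); first by rewrite mem_enum.
rewrite poly_rV_K; first by rewrite addrC subrK.
apply/leq_sizeP => i; rewrite leq_eqVlt coefB coefXn => /orP[/eqP <-|lt_ki].
  by rewrite eqxx; move: mP; rewrite monicE lead_coefE sP => /eqP ->; rewrite subrr.
by rewrite nth_default ?sP // gtn_eqF // subr0.
Qed.

Lemma uniq_mon k : uniq (mon k).
Proof.
rewrite map_inj_uniq ?enum_uniq // => u v /addrI /(congr1 (@poly_rV _ k)).
by rewrite !rVpolyK.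
Qed.

Lemma size_mon k : size (mon k) = (#|K| ^ k)%N.
Proof. by rewrite size_map -cardE card_mx mul1n. Qed.

Lemma mon0 : mon 0 = [:: 1].
Proof.
have := size_mon 0; rewrite expn0; have := mem_mon 0 1.
rewrite monic1 size_poly1 eqxx /=; case: (mon 0) => [|P [|? ?]] //.
by rewrite inE => /eqP <-.
Qed.

Lemma mem_Irr d P : (P \in Irr d) = (P \in mon d) && irreducibleb P.
Proof. by rewrite mem_filter andbC. Qed.

Lemma uniq_Irr d : uniq (Irr d).
Proof. exact/filter_uniq/uniq_mon. Qed.

Lemma monM k d P R : P \in mon k -> R \in mon d -> P * R \in mon (k + d).
Proof.
rewrite !mem_mon => /andP[mP /eqP sP] /andP[mR /eqP sR].
rewrite monicMl // mR size_Mmonic ?monic_neq0 // sP sR; apply/eqP; lia.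
Qed.

Lemma mon_divK k d P D : D \in mon d -> P \in mon k -> D %| P ->
  exists2 R, P = D * R & (d <= k)%N /\ R \in mon (k - d).
Proof.
move=> Dd Pk /dvdpP[R defP]; exists R; first by rewrite mulrC.
move: Dd Pk; rewrite !mem_mon => /andP[mD /eqP sD] /andP[mP /eqP sP].
have mR : R \is monic by rewrite -(monicMr R mD) -defP.
move: sP; rewrite defP mulrC size_Mmonic ?monic_neq0 // sD => sRd.
have : (0 < size R)%N by rewrite size_poly_gt0 monic_neq0.
by rewrite mR /=; move: sRd; move: (size R) => m; split; [|apply/eqP]; lia.
Qed.

Lemma sum_mon_dvd (V : nmodType) k d D (F : {poly K} -> V) : D \in mon d ->
  \sum_(P <- mon k | D %| P) F P
    = if (d <= k)%N then \sum_(R <- mon (k - d)) F (D * R) else 0.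
Proof.
move=> Dd; have [mD _] := andP (etrans (esym (mem_mon _ _)) Dd).
case: leqP => [le_dk|lt_kd]; last first.
  rewrite big_seq_cond big1 // => P /andP[Pk dvP].
  by have [R _ [le_dk _]] := mon_divK Dd Pk dvP; lia.
rewrite -big_filter -[RHS](big_map (fun R => D * R) predT F).
apply: perm_big; apply: uniq_perm.
- exact/filter_uniq/uniq_mon.
- by rewrite map_inj_uniq ?uniq_mon //; apply: mulfI; apply: monic_neq0.
move=> P; rewrite mem_filter; apply/andP/mapP => [[dvP Pk]|[R Rk ->]].
  by have [R -> [_ ?]] := mon_divK Dd Pk dvP; exists R.
by rewrite dvdp_mulr //; split=> //; rewrite -(subnKC le_dk) monM.
Qed.

Lemma IrrP d P : P \in Irr d -> [/\ P \is monic, size P = d.+1 & irreducible_poly P].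
Proof. by rewrite mem_Irr mem_mon => /andP[/andP[mP /eqP sP] /irreducibleP]. Qed.

Lemma ex_irr_dvd k P : P \in mon k -> (0 < k)%N ->
  exists d D, [/\ (0 < d)%N, D \in Irr d & D %| P].
Proof.
move=> Pk k0; have ex : exists d, (0 < d)%N && has (fun D => D %| P) (mon d).
  by exists k; rewrite k0; apply/hasP; exists P => //; apply: dvdpp.
case: (ex_minnP ex) => d /andP[d0 /hasP[D Dd DP]] min_d.
exists d, D; split=> //; rewrite mem_Irr Dd; apply/irreducibleP.
move: Dd; rewrite mem_mon => /andP[mD /eqP sD]; split=> [|q sq qD]; first by rewrite sD.
have q0 : q != 0 by apply: contraTneq qD => ->; rewrite dvd0p monic_neq0.
have lq : lead_coef q != 0 by rewrite lead_coef_eq0.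
have sq1 : (1 < size q)%N.
  by move: q0 sq; rewrite -size_poly_gt0; case: (size q) => [|[]].
have : (d <= (size q).-1)%N.
  apply: min_d; rewrite -ltnS prednK ?sq1 ?(ltnW sq1) //=.
  apply/hasP; exists ((lead_coef q)^-1 *: q).
    rewrite mem_mon monicE lead_coefZ mulVf // eqxx size_scale ?invr_eq0 //.
    by rewrite (ltn_predK sq1) eqxx.
  by rewrite dvdpZl ?invr_eq0 // (dvdp_trans qD DP).
move=> ledq; rewrite -dvdp_size_eqp // eqn_leq dvdp_leq ?monic_neq0 //= sD.
by rewrite -(ltn_predK sq1) ltnS.
Qed.

Lemma irr_dvd_mul d e D E P j : D \in Irr d -> E \in Irr e -> D != E ->
  (D ^+ j %| E * P) = (D ^+ j %| P).
Proof.
move=> /IrrP[mD sD iD] /IrrP[mE sE iE] neq; rewrite Gauss_dvdpr //.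
apply: coprimep_expl; rewrite irreducible_poly_coprime //; apply: contra neq => dv.
have sD1 : size D != 1 by case: iD => + _; case: eqP => // ->.
by have := apply_irredp iE sD1 dv; rewrite eqp_monic.
Qed.

(** Unique factorisation as it enters a logarithmic derivative: the multiplicity of [D] is the
    number of its powers dividing [P]. The cutoff [N] is independent of [k], so the induction can
    remove one irreducible factor without changing any range. *)
Lemma irr_mult_sum N k P : P \in mon k -> (k <= N)%N ->
  (\sum_(1 <= d < N.+1) \sum_(D <- Irr d) \sum_(1 <= j < N.+1) d * (D ^+ j %| P)%R = k)%N.
Proof.
elim/ltn_ind: k P => k IH P Pk leN.
have [k0|k0] := posnP k.
  move: Pk; rewrite k0 mon0 inE => /eqP ->.
  rewrite big_nat big1 // => d /andP[d0 _]; rewrite big_seq big1 // => D /IrrP[mD sD iD].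
  rewrite big_nat big1 // => j /andP[j0 _].
  case: (boolP (_ %| _)%R); rewrite ?muln0 // dvdp1 => /eqP s1.
  by have := size_exp D j; rewrite s1 sD /=; nia.
have [d0 [D0 [d0_gt0 D0d D0P]]] := ex_irr_dvd Pk k0.
have [D0mon _] := andP (etrans (esym (mem_Irr _ _)) D0d).
have [R defP [le_dk Rk]] := mon_divK D0mon Pk D0P.
have lt_k : (k - d0 < k)%N by lia.
have leN' : (k - d0 <= N)%N by lia.
rewrite -(subnKC le_dk) -(IH _ lt_k R Rk leN').
(* Removing one factor [D0] shifts its powers by one index. The index 0 gives the extra [d0], and
   the index [N] contributes nothing, as [D0 ^+ N] has larger degree than [R]. *)
have aux d D : D \in Irr d -> (\sum_(1 <= j < N.+1) d * (D ^+ j %| P)%R =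
   (if D == D0 then d0 else 0) + \sum_(1 <= j < N.+1) d * (D ^+ j %| R)%R)%N.
  move=> Dd; case: eqP => [eqD|/eqP neq]; last first.
    by rewrite add0n; apply: eq_bigr => j _; rewrite defP (irr_dvd_mul _ _ Dd D0d neq).
  have eqd : d = d0.
    by have [_ + _] := IrrP Dd; have [_ sD0 _] := IrrP D0d; rewrite eqD sD0 => [[]].
  rewrite eqD eqd -!big_distrr /= -mulnS; congr (_ * _)%N.
  rewrite big_add1 /= big_mkord.
  rewrite (eq_bigr (fun j : 'I_N => ((D0 ^+ j %| R)%R : nat))) => [|j _]; last first.
    by rewrite defP exprS dvdp_mul2l //; have [/monic_neq0 ? _ _] := IrrP D0d.
  rewrite -(big_mkord predT (fun j => ((D0 ^+ j %| R)%R : nat))).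
  have N0 : (0 < N)%N by lia.
  rewrite [LHS]big_ltn //= expr0 dvd1p add1n; congr _.+1.
  rewrite [RHS]big_nat_recr //=; case: (boolP (D0 ^+ N %| R)); rewrite ?addn0 // => dv.
  exfalso; move: Rk; rewrite mem_mon => /andP[mR /eqP sR].
  have := dvdp_leq (monic_neq0 mR) dv; rewrite sR.
  have [/monic_neq0 D00 sD0 _] := IrrP D0d.
  have := size_exp D0 N; rewrite sD0 /=.
  have : (0 < size (D0 ^+ N))%N by rewrite size_poly_gt0 expf_neq0.
  move: (size (D0 ^+ N)) => z; nia.
have lt0 : (1 <= d0 < N.+1)%N by lia.
under eq_bigr => d _.
  rewrite big_seq; under eq_bigr => D Dd do rewrite (aux d D Dd).
  rewrite -big_seq big_split /=; over.
rewrite big_split /=; congr addn.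
rewrite (bigD1_seq d0) ?iota_uniq ?mem_index_iota //= (bigD1_seq D0) ?uniq_Irr //= eqxx.
rewrite [X in (_ + X + _)%N]big1 ?addn0 => [|D /negPf -> //].
rewrite big1 ?addn0 // => d neq; rewrite big_seq big1 // => D Dd.
case: eqP => // eqD; case/eqP: neq.
have [_ + _] := IrrP Dd; have [_ sD0 _] := IrrP D0d.
by rewrite eqD sD0 => [[]].
Qed.

Section LSeries.
Variable X : {poly K} -> int.
Hypothesis XM : forall P R, X (P * R) = X P * X R.
Hypothesis X1 : X 1 = 1.

Definition Lcoef k : int := \sum_(P <- mon k) X P.
(** The coefficient of [T^i] in [T L'(T) / L(T)], read off the Euler product of
    [L(T) = sum_k Lcoef k T^k]. *)
Definition Lsum i : int :=
  \sum_(1 <= d < i.+1 | (d %| i)%N) \sum_(D <- Irr d) X D ^+ (i %/ d) *+ d.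

Lemma X_exp P j : X (P ^+ j) = X P ^+ j.
Proof. by elim: j => [|j IH]; rewrite ?expr0 ?X1 // !exprS XM IH. Qed.

Lemma sum_nat_dvd (V : nmodType) d k (g : nat -> nat -> V) : (0 < d)%N ->
  \sum_(1 <= j < k.+1) (if (d * j <= k)%N then g (d * j)%N j else 0)
   = \sum_(1 <= i < k.+1 | (d %| i)%N) g i (i %/ d)%N.
Proof.
move=> d0; rewrite -big_mkcond /= -big_filter -[RHS]big_filter.
rewrite (eq_bigr (fun j => g (d * j)%N (d * j %/ d)%N)) => [|j _]; last by rewrite mulKn.
rewrite -(big_map (fun j => d * j)%N predT (fun i => g i (i %/ d)%N)).
apply: perm_big; apply: uniq_perm; rewrite ?filter_uniq ?iota_uniq //.
  rewrite map_inj_uniq ?filter_uniq ?iota_uniq // => a b /eqP.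
  by rewrite eqn_pmul2l // => /eqP.
move=> i; rewrite mem_filter mem_index_iota.
apply/mapP/andP => [[j]|[/dvdnP[j ->] ji]].
  rewrite mem_filter mem_index_iota => /andP[le /andP[j0 _]] ->.
  by rewrite dvdn_mulr //; split=> //; nia.
exists j; last by rewrite mulnC.
by rewrite mem_filter mem_index_iota; apply/andP; split; nia.
Qed.

(** The identity [T L' = L * (T L' / L)] by double counting: each [P] is weighted by its degree in
    the form of [irr_mult_sum], and the multiples of [D ^+ j] are then divided by it. *)
Lemma Lcoef_newton k :
  Lcoef k *+ k = \sum_(1 <= i < k.+1) Lsum i * Lcoef (k - i).
Proof.
transitivity (\sum_(P <- mon k) \sum_(1 <= d < k.+1) \sum_(D <- Irr d)
    \sum_(1 <= j < k.+1) (if D ^+ j %| P then X P *+ d else 0)).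
  rewrite /Lcoef -sumrMnl big_seq [RHS]big_seq; apply: eq_bigr => P Pk.
  rewrite -{1}(irr_mult_sum Pk (leqnn k)) -sumrMnr; apply: eq_bigr => d _.
  rewrite -sumrMnr; apply: eq_bigr => D _; rewrite -sumrMnr; apply: eq_bigr => j _.
  by case: ifP => _; rewrite ?muln1 ?muln0.
rewrite exchange_big /=.
transitivity (\sum_(1 <= d < k.+1) \sum_(D <- Irr d)
    \sum_(1 <= i < k.+1 | (d %| i)%N) X D ^+ (i %/ d) * Lcoef (k - i) *+ d).
  rewrite big_nat [RHS]big_nat; apply: eq_bigr => d /andP[d0 _].
  rewrite exchange_big /= big_seq [RHS]big_seq; apply: eq_bigr => D Dd.
  rewrite exchange_big /=.
  rewrite -(sum_nat_dvd k (fun i j => X D ^+ j * Lcoef (k - i) *+ d) d0).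
  apply: eq_bigr => j _; rewrite -big_mkcond /=.
  have Dj : D ^+ j \in mon (d * j).
    have [Dm _] := andP (etrans (esym (mem_Irr _ _)) Dd).
    elim: j => [|j IH]; first by rewrite muln0 mon0 expr0 inE.
    by rewrite exprS mulnS monM.
  rewrite (sum_mon_dvd _ _ Dj); case: ifP => // _.
  under eq_bigr => R _ do rewrite XM X_exp.
  by rewrite sumrMnl /Lcoef mulr_sumr.
rewrite /Lsum; under [RHS]eq_bigr => i _ do rewrite mulr_suml.
rewrite [RHS](eq_big_nat _ _ (F2 := fun i => \sum_(1 <= d < k.+1 | (d %| i)%N)
   (\sum_(D <- Irr d) X D ^+ (i %/ d) *+ d) * Lcoef (k - i))); last first.
  move=> i /andP[i0 lei]; rewrite [RHS](big_cat_nat (n := i.+1)) //=.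
  rewrite [X in _ + X]big_nat_cond [X in _ + X]big1 ?addr0 // => d /andP[/andP[d1 _] dv].
  by have := dvdn_leq i0 dv; lia.
under [RHS]eq_bigr => i _ do rewrite big_mkcond.
rewrite [RHS]exchange_big /=; apply: eq_bigr => d _.
under [RHS]eq_bigr => i _ do rewrite mulr_suml.
rewrite -big_mkcond exchange_big /=; apply: eq_bigr => i _; apply: eq_bigr => D _.
by rewrite mulrnAl.
Qed.
End LSeries.

(** For the trivial character the L-series is the geometric series of ratio [#|K|], and the
    recurrence determines the sums one after the other. This is the exact prime polynomial
    theorem. *)
Lemma Lsum1 i : (0 < i)%N -> Lsum (fun=> 1) i = (#|K| ^ i)%N%:R.
Proof.
have Lc k : Lcoef (fun=> 1) k = (#|K| ^ k)%N%:R.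
  by rewrite /Lcoef big_const_seq count_predT size_mon iter_addr_0.
elim/ltn_ind: i => i IH i0.
have := Lcoef_newton (fun _ _ => esym (mulr1 1)) erefl i.
case: i i0 IH => // i _ IH.
rewrite big_nat_recr //= subnn !Lc expn0 mulr1.
rewrite (eq_big_nat _ _ (F2 := fun=> (#|K| ^ i.+1)%N%:R)).
  rewrite sumr_const_nat subn1 /= mulrSr => /addrI -> //.
move=> j /andP[j0 lej]; rewrite IH // Lc -natrM -expnD; congr (_ ^ _)%N%:R; lia.
Qed.

End MonicPolynomials.

(** * Newton's identities and the growth of power sums *)

Section PowerSums.
Variable F : comNzRingType.
Implicit Types (r : seq F) (k i : nat).

Definition rprod r : {poly F} := \prod_(z <- r) (1 - z *: 'X).
Definition psum r i : F := \sum_(z <- r) z ^+ i.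

Lemma coef_rprod_cons z r k :
  (rprod (z :: r))`_k = (rprod r)`_k - (if k is k'.+1 then z * (rprod r)`_k' else 0).
Proof.
rewrite /rprod big_cons mulrBl mul1r coefB -scalerAl coefZ coefXM.
by case: k => [|k] /=; rewrite ?mulr0.
Qed.

Lemma rprod_coef_out r k : (size r < k)%N -> (rprod r)`_k = 0.
Proof.
elim: r k => [|z r IH] [|k] //= lt_k; first by rewrite /rprod big_nil coef1.
by rewrite coef_rprod_cons !IH ?mulr0 ?subr0 //; apply: ltnW.
Qed.

Lemma coef_prod_XsubC_rev r k : (k <= size r)%N ->
  (\prod_(z <- r) ('X - z%:P))`_(size r - k) = (rprod r)`_k.
Proof.
elim: r k => [|z r IH] k.
  by rewrite leqn0 => /eqP ->; rewrite /rprod !big_nil !coef1.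
rewrite coef_rprod_cons big_cons mulrBl coefB coefXM coefCM.
case: k => [|k]; rewrite [size (z :: r)]/= => le_k.
  rewrite !subn0 /= -IH // subn0 [in z * _]nth_default ?mulr0 //.
  by rewrite size_prod_XsubC.
rewrite subSS; case: (posnP (size r - k)) => [r0|r0].
  rewrite r0 /= sub0r; have -> : k = size r by lia.
  by rewrite -(IH (size r)) // subnn rprod_coef_out // sub0r.
rewrite -subnS !IH //; lia.
Qed.

(** Newton's identities, adding one root at a time; the geometric contribution of the new root
    telescopes against [1 - z X]. *)
Lemma rprod_newton r k :
  (rprod r)`_k.+1 *+ k.+1 = - \sum_(i < k.+1) psum r i.+1 * (rprod r)`_(k - i).
Proof.
elim: r k => [|z r IH] k.
  rewrite {1}/rprod big_nil coef1 mul0rn big1 ?oppr0 // => i _.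
  by rewrite /psum big_nil mul0r.
set g := rprod r in IH *; set g' := rprod (z :: r).
have g'0 : g'`_0 = g`_0 by rewrite coef_rprod_cons subr0.
have g'S m : g'`_m.+1 = g`_m.+1 - z * g`_m by rewrite coef_rprod_cons.
have tele m : \sum_(i < m.+1) z ^+ i.+1 * g'`_(m - i) = z * g`_m.
  elim: m => [|m IHm]; first by rewrite big_ord1 g'0 expr1.
  rewrite big_ord_recl subn0 expr1 g'S.
  rewrite (eq_bigr (fun i : 'I_m.+1 => z * (z ^+ i.+1 * g'`_(m - i)))) => [|i _].
    by rewrite -mulr_sumr IHm; ring.
  by rewrite /= /bump /= add1n subSS (exprS z i.+1) mulrA.
under eq_bigr => i _ do rewrite /psum big_cons -/(psum r _) mulrDl.
rewrite big_split /= tele opprD.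
have shift : \sum_(i < k.+1) psum r i.+1 * g'`_(k - i)
   = \sum_(i < k.+1) psum r i.+1 * g`_(k - i) + z * (g`_k *+ k).
  case: k => [|k]; first by rewrite !big_ord1 g'0 mulr0n mulr0 addr0.
  rewrite IH mulrN mulr_sumr [in LHS]big_ord_recr [in RHS]big_ord_recr /= subnn g'0.
  rewrite addrAC; congr (_ + _); rewrite -sumrB; apply: eq_bigr => i _.
  by rewrite subSn ?(ltnW (ltn_ord i)) -1?ltnS ?ltn_ord // g'S; ring.
by rewrite shift opprD -IH g'S mulrnBl mulrSr mulrnAr; ring.
Qed.
End PowerSums.

Section Growth.
Implicit Types (x y z : algC).

Lemma bernoulli_ge x k : 1 <= x -> 1 + (x - 1) * k%:R <= x ^+ k.
Proof.
move=> x1; have x0 : 0 <= x by apply: le_trans x1.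
elim: k => [|k IH]; first by rewrite mulr0 addr0 expr0.
rewrite exprS; apply: le_trans (ler_wpM2l x0 IH).
rewrite -subr_ge0 (_ : _ - _ = (x - 1) ^+ 2 * k%:R); last by rewrite -natr1; ring.
by rewrite mulr_ge0 ?exprn_even_ge0 ?ler0n // -realEsqr rpredB ?ger0_real.
Qed.

Lemma le_of_expr_bound (x q M : algC) k0 : 0 <= x -> 0 < q ->
  (forall k, (k0 <= k)%N -> x ^+ k <= M * q ^+ k) -> x <= q.
Proof.
move=> x0 q0 bnd; rewrite -(divfK (lt0r_neq0 q0) x) -[leRHS]mul1r ler_pM2r //.
set y := x / q; have y0 : 0 <= y by rewrite divr_ge0 // ltW.
have {}bnd k : (k0 <= k)%N -> y ^+ k <= M.
  by move=> /bnd; rewrite /y expr_div_n ler_pdivrMr // exprn_gt0.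
rewrite real_leNgt ?ger0_real ?ler01 //; apply/negP => y1.
have d0 : 0 < y - 1 by rewrite subr_gt0.
have M0 : 0 <= M by apply: le_trans (bnd _ (leqnn k0)); rewrite exprn_ge0.
pose N := Num.bound (M / (y - 1)).
have := archi_boundP (divr_ge0 M0 (ltW d0)); rewrite -/N ltr_pdivrMr // => ltM.
have leN : N%:R <= (maxn k0 N)%:R :> algC by rewrite ler_nat leq_maxr.
have := bnd _ (leq_maxl k0 N); apply/negP; rewrite -real_ltNge ?ger0_real ?exprn_ge0 //.
apply: lt_le_trans (bernoulli_ge _ (ltW y1)); apply: lt_le_trans ltM _.
rewrite mulrC; apply: le_trans (ler_wpM2l (ltW d0) leN) _.
by rewrite lerDr ler01.
Qed.

(* Evaluating a linear recurrence at the polynomial vanishing at all the other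
   squared roots isolates the powers of one of them. *)
Lemma psum_even_bound (r : seq algC) (q C : algC) k0 : 0 < q ->
  (forall k, (k0 <= k)%N -> `|psum r k.*2| <= C * q ^+ k) ->
  forall z, z \in r -> `|z| ^+ 2 <= q.
Proof.
move=> q0 bnd z zr; set b := z ^+ 2.
pose s := [seq w ^+ 2 | w <- r].
pose h : {poly algC} := \prod_(w <- [seq w <- s | w != b]) ('X - w%:P).
have hb : h.[b] != 0.
  rewrite -rootE root_prod_XsubC mem_filter eqxx //.
have hw w : w \in s -> w != b -> h.[w] = 0.
  by move=> ws wb; apply/eqP; rewrite -rootE root_prod_XsubC mem_filter wb.
have bs : b \in s by apply: map_f.
pose m := count_mem b s.
have m0 : m%:R != 0 :> algC by rewrite pnatr_eq0 -lt0n -has_count has_pred1.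
have key k : \sum_(j < size h) h`_j * psum r (k + j).*2 = m%:R * h.[b] * b ^+ k.
  transitivity (\sum_(w <- s) h.[w] * w ^+ k).
    rewrite big_map /psum.
    under [LHS]eq_bigr => j _ do rewrite mulr_sumr.
    rewrite exchange_big /=; apply: eq_bigr => w _.
    rewrite horner_coef mulr_suml; apply: eq_bigr => j _.
    by rewrite -mulrA -exprD -!exprM mul2n addnC.
  rewrite (bigID (pred1 b)) /= [X in _ + X]big_seq_cond [X in _ + X]big1 ?addr0.
    by rewrite (eq_bigr (fun=> h.[b] * b ^+ k)) => [|w /eqP -> //];
       rewrite big_const_seq iter_addr_0 -/m -mulrA mulr_natl.
  by move=> w /andP[ws wb]; rewrite hw ?mul0r.
have c0 : 0 < `|m%:R * h.[b]| by rewrite normr_gt0 mulf_neq0.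
pose M := (\sum_(j < size h) `|h`_j| * C * q ^+ j) / `|m%:R * h.[b]|.
have b2 : `|z| ^+ 2 = `|b| by rewrite normrX.
rewrite b2; apply: (@le_of_expr_bound _ _ M k0) => // k le_k.
rewrite /M mulrAC ler_pdivlMr // -normrX -normrM mulrC -key.
apply: le_trans (ler_norm_sum _ _ _) _; rewrite mulr_suml; apply: ler_sum => j _.
rewrite normrM -!mulrA ler_wpM2l // -exprD addnC [(j + k)%N]addnC.
by apply: bnd; apply: leq_trans (leq_addr _ _).
Qed.

(** [A] and [S] play the coefficients of a polynomial L-series and of its logarithmic derivative, so
    [S i] is minus the [i]-th power sum of the inverse roots. A bound on the even power sums alone
    forces every inverse root to have modulus at most [sqrt q], and there are [D] of them. *)
Lemma newton_growth (A S : nat -> int) (D q C k0 : nat) : (0 < q)%N ->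
  A 0 = 1 -> (forall k, (D < k)%N -> A k = 0) ->
  (forall k, A k *+ k = \sum_(1 <= i < k.+1) S i * A (k - i)%N) ->
  (forall k, (k0 <= k)%N -> `|S k.*2| <= (C * q ^ k)%N%:R) ->
  S 1%N ^+ 2 <= (D ^ 2 * q)%N%:R.
Proof.
move=> q0 A0 AD newt bnd.
(* The reversed polynomial is monic of degree exactly [D] because [A 0 = 1]; if [A] stops earlier,
   the missing inverse roots are zeros, which change no power sum of positive index. *)
pose p : {poly algC} := \poly_(k < D.+1) (A (D - k)%N)%:~R.
have sp : size p = D.+1 by rewrite size_poly_eq // subnn A0 oner_eq0.
have [r defp] := closed_field_poly_normal p.
have lp : lead_coef p = 1.
  by rewrite lead_coefE sp coef_poly ltnSn subnn A0.
rewrite lp scale1r in defp.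
have sr : size r = D by apply: succn_inj; rewrite -sp defp size_prod_XsubC.
have Ar k : (A k)%:~R = (rprod r)`_k :> algC.
  case: (leqP k D) => leD.
    rewrite -coef_prod_XsubC_rev ?sr // -defp coef_poly ifT; last by lia.
    by rewrite subKn.
  by rewrite AD // rprod_coef_out // sr.
have Sr i : (S i.+1)%:~R = - psum r i.+1.
  elim/ltn_ind: i => i IH.
  have := rprod_newton r i; rewrite -Ar; have := newt i.+1.
  rewrite big_add1 /= big_mkord => /(congr1 (fun z : int => z%:~R : algC)).
  rewrite !rmorphMn /= => -> ; rewrite rmorph_sum /=.
  rewrite big_ord_recr [in RHS]big_ord_recr /= !subnn opprD.
  rewrite -!Ar A0 rmorphM /= rmorph1 !mulr1.
  rewrite (eq_bigr (fun j : 'I_i => - (psum r j.+1 * (rprod r)`_(i - j)))) => [|j _].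
    by rewrite sumrN => /addrI.
  by rewrite rmorphM /= IH // subSS Ar mulNr.
have qC : 0 < q%:R :> algC by rewrite ltr0n.
have root_bound z : z \in r -> `|z| ^+ 2 <= q%:R.
  apply: (@psum_even_bound r q%:R C%:R (maxn k0 1)) => // k.
  rewrite geq_max => /andP[le_k k1].
  have k2 : k.*2 = (k.*2.-1).+1 by lia.
  rewrite -normrN k2 -Sr -k2 -natrX -natrM -intr_norm.
  by rewrite [leRHS]pmulrn ler_int -natz bnd.
have root_bound' z : z \in r -> `|z| <= sqrtC q%:R.
  by move=> /root_bound; rewrite -ler_sqrtC ?nnegrE ?exprn_ge0 ?ler0n // sqrCK.
have : `|(S 1%N)%:~R : algC| <= D%:R * sqrtC q%:R.
  rewrite (Sr 0) normrN /psum; apply: le_trans (ler_norm_sum _ _ _) _.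
  apply: le_trans (_ : \sum_(z <- r) sqrtC q%:R <= _).
    by rewrite big_seq [leRHS]big_seq; apply: ler_sum => z; rewrite expr1; apply: root_bound'.
  by rewrite big_const_seq count_predT iter_addr_0 sr mulr_natl.
move=> h; rewrite -(ler_int algC) rmorphXn /= -real_normK ?realz //.
apply: le_trans (_ : (D%:R * sqrtC q%:R) ^+ 2 <= _).
  by rewrite ler_sqr ?nnegrE // mulr_ge0 ?ler0n // sqrtC_ge0 ler0n.
by rewrite natz exprMn sqrtCK -natrX -natrM.
Qed.
End Growth.

Lemma pchar_nat_card (K : finFieldType) : [pchar K].-nat #|K|.
Proof.
have [p pr_p pK] := finPcharP K.
have cardK : #|K| = (p ^ logn p #|K|)%N := card_pprimeChar pK.
by rewrite cardK pnatX pnatE // pK.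
Qed.

Lemma dvdp_irr_prod (K : finFieldType) (s : seq {poly K}) (h : {poly K}) :
  uniq s -> (forall D, D \in s -> D \is monic /\ irreducible_poly D) ->
  (forall D, D \in s -> D %| h) -> \prod_(D <- s) D %| h.
Proof.
elim: s => [|D s IH] /=; first by rewrite big_nil dvd1p.
move=> /andP[Ds us] irr dv; rewrite big_cons Gauss_dvdp; last first.
  rewrite big_seq; elim/big_ind: _ => [|P R cP cR|E Es].
  - exact: coprimep1.
  - by rewrite coprimepMr cP cR.
  have [mD iD] := irr _ (mem_head D s).
  have [mE iE] := irr E (mem_behead (s := D :: s) Es).
  rewrite irreducible_poly_coprime //; apply: contra Ds => DE.
  have sD1 : size D != 1 by case: iD => + _; case: eqP => // ->.
  by have := apply_irredp iE sD1 DE; rewrite eqp_monic // => /eqP ->.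
rewrite dv ?mem_head //= IH // => E Es; [apply: irr|apply: dv]; exact: mem_behead.
Qed.

(** * Roots of irreducible polynomials as Frobenius orbits *)

Section Points.
Variables (K : finFieldType) (W : closedFieldType) (iota : {rmorphism K -> W}).
Local Notation Q := #|K|.
Local Notation "p ^i" := (map_poly iota p) (at level 2, format "p ^i").
Implicit Types (x y a : W) (p h : {poly K}) (k d m : nat).

Lemma exprQD k x y : (x + y) ^+ (Q ^ k) = x ^+ (Q ^ k) + y ^+ (Q ^ k).
Proof.
apply: exprDn_pchar; rewrite pnatX.
by rewrite (eq_pnat _ (fmorph_pchar iota)) pchar_nat_card.
Qed.

Lemma exprQB k x y : (x - y) ^+ (Q ^ k) = x ^+ (Q ^ k) - y ^+ (Q ^ k).
Proof. by apply/eqP; rewrite eq_sym subr_eq -exprQD subrK. Qed.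

Lemma exprQ0 k : 0 ^+ (Q ^ k) = 0 :> W.
Proof. by rewrite expr0n expn_eq0 gtn_eqF // (ltn_trans _ (finNzRing_gt1 K)). Qed.

Lemma exprQ_inj k : injective (fun x => x ^+ (Q ^ k)).
Proof.
move=> x y /= eq_xy; apply/eqP; rewrite -subr_eq0.
suff : (x - y) ^+ (Q ^ k) == 0 by rewrite expf_eq0 => /andP[].
have := exprQD k (x - y) y; rewrite subrK eq_xy => /esym/eqP.
by rewrite -subr_eq0 addrK.
Qed.

Lemma iotaQ k (c : K) : iota c ^+ (Q ^ k) = iota c.
Proof.
elim: k => [|k IH]; first by rewrite expr1.
by rewrite expnS mulnC exprM IH -rmorphXn /= expf_card.
Qed.

Lemma hornerQ k p x : p^i.[x] ^+ (Q ^ k) = p^i.[x ^+ (Q ^ k)].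
Proof.
elim/poly_ind: p => [|p c IH]; first by rewrite rmorph0 !horner0 exprQ0.
rewrite rmorphD rmorphM /= map_polyX map_polyC /= !hornerMXaddC exprQD.
by rewrite exprMn IH iotaQ.
Qed.

Lemma fixQ_iota x : x ^+ Q = x -> exists c, x = iota c.
Proof.
move=> fx; have : root ('X^Q - 'X : {poly W}) x.
  by rewrite rootE !hornerE fx subrr.
have -> : 'X^Q - 'X = ('X^Q - 'X)^i by rewrite rmorphB /= map_polyXn map_polyX.
rewrite finField_genPoly rmorph_prod /=.
rewrite (eq_bigr (fun c => 'X - (iota c)%:P)) => [|c _]; last first.
  by rewrite rmorphB /= map_polyX map_polyC.
rewrite rootE horner_prod => /prodf_eq0[c _].
by rewrite !hornerE subr_eq0 => /eqP ->; exists c.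
Qed.

Definition frobW of {rmorphism K -> W} := fun x => x ^+ Q.
Local Notation frob := (frobW iota).

Lemma frobW_additive : zmod_morphism frob.
Proof.
move=> x y; rewrite /frobW; apply/eqP; rewrite eq_sym subr_eq.
by have := exprQD 1 (x - y) y; rewrite expn1 subrK => ->.
Qed.

Lemma frobW_multiplicative : monoid_morphism frob.
Proof. by split=> [|x y]; rewrite /frobW ?expr1n ?exprMn. Qed.

HB.instance Definition _ := GRing.isZmodMorphism.Build W W frob frobW_additive.
HB.instance Definition _ := GRing.isMonoidMorphism.Build W W frob frobW_multiplicative.

Lemma irr_dvd_root p h a : irreducible_poly p -> root p^i a -> root h^i a -> p %| h.
Proof.
move=> irr_p pa ha; apply: contraLR isT; rewrite -irreducible_poly_coprime //.
rewrite -(coprimep_map iota) => /coprimep_root /(_ pa).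
by rewrite -rootE ha.
Qed.

(** By pigeonhole among the roots of [p], the Frobenius orbit of [a] closes up after some least
    [e <= d]. The product over this orbit has coefficients fixed by Frobenius, hence descends to
    [K]; it is divisible by the irreducible [p], so [e = d]. *)
Lemma irr_root d p a : p \in Irr K d -> root p^i a ->
  a ^+ (Q ^ d) = a /\ p^i = \prod_(j < d) ('X - (a ^+ (Q ^ j))%:P).
Proof.
move=> /IrrP[mp sp ip] pa.
have p0 : p^i != 0 by rewrite map_poly_eq0 monic_neq0.
have rootQ j : root p^i (a ^+ (Q ^ j)) by rewrite rootE -hornerQ (rootP pa) exprQ0.
have ex : exists e, (0 < e <= d)%N && (a ^+ (Q ^ e) == a).
  have : ~~ uniq [seq a ^+ (Q ^ j) | j <- seq.iota 0 d.+1].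
    apply/negP => u; have := max_poly_roots p0 _ u.
    rewrite size_map size_iota size_map_poly sp ltnn => H; apply: notF; apply: H.
    by apply/allP => _ /mapP[j _ ->].
  case/(uniqPn a) => i [j [ij]]; rewrite size_map size_iota => jd.
  rewrite !(nth_map 0%N) ?size_iota ?(ltn_trans ij) // !nth_iota ?(ltn_trans ij) //.
  rewrite !add0n => eq_ij; exists (j - i)%N; apply/andP; split; first by lia.
  apply/eqP; apply: (@exprQ_inj i); rewrite /= -exprM -expnD subnK ?(ltnW ij) //.
case: (ex_minnP ex) => e /andP[/andP[e0 ed] /eqP ae] min_e {ex}.
pose r := \prod_(j < e) ('X - (a ^+ (Q ^ j))%:P).
have r_root : root r a.
  by rewrite rootE /r (bigD1 (Ordinal e0)) //= !hornerE /= expr1 subrr mul0r.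
have map_r : map_poly frob r = r.
  rewrite /r rmorph_prod /=.
  case: e e0 ed ae min_e @r r_root => // e e0 ed ae min_e r r_root.
  rewrite big_ord_recr [RHS]big_ord_recl [LHS]mulrC; congr (_ * _).
    by rewrite rmorphB /= map_polyX map_polyC /= /frobW -exprM -expnSr ae expn0 expr1.
  apply: eq_bigr => j _.
  by rewrite rmorphB /= map_polyX map_polyC /= /frobW -exprM -expnSr.
have rQ k : exists c, r`_k = iota c.
  by apply: fixQ_iota; rewrite -{2}map_r coef_map.
have [r0 def_r] : exists r0, r = r0^i.
  have ch k : {c | r`_k == iota c}.
    by apply: sigW; have [c ->] := rQ k; exists c.
  exists (\poly_(k < size r) sval (ch k)); apply/polyP => k.
  rewrite coef_map coef_poly; case: ltnP => [_|le]; last first.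
    by rewrite nth_default //; apply: esym (rmorph0 iota).
  by case: (ch k) => c /= /eqP.
have sr : size r = e.+1 by rewrite /r size_prod_XsubC /index_enum -enumT size_enum_ord.
have mr : r0 \is monic by rewrite -(map_monic iota) -def_r monic_prod_XsubC.
have pr : p %| r0 by apply: irr_dvd_root ip pa _; rewrite -def_r.
have sr0 : size r0 = e.+1 by rewrite -(size_map_poly iota) -def_r.
have de : d = e.
  apply/eqP; rewrite eqn_leq ed andbT -ltnS -sp -sr0.
  by rewrite dvdp_leq // monic_neq0.
have -> : p = r0.
  by apply/eqP; rewrite -eqp_monic // -dvdp_size_eqp // sp sr0 de.
by rewrite -def_r de.
Qed.

Lemma irr_root_exprQ d m p a : p \in Irr K d -> root p^i a -> (d %| m)%N ->
  a ^+ (Q ^ m) = a.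
Proof.
move=> pd pa /dvdnP[j ->]; have [ad _] := irr_root pd pa.
elim: j => [|j IH]; first by rewrite mul0n expn0 expr1.
by rewrite mulSn expnD exprM ad.
Qed.

Lemma irr_ex_root d p : p \in Irr K d -> (0 < d)%N -> exists a, root p^i a.
Proof.
move=> /IrrP[mp sp _] d0; apply: closed_rootP.
by rewrite size_map_poly sp; case: d d0 {sp}.
Qed.
End Points.

(** * Stepanov's method for a double cover of the line *)

Lemma ex_lin_dep (K : fieldType) (T : finType) (e : T -> {poly K}) M :
  (forall t, (size (e t) <= M)%N) -> (M < #|T|)%N ->
  exists2 z : T -> K, (exists t, z t != 0) & \sum_t z t *: e t = 0.
Proof.
move=> size_e ltM.
pose A := \matrix_(n < #|T|, m < M) (e (enum_val n))`_m.
have : kermx A != 0.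
  rewrite kermx_eq0 /row_free neq_ltn (leq_ltn_trans (rank_leq_col _)) //.
case/rowV0Pn => v /sub_kermxP vA v0.
exists (fun t => v 0 (enum_rank t)).
  have [n vn] : exists n, v 0 n != 0 by apply/rV0Pn.
  by exists (enum_val n); rewrite enum_valK.
apply/polyP => m; rewrite coef_sum coef0.
have [lt_m|le_m] := ltnP m M; last first.
  by rewrite big1 // => t _; rewrite coefZ nth_default ?mulr0 // (leq_trans (size_e t)).
have /(congr1 (fun B : 'rV_M => B 0 (Ordinal lt_m))) := vA.
rewrite !mxE => vA0; rewrite -[RHS]vA0.
rewrite (reindex (@enum_val T predT)) /=; last by apply: onW_bij; apply: enum_val_bij.
by apply: eq_bigr => n _; rewrite !mxE coefZ enum_valK.
Qed.

Lemma poly_eq0_closed (W : closedFieldType) (p : {poly W}) :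
  (forall a, p.[a] = 0) -> p = 0.
Proof.
move=> p0; apply/eqP; apply: contraT => pn0.
have [s1|s1] := eqVneq (size p) 1.
  have /eqP/size_poly1P[c c0 ec] := s1.
  by have := p0 0; rewrite ec hornerC => /eqP; rewrite (negPf c0).
have s2 : size (p + 1) = size p.
  rewrite size_polyDl // size_poly1 ltn_neqAle eq_sym s1 /=.
  by rewrite size_poly_gt0.
have : size (p + 1) != 1 by rewrite s2.
case/closed_rootP => a; rewrite rootE hornerD hornerC p0 add0r.
by rewrite oner_eq0.
Qed.

(** With inner degree below [r], the coefficients of [P] fill disjoint blocks of exponents after the
    substitution. *)
Lemma horner_Xn_inj (F : fieldType) (P : {poly {poly F}}) r :
  (forall j, (size (P`_j)%R <= r)%N) -> P.['X^r] = 0 -> P = 0.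
Proof.
elim/poly_ind: P => [|P c IH] // sz; rewrite hornerMXaddC => eq0.
have szc : (size c <= r)%N.
  by have := sz 0%N; rewrite coefD coefMX coefC /= add0r.
have sP j : (size (P`_j)%R <= r)%N.
  by have := sz j.+1; rewrite coefD coefMX coefC /= addr0.
have PX0 : P.['X^r] = 0.
  apply/eqP; apply: contraT => P0.
  have : (size c < size (P.['X^r] * 'X^r)%R)%N.
    by rewrite size_mulXn // (leq_ltn_trans szc) // -addn1 leq_add2l size_poly_gt0.
  move/eqP: eq0; rewrite addr_eq0 => /eqP ->; rewrite size_polyN ltnn //.
move: eq0; rewrite PX0 mul0r add0r => ->.
by rewrite (IH sP PX0) mul0r addr0.
Qed.

Lemma quad_form_eq0 (R : idomainType) (u v s t n : R) :
  u ^+ 2 + u * v * s * t + v ^+ 2 * n = 0 -> v = 0 -> u = 0.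
Proof.
move=> + v0; rewrite v0 !expr2 !(mulr0, mul0r, addr0) => /eqP.
by rewrite mulf_eq0 orbb => /eqP.
Qed.

Section Stepanov.
Variables (K : finFieldType) (W : closedFieldType) (iota : {rmorphism K -> W}).
Variables (tau nu : {poly K}) (w : nat).
Local Notation Q := #|K|.
Local Notation "p ^i" := (map_poly iota p) (at level 2, format "p ^i").
Hypothesis size_tau : (size tau <= w.+1)%N.
Hypothesis size_nu : (size nu <= w.*2.+1)%N.

Definition quad_root (a y : W) := y ^+ 2 - tau^i.[a] * y + nu^i.[a] == 0.

Lemma ex_quad_root a : exists y, quad_root a y.
Proof.
have : size (('X - tau^i.[a]%:P) * 'X + nu^i.[a]%:P) != 1.
  by rewrite size_MXaddC polyXsubC_eq0 /= size_XsubC.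
case/closed_rootP => y; rewrite rootE !hornerE => e.
by exists y; rewrite /quad_root -(eqP e); apply/eqP; ring.
Qed.

Lemma quad_rootQ k a y : quad_root a y -> quad_root (a ^+ (Q ^ k)) (y ^+ (Q ^ k)).
Proof.
move=> /eqP e; have {}e : y ^+ 2 + nu^i.[a] = tau^i.[a] * y.
  by apply/eqP; rewrite -subr_eq0 -[X in _ == X]e; apply/eqP; ring.
move/(congr1 (fun z => z ^+ (Q ^ k))): e; rewrite (exprQD iota) exprMn !hornerQ.
by move=> e; rewrite /quad_root expr2 addrAC e exprMn hornerQ subrr.
Qed.

Lemma quad_root_uniq a y z : quad_root a y -> quad_root a z ->
  z = y \/ z = tau^i.[a] - y.
Proof.
move=> /eqP ey /eqP ez.
have : (z - y) * (z - (tau^i.[a] - y)) == 0.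
  by apply/eqP; rewrite -[RHS](subrr 0) -{1}ez -ey; ring.
by rewrite mulf_eq0 !subr_eq0 => /orP[] /eqP; [left | right].
Qed.

(** For [j = r] a power of [#|K|] this yields the function that Stepanov's polynomial needs besides
    [X] and [X^r]: it involves [y] and its Frobenius image, yet lies in [K[X]] with degree at most
    [(r + 1) w]. Carrying pairs of consecutive terms makes the recursion structural. *)
Fixpoint lucas2 j : {poly K} * {poly K} :=
  if j is j'.+1 then let: (p, q) := lucas2 j' in (q, tau * q - nu * p)
  else (tau, nu *+ 2).
Definition lucas j := (lucas2 j).1.

Lemma lucasSS j : lucas j.+2 = tau * lucas j.+1 - nu * lucas j.
Proof. by rewrite /lucas /=; case: (lucas2 j). Qed.

Lemma size_lucas j : (size (lucas j) <= (j.+1 * w).+1)%N.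
Proof.
suff : (size (lucas j) <= (j.+1 * w).+1)%N /\ (size (lucas j.+1) <= (j.+2 * w).+1)%N.
  by case.
elim: j => [|j [IH1 IH2]].
  by rewrite /lucas /= mul1n size_tau mul2n -scaler_nat (leq_trans (size_scale_leq _ _)).
split=> //; rewrite lucasSS (leq_trans (size_polyD _ _)) // size_polyN geq_max.
apply/andP; split; apply: leq_trans (size_polyMleq _ _) _.
  by move: size_tau IH2; move: (size tau) (size (lucas j.+1)) => u v; nia.
by move: size_nu IH1; move: (size nu) (size (lucas j)) => u v; nia.
Qed.

(* With [y] and [y'] the two roots above [a], [lucas j] is [y y'^j + y' y^j]. *)
Lemma lucasE j a y : quad_root a y ->
  (lucas j)^i.[a] = y * (tau^i.[a] - y) ^+ j + (tau^i.[a] - y) * y ^+ j.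
Proof.
move=> qy; set t := tau^i.[a]; set y' := t - y.
have eqnu : nu^i.[a] = y * y'.
  by move/eqP: qy => qy; apply/eqP; rewrite -subr_eq0 -[X in _ == X]qy /y' /t; apply/eqP; ring.
have eqt : t = y + y' by rewrite /y'; ring.
suff : (lucas j)^i.[a] = y * y' ^+ j + y' * y ^+ j /\
       (lucas j.+1)^i.[a] = y * y' ^+ j.+1 + y' * y ^+ j.+1 by case.
elim: j => [|j [IH1 IH2]].
  by rewrite /lucas /= rmorphMn hornerMn eqnu -/t eqt !expr0 !expr1; split; ring.
split=> //; rewrite lucasSS rmorphB !rmorphM /= hornerD hornerN !hornerM IH1 IH2 -/t eqnu.
by rewrite eqt !exprS; ring.
Qed.

(* [eta] specialises the Frobenius-twisted copy of the variable, so this says that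
   [Y^2 - tau Y + nu] at the two generic points [x], [eta] has no common splitting. *)
Definition quad_indep (eta : W) := forall u v : {poly W},
  u ^+ 2 + u * v * tau^i * (tau^i.[eta])%:P
  + v ^+ 2 * ((nu^i.[eta])%:P * (tau^i ^+ 2 - nu^i *+ 2)
              + nu^i * (tau^i.[eta] ^+ 2 - nu^i.[eta] *+ 2)%:P) = 0 -> v = 0.

Section BivariatePolynomials.
Variables (I J r : nat) (z : 'I_I * 'I_J -> K).
Local Notation T := ('I_I * 'I_J)%type.

Definition biv : {poly {poly K}} := \sum_(t : T) (z t *: 'X^(t.1 : nat))%:P * 'X^(t.2 : nat).
(** This is [biv] at [(X, X^r)], while [biv_high] is [biv] at [(X^r, X)]. When [a^(r^2) = a], the
    power [r] turns the value of the first at [a] into that of the second. *)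
Definition biv_low : {poly K} := \sum_(t : T) z t *: 'X^(t.1 + r * t.2).
Definition biv_high : {poly K} := \sum_(t : T) z t *: 'X^(r * t.1 + t.2).

Lemma coef_biv (t : T) : biv`_(t.2)`_(t.1) = z t.
Proof.
rewrite !coef_sum (bigD1 t) //= coefCM coefXn eqxx mulr1 coefZ coefXn eqxx mulr1 big1 ?addr0 //.
move=> t' neq; rewrite coefCM coefXn.
case: eqP => [e2|]; last by rewrite mulr0 coef0.
rewrite mulr1 coefZ coefXn; case: eqP => [e1|]; last by rewrite mulr0.
by case/eqP: neq; case: t t' e1 e2 => [t1 t2] [u1 u2] /= /val_inj -> /val_inj ->.
Qed.

Lemma size_coef_biv j : (size (biv`_j)%R <= I)%N.
Proof.
rewrite coef_sum (leq_trans (size_sum _ _ _)) //; apply/bigmax_leqP => t _.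
rewrite coefCM coefXn; case: eqP => _; last by rewrite mulr0 size_poly0.
by rewrite mulr1 (leq_trans (size_scale_leq _ _)) // size_polyXn.
Qed.

Lemma biv_lowE : biv.['X^r] = biv_low.
Proof.
rewrite horner_sum; apply: eq_bigr => t _.
by rewrite !hornerE -exprM -scalerAl -exprD.
Qed.

Lemma size_biv_low : (0 < I)%N -> (size biv_low <= I + r * J.-1)%N.
Proof.
move=> I0; rewrite (leq_trans (size_sum _ _ _)) //; apply/bigmax_leqP => t _.
rewrite (leq_trans (size_scale_leq _ _)) // size_polyXn.
have := ltn_ord t.1; have := ltn_ord t.2; case: J t => [|J'] [t1 t2] /=; first by case: t2.
nia.
Qed.

Lemma biv_low_exp k a : r = (Q ^ k)%N -> a ^+ (Q ^ k.*2) = a ->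
  biv_low^i.[a] ^+ r = biv_high^i.[a].
Proof.
move=> def_r ar; rewrite def_r hornerQ -def_r /biv_low /biv_high !rmorph_sum /= !horner_sum.
apply: eq_bigr => t _; rewrite !map_polyZ !map_polyXn !hornerE; congr (_ * _).
have arr : a ^+ r ^+ r = a by rewrite -exprM def_r -expnD addnn.
by rewrite exprD !exprM arr exprD exprM.
Qed.
End BivariatePolynomials.

Lemma biv_spec0 (A : {poly {poly K}}) (b : {poly W}) : b != 0 ->
  (forall eta, b.[eta] != 0 -> (map_poly (map_poly iota) A).[eta%:P] = 0) -> A = 0.
Proof.
move=> b0 A0; apply/polyP => j; apply/polyP => i; rewrite !coef0.
set B := map_poly (map_poly iota) A in A0.
pose q := \poly_(l < size B) (B`_l`_i).
have q0 : b * q = 0.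
  apply: poly_eq0_closed => eta; rewrite hornerM.
  have [->|be] := eqVneq b.[eta] 0; first by rewrite mul0r.
  suff -> : q.[eta] = 0 by rewrite mulr0.
  have /(congr1 (fun p : {poly W} => p`_i)) := A0 _ be.
  rewrite coef0 horner_coef coef_sum => e; rewrite -[RHS]e horner_poly.
  by apply: eq_bigr => l _; rewrite -rmorphXn /= coefMC.
move/eqP: q0; rewrite mulf_eq0 (negPf b0) /= => /eqP q0.
have : B`_j`_i = 0.
  have [lt_j|le_j] := ltnP j (size B); last by rewrite [B`_j]nth_default ?coef0.
  by have := coef_poly (size B) (fun l => B`_l`_i) j; rewrite -/q q0 coef0 lt_j.
by rewrite /B !coef_map /= => /eqP; rewrite fmorph_eq0 => /eqP.
Qed.

Definition xdeg m (A : {poly {poly K}}) := forall j, (size (A`_j)%R <= m.+1)%N.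

Lemma xdegD m A B : xdeg m A -> xdeg m B -> xdeg m (A + B).
Proof.
by move=> dA dB j; rewrite coefD (leq_trans (size_polyD _ _)) // geq_max dA dB.
Qed.

Lemma xdegN m A : xdeg m A -> xdeg m (- A).
Proof. by move=> dA j; rewrite coefN size_polyN. Qed.

Lemma xdegM m n A B : xdeg m A -> xdeg n B -> xdeg (m + n) (A * B).
Proof.
move=> dA dB j; rewrite coefM (leq_trans (size_sum _ _ _)) //.
apply/bigmax_leqP => i _; rewrite (leq_trans (size_polyMleq _ _)) //.
by have := dA i; have := dB (j - i)%N; lia.
Qed.

Lemma xdegC m (p : {poly K}) : (size p <= m.+1)%N -> xdeg m p%:P.
Proof. by move=> sp j; rewrite coefC; case: ifP => // _; rewrite size_poly0. Qed.

Lemma xdeg_polyC m (p : {poly K}) : xdeg m p^:P.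
Proof.
by move=> j; rewrite coef_map /= (leq_trans (size_polyC_leq1 _)).
Qed.

Lemma xdeg_weak m n A : (m <= n)%N -> xdeg m A -> xdeg n A.
Proof. by move=> le dA j; apply: leq_trans (dA j) _. Qed.

(** [lucas r] and [tau * tau(X^r) - lucas r] are conjugate: their sum and product are polynomials in
    [X] and [X^r]. The norm of [U + V lucas r] is thus a bivariate polynomial [P] taken at
    [Y = X^r]; its degree in [X] is below [r], so [P] itself vanishes. After specialising [Y] to a
    constant [eta], [quad_indep] kills [V] and then [U]. *)
Lemma low_neq0 I J k (zu zv : 'I_I * 'I_J -> K) (b : {poly W}) :
  let r := (Q ^ k)%N in
  b != 0 -> (forall eta, b.[eta] != 0 -> quad_indep eta) ->
  (I.-1.*2 + w.*2 < r)%N ->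
  biv_low r zu + biv_low r zv * lucas r = 0 -> biv zu = 0 /\ biv zv = 0.
Proof.
move=> r b0 irr ltr h0.
set U := biv zu; set V := biv zv.
pose N := nu^:P * (tau ^+ 2 - nu *+ 2)%:P + nu%:P * (tau^:P ^+ 2 - nu^:P *+ 2).
pose P := U ^+ 2 + U * V * tau%:P * tau^:P + V ^+ 2 * N.
have PX : P.['X^r] = 0.
  apply: (map_poly_inj iota); rewrite rmorph0; apply: poly_eq0_closed => a.
  have [y qy] := ex_quad_root a.
  have evC p : (p^:P.['X^r])^i.[a] = p^i.[a ^+ r].
    by rewrite -/(p \Po 'X^r) map_comp_poly horner_comp map_polyXn hornerXn.
  have lowa : (biv_low r zu)^i.[a] = - ((biv_low r zv)^i.[a] * (lucas r)^i.[a]).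
    have /(congr1 (fun p => p^i.[a])) := h0.
    rewrite rmorphD rmorphM /= rmorph0 horner0 hornerD hornerM => /eqP.
    by rewrite addr_eq0 => /eqP.
  rewrite /P /N !(hornerD, hornerM, hornerN, horner_exp, hornerMn, hornerC) !biv_lowE.
  rewrite !(rmorphD, rmorphM, rmorphN, rmorphXn, rmorphMn) /=.
  rewrite !(hornerD, hornerM, hornerN, horner_exp, hornerMn) !evC.
  rewrite lowa (lucasE r qy).
  have qY := quad_rootQ k qy; rewrite -/r in qY.
  set Y := y ^+ r in qY *.
  have -> : (tau^i.[a] - y) ^+ r = tau^i.[a ^+ r] - Y by rewrite (exprQB iota) hornerQ.
  have eqnu : nu^i.[a] = y * (tau^i.[a] - y).
    by move/eqP: qy => e; apply/eqP; rewrite -subr_eq0 -[X in _ == X]e; apply/eqP; ring.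
  have eqnur : nu^i.[a ^+ r] = Y * (tau^i.[a ^+ r] - Y).
    by move/eqP: qY => e; apply/eqP; rewrite -subr_eq0 -[X in _ == X]e; apply/eqP; ring.
  by rewrite eqnu eqnur; ring.
have dU : xdeg I.-1 U.
  move=> j; apply: leq_trans (size_coef_biv _ _) _.
  by case: (I) => //=.
have dV : xdeg I.-1 V by move=> j; apply: leq_trans (size_coef_biv _ _) _; case: (I).
have dN : xdeg w.*2 N.
  have s2 : (size (tau ^+ 2 - nu *+ 2)%R <= w.*2.+1)%N.
    rewrite (leq_trans (size_polyD _ _)) // size_polyN geq_max.
    rewrite -scaler_nat (leq_trans (size_scale_leq _ _)) // andbT.
    by rewrite expr2 (leq_trans (size_polyMleq _ _)) //; move: size_tau; lia.
  have d1 := xdegM (xdeg_polyC 0 nu) (xdegC s2).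
  have d2 := xdegM (xdegC size_nu) (xdegD (xdeg_polyC 0 (tau ^+ 2)) (xdegN (xdeg_polyC 0 (nu *+ 2)))).
  rewrite /N; apply: xdegD; [exact: d1 | rewrite -[w.*2]addn0 -rmorphXn -rmorphMn; exact: d2].
have P0 : P = 0.
  apply: (horner_Xn_inj _ PX) => j; apply: (leq_trans (n := (I.-1.*2 + w.*2).+1)) => //.
  move: j; apply: xdegD; [apply: xdegD|].
  - by apply: xdeg_weak (xdegM dU dU); rewrite addnn leq_addr.
  - have := xdegM (xdegM (xdegM dU dV) (xdegC size_tau)) (xdeg_polyC 0 tau).
    by apply: xdeg_weak; lia.
  - by apply: xdeg_weak (xdegM (xdegM dV dV) dN); lia.
have spec eta : b.[eta] != 0 ->
    (map_poly (map_poly iota) U).[eta%:P] = 0 /\ (map_poly (map_poly iota) V).[eta%:P] = 0.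
  move=> be; have /(congr1 (fun p => (map_poly (map_poly iota) p).[eta%:P])) := P0.
  have evC p : (map_poly (map_poly iota) p^:P).[eta%:P] = (p^i.[eta])%:P.
    rewrite -map_poly_comp (eq_map_poly (g := polyC \o iota)) => [|c /=]; last first.
      by rewrite map_polyC.
    by rewrite map_poly_comp horner_map.
  rewrite /P /N !(rmorphD, rmorphM, rmorphN, rmorphXn, rmorphMn) /= rmorph0 horner0.
  rewrite !(hornerD, hornerM, hornerN, horner_exp, hornerMn) !evC.
  rewrite !map_polyC /= !hornerC => eq0.
  have v0 : (map_poly (map_poly iota) V).[eta%:P] = 0.
    apply: (irr eta be (map_poly (map_poly iota) U).[eta%:P]).
    by rewrite -[RHS]eq0 !(rmorphD, rmorphM, rmorphN, rmorphXn, rmorphMn).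
  by split=> //; apply: quad_form_eq0 eq0 v0.
by split; apply: (biv_spec0 b0) => eta /spec[].
Qed.

(** With [y' = tau - y], the power [r] sends [y y'^r + y' y^r] to [y^r y'^(r^2) + y'^r y^(r^2)]: the
    same value if [y^(r^2) = y], its conjugate if [y^(r^2) = y']. *)
Lemma lucas_exp (eps : bool) k a y : quad_root a y -> a ^+ (Q ^ k.*2) = a ->
  y ^+ (Q ^ k.*2) = (if eps then y else tau^i.[a] - y) ->
  let r := (Q ^ k)%N in
  (lucas r)^i.[a] ^+ r =
  (if eps then lucas r else tau * (tau \Po 'X^r) - lucas r)^i.[a].
Proof.
move=> qy ar yr r; have rr : (Q ^ k.*2)%N = (r * r)%N by rewrite -addnn expnD.
have rD (x z : W) : (x + z) ^+ r = x ^+ r + z ^+ r by rewrite /r (exprQD iota).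
have arr : tau^i.[a ^+ r ^+ r] = tau^i.[a] by rewrite -exprM -rr ar.
rewrite (lucasE r qy) rD !exprMn.
have -> : (tau^i.[a] - y) ^+ r = tau^i.[a ^+ r] - y ^+ r by rewrite (exprQB iota) hornerQ.
have -> : (tau^i.[a ^+ r] - y ^+ r) ^+ r = tau^i.[a] - (if eps then y else tau^i.[a] - y).
  by rewrite (exprQB iota) hornerQ arr -exprM -rr yr.
rewrite -exprM -rr yr; case: eps {yr}; rewrite ?rmorphB ?rmorphM /= ?hornerD ?hornerN ?hornerM.
  rewrite (lucasE r qy) (exprQB iota) hornerQ; ring.
rewrite (lucasE r qy) (exprQB iota) hornerQ map_comp_poly horner_comp map_polyXn hornerXn.
ring.
Qed.

(** Points of one sign [eps] should make up half of the [r^2] elements [a], so vanishing to order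
    one suffices provided [h] has degree about [r^2 / 2]. The coefficients of [h] solve the linear
    system saying that [h^r], rewritten by means of [a^(r^2) = a], is the zero polynomial. *)
Lemma stepanov_exists (eps : bool) k (b : {poly W}) :
  let r := (Q ^ k)%N in
  b != 0 -> (forall eta, b.[eta] != 0 -> quad_indep eta) -> (8 * w + 8 <= r)%N ->
  exists h : {poly K}, [/\ h != 0, (2 * size h <= r ^ 2 + (6 * w + 6) * r)%N &
    forall a y, quad_root a y -> a ^+ (Q ^ k.*2) = a ->
      y ^+ (Q ^ k.*2) = (if eps then y else tau^i.[a] - y) -> root h^i a].
Proof.
move=> r b0 irr ler.
(* There are [2 I J] unknowns for about [r I + r w] equations, and [h] has degree about [r J]. The
   target degree asks for [J] near [r / 2]; then both counts have leading term [r^2 / 4], and the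
   successor in [I] and the summand [2 w + 1] in [J] supply the excess. *)
pose I := (r %/ 4).+1; pose J := (r %/ 2 + (2 * w + 1))%N.
pose e0 := if eps then lucas r else tau * (tau \Po 'X^r) - lucas r.
have size_e0 : (size e0 <= (r.+1 * w).+1)%N.
  rewrite /e0; case: ifP => _; first exact: size_lucas.
  rewrite (leq_trans (size_polyD _ _)) // size_polyN geq_max size_lucas andbT.
  rewrite (leq_trans (size_polyMleq _ _)) //.
  have := size_comp_poly tau 'X^r; rewrite size_polyXn /=.
  move: (size (tau \Po 'X^r)) size_tau; move: (size tau) => u v; nia.
pose T := ('I_I * 'I_J * bool)%type.
pose e (t : T) : {poly K} := 'X^(r * t.1.1 + t.1.2) * (if t.2 then e0 else 1).
have size_e t : (size (e t) <= r * (r %/ 4) + J.-1 + (r.+1 * w).+1)%N.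
  rewrite /e (leq_trans (size_polyMleq _ _)) // size_polyXn /=.
  have := ltn_ord t.1.1; have := ltn_ord t.1.2.
  have : (size (if t.2 then e0 else 1)%R <= (r.+1 * w).+1)%N.
    by case: ifP; rewrite ?size_poly1.
  rewrite /I; move: (size _) (t.1.1 : nat) (t.1.2 : nat) => s1 i j; nia.
have ltM : (r * (r %/ 4) + J.-1 + (r.+1 * w).+1 < #|{: 'I_I * 'I_J * bool}|)%N.
  rewrite !card_prod !card_ord card_bool /I /J.
  have := divn_eq r 4; have := divn_eq r 2.
  have := ltn_pmod r (isT : 0 < 4)%N; have := ltn_pmod r (isT : 0 < 2)%N.
  move: (r %% 4)%N (r %/ 4)%N (r %% 2)%N (r %/ 2)%N => u1 q4 u2 q2; nia.
have [z [t0 zt0] sum0] := ex_lin_dep size_e ltM.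
pose zu t := z (t, false); pose zv t := z (t, true).
have E0 : biv_high r zu + biv_high r zv * e0 = 0.
  rewrite -[RHS]sum0.
  rewrite [RHS](eq_bigr (fun t => z (t.1, t.2) *: e (t.1, t.2))) => [|[p c] _ //].
  rewrite -(pair_bigA _ (fun p c => z (p, c) *: e (p, c))) /=.
  rewrite /biv_high mulr_suml -big_split; apply: eq_bigr => p _ /=.
  by rewrite big_bool addrC /e /= mulr1 -scalerAl.
have hirr := low_neq0 (zu := zu) (zv := zv) (k := k) b0 irr.
exists (biv_low r zu + biv_low r zv * lucas r); split.
- apply/eqP => h0; have [] := hirr _ h0.
    rewrite -/r /I /=; have := divn_eq r 4; move: (r %% 4)%N (r %/ 4)%N => u1 q4; lia.
  move=> U0 V0; case/eqP: zt0; case: t0 => p [].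
    by rewrite -[LHS](coef_biv zv) V0 !coef0.
  by rewrite -[LHS](coef_biv zu) U0 !coef0.
- have sl (zz : 'I_I * 'I_J -> K) : (size (biv_low r zz) <= I + r * J.-1)%N.
    exact: size_biv_low.
  have sh : (size (biv_low r zu + biv_low r zv * lucas r)%R <= I + r * J.-1 + r.+1 * w)%N.
    rewrite (leq_trans (size_polyD _ _)) // geq_max; apply/andP; split.
      by rewrite (leq_trans (sl zu)) ?leq_addr.
    rewrite (leq_trans (size_polyMleq _ _)) //.
    have := sl zv; have := size_lucas r.
    by move: (size (lucas r)) (size (biv_low r zv)) => s1 s2; lia.
  rewrite (leq_trans (leq_mul (leqnn 2) sh)) // /I /J.
  have := divn_eq r 4; have := divn_eq r 2.
  move: (r %% 4)%N (r %/ 4)%N (r %% 2)%N (r %/ 2)%N => u1 q4 u2 q2; nia.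
move=> a y qy ar yr; rewrite rootE.
suff : (biv_low r zu + biv_low r zv * lucas r)^i.[a] ^+ r == 0.
  by rewrite expf_eq0 => /andP[].
rewrite rmorphD rmorphM /= hornerD hornerM /r (exprQD iota) exprMn -/r.
rewrite !(biv_low_exp _ (erefl r) ar) (lucas_exp qy ar yr) -/r -/e0.
by have /(congr1 (fun p => p^i.[a])) := E0; rewrite rmorphD rmorphM /= rmorph0 hornerD hornerM horner0 => ->.
Qed.

End Stepanov.

Lemma mon_addr (K : finFieldType) k (P R : {poly K}) :
  P \in mon K k -> (size R <= k)%N -> P + R \in mon K k.
Proof.
rewrite !mem_mon => /andP[mP /eqP sP] sR.
have ltR : (size R < size P)%N by rewrite sP ltnS.
by rewrite monicE lead_coefDl // size_polyDl // sP eqxx andbT -monicE.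
Qed.

(** * The bound for quadratic characters *)

Section IrreducibleSums.
Variable K : finFieldType.
Local Notation Q := #|K|.
Implicit Types (D P R : {poly K}).

Definition degp P := (size P).-1.
(** These correspond to the Frobenius orbits on the extension of degree [m]; weighted by [degp] they
    count its [#|K| ^ m] elements. *)
Definition irrs m : seq {poly K} :=
  flatten [seq Irr K d | d <- [seq d <- index_iota 1 m.+1 | (d %| m)%N]].

Lemma mem_irrs m D : (D \in irrs m) =
  [&& (0 < degp D)%N, (degp D %| m)%N, (0 < m)%N & D \in Irr K (degp D)].
Proof.
apply/flatten_mapP/idP => [[d]|/and4P[d0 dm m0 Dd]].
  rewrite mem_filter mem_index_iota => /and3P[dm d0 ltd] Dd.
  have -> : degp D = d by have [_ sD _] := IrrP Dd; rewrite /degp sD.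
  by rewrite d0 dm Dd (leq_trans d0).
by exists (degp D); rewrite // mem_filter mem_index_iota dm d0 ltnS dvdn_leq.
Qed.

Lemma uniq_irrs m : uniq (irrs m).
Proof.
rewrite /irrs; have : uniq [seq d <- index_iota 1 m.+1 | (d %| m)%N].
  exact/filter_uniq/iota_uniq.
elim: [seq _ <- _ | _] => //= d s IH /andP[ds us]; rewrite cat_uniq uniq_Irr IH // andbT /=.
apply/hasPn => D /flatten_mapP[e es De]; apply: contra ds => Dd.
suff -> : d = e by [].
by have [_ s1 _] := IrrP Dd; have [_ s2 _] := IrrP De; move: s2; rewrite s1 => [[]].
Qed.

Lemma Lsum_irrs (X : {poly K} -> int) m :
  Lsum X m = \sum_(D <- irrs m) X D ^+ (m %/ degp D) *+ degp D.
Proof.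
rewrite /irrs big_flatten big_map big_filter; apply: eq_bigr => d _.
rewrite big_seq [RHS]big_seq; apply: eq_bigr => D Dd.
by have -> : degp D = d by have [_ sD _] := IrrP Dd; rewrite /degp sD.
Qed.

Lemma Lsum_degree1 (X : {poly K} -> int) : Lsum X 1 = \sum_(a : K) X ('X - a%:P).
Proof.
rewrite Lsum_irrs -(big_map (fun a : K => 'X - a%:P) predT X).
rewrite (eq_big_seq (fun D => X D)) => [|D]; last first.
  rewrite mem_irrs dvdn1 => /and4P[_ /eqP -> _ _].
  by rewrite divn1 expr1 mulr1n.
apply: perm_big; apply: uniq_perm; first exact: uniq_irrs.
  rewrite map_inj_uniq ?index_enum_uniq // => a b /addrI /oppr_inj /polyC_inj //.
move=> D; rewrite mem_irrs dvdn1; apply/and4P/mapP => [[_ /eqP dD _]|[a _ ->]].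
  rewrite dD => /IrrP[mD sD _]; exists (- D`_0); first by rewrite mem_index_enum.
  apply/polyP => i; rewrite polyCN opprK coefD coefX coefC.
  case: i => [|[|i]] /=; rewrite ?add0r ?addr0 //.
    by move: mD; rewrite monicE lead_coefE sD => /eqP.
  by rewrite nth_default // sD.
rewrite /degp size_XsubC; split=> //; rewrite mem_Irr mem_mon monicXsubC size_XsubC eqxx.
by apply/irreducibleP; apply: irredp_XsubC.
Qed.

Lemma sum_degp_dvd m (p : pred {poly K}) (h : {poly K}) : h != 0 ->
  (forall D, D \in irrs m -> p D -> D %| h) ->
  (\sum_(D <- irrs m | p D) degp D < size h)%N.
Proof.
move=> h0 dv; rewrite -big_filter.
have : \prod_(D <- [seq D <- irrs m | p D]) D %| h.
  apply: dvdp_irr_prod; first exact/filter_uniq/uniq_irrs.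
    move=> D; rewrite mem_filter mem_irrs => /andP[_ /and4P[_ _ _ Dd]].
    by have [? _ ?] := IrrP Dd.
  by move=> D; rewrite mem_filter => /andP[pD Dm]; apply: dv.
move/(dvdp_leq h0); apply: leq_trans; rewrite size_prod_seq; last first.
  move=> D; rewrite mem_filter mem_irrs => /andP[_ /and4P[_ _ _ Dd]].
  by have [mD _ _] := IrrP Dd; apply: monic_neq0.
rewrite ltn_subRL ltnS.
rewrite [in leqRHS](eq_big_seq (fun D => degp D + 1)%N) => [|D]; last first.
  rewrite mem_filter mem_irrs => /andP[_ /and4P[_ _ _ Dd]].
  by have [_ sD _] := IrrP Dd; rewrite /degp sD addn1.
by rewrite big_split /= sum1_size addnC.
Qed.
End IrreducibleSums.

Section ResidueSums.
Variables (K : finFieldType) (X : {poly K} -> int) (M : {poly K}) (m : nat).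
Hypothesis monM' : M \in mon K m.
Hypothesis XM : forall P R, X (P * R) = X P * X R.
Hypothesis Xmod : forall P, X (P %% M) = X P.

(** Multiplication by [P0] permutes the residues modulo [M] and changes the sign of [X]. *)
Lemma sum_residues P0 : coprimep P0 M -> X P0 = - 1 ->
  \sum_(v : 'rV[K]_m) X (rVpoly v) = 0.
Proof.
move=> cop XP0; have [mM sM] : M \is monic /\ size M = m.+1.
  by move: monM'; rewrite mem_mon => /andP[? /eqP].
have M0 := monic_neq0 mM.
pose f (v : 'rV[K]_m) : 'rV[K]_m := poly_rV ((P0 * rVpoly v) %% M).
have fK v : rVpoly (f v) = (P0 * rVpoly v) %% M.
  by rewrite /f poly_rV_K // -ltnS -sM ltn_modp.
have f_inj : injective f.
  move=> u v /(congr1 rVpoly); rewrite !fK => /eqP.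
  rewrite -subr_eq0 -modpN -modpD -mulrN -mulrDr -/(M %| _) Gauss_dvdpr 1?coprimep_sym //.
  rewrite -linearB /= => /modp_eq0; rewrite modp_small; last by rewrite sM ltnS size_poly.
  move=> /(congr1 (@poly_rV _ m)); rewrite rVpolyK raddf0 => /eqP.
  by rewrite subr_eq0 => /eqP.
have : \sum_(v : 'rV[K]_m) X (rVpoly v) = - \sum_(v : 'rV[K]_m) X (rVpoly v).
  rewrite {1}(reindex_inj f_inj) -sumrN; apply: eq_bigr => v _.
  by rewrite fK Xmod XM XP0 mulN1r.
lia.
Qed.

(** In degree [k >= m] the monic polynomials are spread evenly over the residue classes modulo [M],
    so the coefficient is a multiple of a complete character sum. This makes the L-series a
    polynomial of degree below [m]. *)
Lemma Lcoef_eq0 P0 k : coprimep P0 M -> X P0 = - 1 -> (m <= k)%N -> Lcoef X k = 0.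
Proof.
move=> cop XP0 le_mk; have [mM sM] : M \is monic /\ size M = m.+1.
  by move: monM'; rewrite mem_mon => /andP[? /eqP].
have M0 := monic_neq0 mM.
pose g (p : {poly K} * 'rV[K]_m) := M * p.1 + rVpoly p.2.
have sv (v : 'rV[K]_m) : (size (rVpoly v) < size M)%N by rewrite sM ltnS size_poly.
have gmod p : g p %% M = rVpoly p.2.
  by rewrite /g modpD modp_mulr add0r modp_small.
have gdiv p : g p %/ M = p.1.
  by rewrite /g divpD mulKp // divp_small // addr0.
have perm : perm_eq (mon K k)
    [seq g (A, v) | A <- mon K (k - m), v <- index_enum ('rV[K]_m : finType)].
  apply: uniq_perm; first exact: uniq_mon.
    apply: allpairs_uniq; rewrite ?uniq_mon ?index_enum_uniq //.
    move=> [A u] [B v] _ _ /= eqg; have := gdiv (A, u); have := gmod (A, u).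
    rewrite eqg gmod gdiv /= => /(congr1 (@poly_rV _ m)); rewrite !rVpolyK => -> ->.
    by [].
  move=> P; apply/idP/allpairsP => [Pk|[[A v] [Ak _ ->]]].
    have sPM : (size (- (P %% M)) <= k)%N.
      by rewrite size_polyN -ltnS (leq_trans (ltn_modpN0 _ M0)) ?sM.
    have dvM : M %| P - P %% M by rewrite {1}(divp_eq P M) addrK dvdp_mull.
    have [A eA [_ Ak]] := mon_divK monM' (mon_addr Pk sPM) dvM.
    exists (A, poly_rV (P %% M)); rewrite mem_index_enum /g /=; split=> //.
    rewrite poly_rV_K; first by rewrite -eA subrK.
    by rewrite -ltnS -sM ltn_modp.
  apply: mon_addr; first by rewrite -(subnKC le_mk) monM.
  by rewrite (leq_trans _ le_mk) // size_poly.
rewrite /Lcoef (perm_big _ perm) /= big_allpairs_dep big1_seq //= => A _.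
rewrite -[RHS](sum_residues cop XP0); apply: eq_bigr => v _.
by rewrite -Xmod gmod.
Qed.
End ResidueSums.

Section WeilBound.
Variables (K : finFieldType) (W : closedFieldType) (iota : {rmorphism K -> W}).
Variables (tau nu M : {poly K}) (w : nat) (X : {poly K} -> int) (b : {poly W}).
Local Notation Q := #|K|.
Local Notation "p ^i" := (map_poly iota p) (at level 2, format "p ^i").
Hypothesis w_gt0 : (0 < w)%N.
Hypothesis size_tau : (size tau <= w.+1)%N.
Hypothesis size_nu : (size nu <= w.*2.+1)%N.
Hypothesis monM' : M \in mon K w.*2.
Hypothesis XM : forall P R, X (P * R) = X P * X R.
Hypothesis X1 : X 1 = 1.
Hypothesis Xmod : forall P, X (P %% M) = X P.
Hypothesis X_coprime : forall P, X P != 0 -> coprimep P M.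
Hypothesis X_frob : forall d D a y, (0 < d)%N -> D \in Irr K d -> root D^i a ->
  quad_root iota tau nu a y ->
  [\/ X D = 1 /\ y ^+ (Q ^ d) = y, X D = - 1 /\ y ^+ (Q ^ d) = tau^i.[a] - y
    | X D = 0 /\ D %| M].
Hypothesis b_neq0 : b != 0.
Hypothesis indep : forall eta, b.[eta] != 0 -> quad_indep iota tau nu eta.

Let N m (c : int) := (\sum_(D <- irrs K m | X D ^+ (m %/ degp D) == c) degp D)%N.

Lemma X_val d D : D \in Irr K d -> (0 < d)%N -> [\/ X D = 1, X D = - 1 | X D = 0].
Proof.
move=> Dd d0; have [a Da] := irr_ex_root iota Dd d0.
have [y qy] := ex_quad_root iota tau nu a.
by case: (X_frob d0 Dd Da qy) => [] [-> _]; [apply: Or31|apply: Or32|apply: Or33].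
Qed.

Lemma X_frobX d D a y j : (0 < d)%N -> D \in Irr K d -> root D^i a ->
  quad_root iota tau nu a y -> X D != 0 ->
  y ^+ (Q ^ (d * j)) = if X D ^+ j == 1 then y else tau^i.[a] - y.
Proof.
move=> d0 Dd Da qy XD0; have [ad _] := irr_root Dd Da.
have adj i : a ^+ (Q ^ (d * i)) = a by apply: irr_root_exprQ Dd Da _; apply: dvdn_mulr.
case: (X_frob d0 Dd Da qy) => [] [eX yd]; last by rewrite eX in XD0.
  rewrite eX expr1n eqxx; elim: j => [|j IH]; first by rewrite muln0 expn0 expr1.
  by rewrite mulnS expnD exprM yd.
rewrite eX; elim: j => [|j IH]; first by rewrite muln0 expn0 expr1 expr0 eqxx.
rewrite mulnSr expnD exprM IH exprS mulN1r -signr_odd.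
case: (odd j) => /=; rewrite ?expr1 ?expr0 //= ?opprK.
by rewrite (exprQB iota) hornerQ ad yd subKr.
Qed.

Lemma X_pow_val m D : D \in irrs K m ->
  [\/ X D ^+ (m %/ degp D) = 1, X D ^+ (m %/ degp D) = - 1 | X D ^+ (m %/ degp D) = 0].
Proof.
rewrite mem_irrs => /and4P[d0 dm m0 Dd].
have j0 : (0 < m %/ degp D)%N by rewrite divn_gt0 // dvdn_leq.
case: (X_val Dd d0) => ->.
- by rewrite expr1n; apply: Or31.
- by rewrite -signr_odd; case: odd; [apply: Or32|apply: Or31].
by rewrite expr0n (gtn_eqF j0); apply: Or33.
Qed.

Lemma irrs_split m : (0 < m)%N -> (N m 1 + N m (- 1)%R + N m 0 = Q ^ m)%N.
Proof.
move=> m0; have := Lsum1 K m0; rewrite Lsum_irrs => e.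
have : (\sum_(D <- irrs K m) degp D)%N = (Q ^ m)%N.
  apply/eqP; rewrite -(eqr_nat int) -e natr_sum; apply/eqP.
  by apply: eq_bigr => D _; rewrite expr1n.
move=> <-; rewrite /N !(big_mkcond (fun D => _ == _)) -!big_split /=.
rewrite big_seq [RHS]big_seq; apply: eq_bigr => D /X_pow_val[] ->; rewrite /=; lia.
Qed.

Lemma Lsum_split m : Lsum X m = (N m 1)%:R - (N m (- 1))%:R.
Proof.
rewrite Lsum_irrs /N !natr_sum !(big_mkcond (fun D => _ == _)) -sumrB.
rewrite big_seq [RHS]big_seq; apply: eq_bigr => D /X_pow_val[] -> /=.
- by rewrite subr0.
- by rewrite sub0r mulNrn.
by rewrite subr0 mul0rn.
Qed.

Lemma N0_le m : (N m 0 <= w.*2)%N.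
Proof.
rewrite -ltnS; have [mM sM] : M \is monic /\ size M = w.*2.+1.
  by move: monM'; rewrite mem_mon => /andP[? /eqP].
rewrite -sM; apply: sum_degp_dvd => [|D]; first exact: monic_neq0.
rewrite mem_irrs => /and4P[d0 dm m0 Dd]; rewrite expf_eq0 => /andP[_ /eqP X0].
have [a Da] := irr_ex_root iota Dd d0; have [y qy] := ex_quad_root iota tau nu a.
by case: (X_frob d0 Dd Da qy) => [] []; rewrite X0.
Qed.

(** At a root [a] of an irreducible counted here, the power [Q ^ k.*2] acts on [y] with the sign
    [eps]; so Stepanov's polynomial vanishes at [a] and the irreducible divides it. *)
Lemma N_le (eps : bool) k : (8 * w + 8 <= Q ^ k)%N ->
  (2 * (N k.*2 (if eps then 1 else - 1)%R).+1 <= Q ^ k.*2 + (6 * w + 6) * Q ^ k)%N.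
Proof.
move=> le_r; have [h [h0 sh rh]] := stepanov_exists size_tau size_nu eps b_neq0 indep le_r.
have -> : (Q ^ k.*2 = (Q ^ k) ^ 2)%N by rewrite -expnM muln2.
apply: leq_trans sh; rewrite leq_mul2l /=; apply: sum_degp_dvd => // D.
rewrite mem_irrs => /and4P[d0 dm m0 Dd] /eqP XD.
have XD0 : X D != 0.
  apply: contra_eq_neq XD => ->; rewrite expr0n.
  have j0 : (0 < k.*2 %/ degp D)%N by rewrite divn_gt0 // dvdn_leq.
  rewrite (gtn_eqF j0).
  by case: (eps).
have [a Da] := irr_ex_root iota Dd d0; have [y qy] := ex_quad_root iota tau nu a.
have [_ _ irrD] := IrrP Dd; apply: (irr_dvd_root irrD Da).
apply: (rh a y qy); first exact: irr_root_exprQ Dd Da dm.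
by rewrite -(divnK dm) mulnC (X_frobX _ d0 Dd Da qy XD0) XD; case: (eps).
Qed.

Lemma expQ_large k : (k < Q ^ k)%N.
Proof. by apply: ltn_expl; apply: finNzRing_gt1. Qed.

(** If -1 never occurred over the extension of degree [k.*2], all but [w.*2] of its [r^2] elements
    would carry the value 1, against the bound of about [r^2 / 2] in [N_le]. *)
Lemma ex_X_neg : exists2 P, coprimep P M & X P = - 1.
Proof.
pose k := (8 * w + 8)%N; have lek := expQ_large k.
have k2 : (0 < k.*2)%N by rewrite /k; lia.
have := irrs_split k2; have := N_le true (ltnW lek); have := N0_le k.*2.
have -> : (Q ^ k.*2 = Q ^ k * Q ^ k)%N by rewrite -addnn expnD.
have [->|] := eqVneq (N k.*2 (- 1)) 0%N.
  by move: (Q ^ k)%N lek (N _ 1) (N _ 0) => r lek n1 n0 /=; rewrite /k in lek *; nia.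
rewrite /N sum_nat_seq_neq0 => /hasP[D Dm /andP[/eqP XD _]] _ _ _.
move: Dm; rewrite mem_irrs => /and4P[d0 dm _ Dd].
have XDN : X D = - 1.
  have j0 : (0 < k.*2 %/ degp D)%N by rewrite divn_gt0 // dvdn_leq.
  case: (X_val Dd d0) => // e; move: XD; rewrite e ?expr1n // expr0n (gtn_eqF j0) //.
by exists D => //; apply: X_coprime; rewrite XDN.
Qed.

Lemma weil_bound : (\sum_(a : K) X ('X - a%:P)) ^+ 2 <= ((w.*2.-1) ^ 2 * Q)%N%:R.
Proof.
have [P0 cop XP0] := ex_X_neg.
rewrite -Lsum_degree1.
(* With [r = Q ^ k], the counts of 1 and -1 are each at most [(r^2 + (6 w + 6) r) / 2] and add up to
   at least [r^2 - 2 w], so they differ by at most [(6 w + 6) r + 2 w], whence [8 w + 6]. The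
   threshold [8 w + 8] makes [r] large enough for [N_le]. *)
apply: (@newton_growth (Lcoef X) (Lsum X) _ Q (8 * w + 6) (8 * w + 8)).
- by rewrite (ltn_trans _ (finNzRing_gt1 K)).
- by rewrite /Lcoef mon0 big_seq1.
- by move=> k ltk; apply: (Lcoef_eq0 monM' XM Xmod cop XP0); lia.
- exact: Lcoef_newton.
move=> k lek; have ler : (8 * w + 8 <= Q ^ k)%N.
  by rewrite (leq_trans lek) // ltnW // expQ_large.
rewrite Lsum_split; have := N_le true ler; have := N_le false ler; have := N0_le k.*2.
have k2 : (0 < k.*2)%N by lia.
have := irrs_split k2.
have -> : (Q ^ k.*2 = Q ^ k * Q ^ k)%N by rewrite -addnn expnD.
rewrite /=; move: (Q ^ k)%N ler => r ler.
move: (N _ 1) (N _ (- 1)) (N _ 0) => n1 n2 n0; nia.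
Qed.

End WeilBound.

(** If [v] were nonzero, the multiplicity of [z] would be even on the left and odd on the right. *)
Lemma sqr_simple_root (F : fieldType) (z c : F) (S v p : {poly F}) :
  p != 0 -> mup z p = 1%N -> c != 0 -> S ^+ 2 = v ^+ 2 * (p * c%:P) -> v = 0.
Proof.
move=> p0 pz c0 key; apply/eqP; apply: contraT => v0.
have cP0 : c%:P != 0 by rewrite polyC_eq0.
have S0 : S != 0 by rewrite -sqrf_eq0 key !mulf_neq0 ?expf_neq0.
have vv0 : v * v != 0 by rewrite mulf_neq0.
have pc0 : p * c%:P != 0 by rewrite mulf_neq0.
have mc : mup z c%:P = 0%N by rewrite mupNroot ?rootC.
have := congr1 (mup z) key; rewrite !expr2.
by rewrite (mupM z vv0 pc0) (mupM z S0 S0) (mupM z v0 v0) (mupM z p0 cP0) pz mc; lia.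
Qed.

Section SeparableRoots.
Variables (K : finFieldType) (W : closedFieldType) (iota : {rmorphism K -> W}).
Local Notation Q := #|K|.
Local Notation "p ^i" := (map_poly iota p) (at level 2, format "p ^i").

Lemma separable_roots (p : {poly K}) : p \is monic -> separable_poly p ->
  exists s : seq W, [/\ uniq s, p^i = \prod_(z <- s) ('X - z%:P)
    & perm_eq [seq z ^+ Q | z <- s] s].
Proof.
move=> mp sp; have [s ps] := closed_field_poly_normal p^i.
have {}ps : p^i = \prod_(z <- s) ('X - z%:P).
  by rewrite ps lead_coef_map (monicP mp) rmorph1 scale1r.
have us : uniq s by rewrite -separable_prod_XsubC -ps separable_map.
exists s; split=> //; apply: prod_XsubC_eq; rewrite -ps big_map.
have fixp : map_poly (frobW iota) p^i = p^i.
  apply/polyP => j; rewrite !coef_map /= /frobW.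
  by have := iotaQ iota 1 p`_j; rewrite expn1.
rewrite -fixp ps rmorph_prod; apply: eq_bigr => z _.
by rewrite rmorphB /= map_polyX map_polyC.
Qed.

Lemma coprimep_roots (p q : {poly K}) (s : seq W) :
  p^i = \prod_(z <- s) ('X - z%:P) -> (forall z, z \in s -> q^i.[z] != 0) -> coprimep q p.
Proof.
move=> ps qs; rewrite -(coprimep_map iota) ps big_seq.
elim/big_ind: _ => [|u v cu cv|z zs]; first exact: coprimep1.
  by rewrite coprimepMr cu.
by rewrite coprimep_XsubC rootE qs.
Qed.
End SeparableRoots.

(** * Quadratic characters in odd and even characteristic *)

(* A quadratic Dirichlet character [X] of modulus [N] that records, at every
   irreducible [P], how Frobenius acts on the roots of [Y^2 - tau Y + nu] above a
   root of [P]. *)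
Definition quad_character (K : finFieldType) (W : closedFieldType)
    (iota : {rmorphism K -> W}) (tau nu : {poly K}) (w : nat) : Prop :=
  exists (X : {poly K} -> int) (N : {poly K}) (b : {poly W}),
  [/\ N \in mon K w.*2, (forall P R, X (P * R) = X P * X R), X 1 = 1,
      (forall P, X (P %% N) = X P) & (forall P, X P != 0 -> coprimep P N)] /\
  [/\ b != 0, (forall eta, b.[eta] != 0 -> quad_indep iota tau nu eta),
   (forall z y, quad_root iota tau nu z y ->
      root (map_poly iota N) z = (y == (map_poly iota tau).[z] - y)) &
   forall d P a y, (0 < d)%N -> P \in Irr K d -> root (map_poly iota P) a ->
    quad_root iota tau nu a y ->
    [\/ X P = 1 /\ y ^+ (#|K| ^ d) = y,
        X P = - 1 /\ y ^+ (#|K| ^ d) = (map_poly iota tau).[a] - y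
      | X P = 0 /\ P %| N]].

Section OddCharacter.
Variables (K : finFieldType) (W : closedFieldType) (iota : {rmorphism K -> W}).
Variables (tau nu : {poly K}) (w : nat) (l : K).
Local Notation Q := #|K|.
Local Notation "p ^i" := (map_poly iota p) (at level 2, format "p ^i").
Hypothesis oddQ : odd Q.
Hypothesis w_gt0 : (0 < w)%N.
Let D := tau ^+ 2 - nu *+ 4.
Hypothesis size_D : size D = w.*2.+1.
Hypothesis lead_D : lead_coef D = l ^+ 2.
Hypothesis sep_D : separable_poly D.

Let D0 : D != 0. Proof. by rewrite -size_poly_gt0 size_D. Qed.
Let l0 : l != 0.
Proof. by have := D0; rewrite -lead_coef_eq0 lead_D sqrf_eq0. Qed.

Let two0 : 2%:R != 0 :> W.
Proof.
have [p pr_p pK] := finPcharP K.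
have cardK : #|K| = (p ^ logn p #|K|)%N := card_pprimeChar pK.
have p2 : p != 2.
  apply: contraTneq oddQ => p2; have := finNzRing_gt1 K.
  by rewrite cardK p2 oddX orbF; case: (logn _ _).
rewrite -(rmorph_nat iota) fmorph_eq0 -(dvdn_pcharf pK); apply: contra p2.
by rewrite dvdn_prime2.
Qed.

(** Up to sign [n P] is the resultant of [P] with the monic discriminant [N0], and [X P] is its
    quadratic character in [K]. As a product over the roots of [N0] it is multiplicative and depends
    on [P] modulo [N0] only; as a product over the roots of [P] it is the norm of [N0(a)], which by
    Euler's criterion decides how Frobenius acts on the square root [y - y'] of the discriminant. *)
Lemma odd_character : quad_character iota tau nu w.
Proof.
have lead0 : lead_coef D != 0 by rewrite lead_coef_eq0.
have [N0 [mM sM sepM DM]] : exists N0 : {poly K},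
    [/\ N0 \is monic, size N0 = w.*2.+1, separable_poly N0 & D = l ^+ 2 *: N0].
  exists ((lead_coef D)^-1 *: D); rewrite monicE lead_coefZ mulVf // size_scale ?invr_eq0 //.
  by rewrite (eqp_separable (eqp_scale _ _)) ?invr_eq0 // scalerA -lead_D divff // scale1r.
have [s [us Ms permQ]] := separable_roots iota mM sepM.
have ss : size s = w.*2.
  by apply: succn_inj; rewrite -sM -(size_map_poly iota) Ms size_prod_XsubC.
pose n (P : {poly K}) : W := \prod_(z <- s) P^i.[z].
have nM P R : n (P * R) = n P * n R.
  by rewrite /n -big_split; apply: eq_bigr => z _; rewrite rmorphM hornerM.
have nQ P : n P ^+ Q = n P.
  rewrite /n -prodrXl -[RHS](perm_big _ permQ) big_map; apply: eq_bigr => z _.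
  by have := hornerQ iota 1 P z; rewrite expn1.
pose h := Q./2.
have Qh : Q = h.*2.+1 by rewrite -[LHS]odd_double_half oddQ.
have n_pm P : n P != 0 -> n P ^+ h = 1 \/ n P ^+ h = - 1.
  move=> nP; have : (n P ^+ h - 1) * (n P ^+ h + 1) == 0.
    have -> : (n P ^+ h - 1) * (n P ^+ h + 1) = n P ^+ h.*2 - 1.
      by rewrite -muln2 exprM; ring.
    by rewrite subr_eq0 -(inj_eq (mulfI nP)) mulr1 -exprS -Qh nQ.
  by rewrite mulf_eq0 subr_eq0 addr_eq0 => /orP[] /eqP; [left|right].
pose X P : int := if n P == 0 then 0 else if n P ^+ h == 1 then 1 else - 1.
have m1_neq1 : (- 1 == 1 :> W) = false.
  by apply/negbTE; rewrite eq_sym -subr_eq0 opprK.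
exists X, N0, D^i; split; split.
- by rewrite mem_mon mM sM eqxx.
- move=> P R; rewrite /X nM mulf_eq0 exprMn.
  have [->|nP] := eqVneq (n P) 0; first by rewrite mul0r.
  have [->|nR] := eqVneq (n R) 0; first by rewrite mulr0.
  rewrite /=; case: (n_pm P nP) => ->; case: (n_pm R nR) => ->;
    by rewrite ?mulr1 ?mul1r ?mulrNN ?mulr1 ?m1_neq1 ?eqxx.
- by rewrite /X /n (eq_bigr (fun=> 1)) => [|z _]; rewrite ?big1 ?rmorph1 ?hornerC ?expr1n ?eqxx ?oner_eq0.
- move=> P; rewrite /X; suff -> : n (P %% N0) = n P by [].
  rewrite /n big_seq [RHS]big_seq; apply: eq_bigr => z zs.
  rewrite [in RHS](divp_eq P N0) rmorphD rmorphM hornerD hornerM.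
  have -> : N0^i.[z] = 0 by apply/eqP; rewrite -rootE Ms root_prod_XsubC.
  by rewrite mulr0 add0r.
- move=> P; rewrite /X; case: ifP => // /negbT nP _.
  apply: (coprimep_roots Ms) => z zs; apply: contraNneq nP => Pz.
  by rewrite /n (big_rem z) //= Pz mul0r.
- by rewrite map_poly_eq0.
- move=> eta Deta u v eq0.
  (* Completing the square in the form of [quad_indep] leaves the product of the discriminants at
     the two points, so the discriminant serves as [b]. *)
  have key : (u *+ 2 + v * tau^i * (tau^i.[eta])%:P) ^+ 2 = v ^+ 2 * (D^i * (D^i.[eta])%:P).
    have -> : (D^i.[eta])%:P = (tau^i.[eta])%:P ^+ 2 - (nu^i.[eta])%:P *+ 4.
      by rewrite /D rmorphB rmorphXn rmorphMn /= hornerD hornerN horner_exp hornerMn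
                 rmorphB rmorphXn rmorphMn.
    have -> : D^i = tau^i ^+ 2 - nu^i *+ 4 by rewrite /D rmorphB rmorphXn rmorphMn.
    move: eq0; rewrite rmorphB rmorphXn rmorphMn /=.
    set A := (tau^i.[eta])%:P; set B := (nu^i.[eta])%:P => eq0.
    by apply/eqP; rewrite -subr_eq0 -(mulr0 4) -eq0; apply/eqP; ring.
  have zs : s`_0 \in s by rewrite mem_nth // ss double_gt0.
  have mupD : mup s`_0 D^i = 1%N.
    rewrite DM map_polyZ /= -mul_polyC mupMr.
      by rewrite Ms mu_prod_XsubC count_uniq_mem // zs.
    by rewrite rootC rmorphXn expf_neq0 // fmorph_eq0.
  have Di0 : D^i != 0 by rewrite map_poly_eq0.
  exact: (sqr_simple_root Di0 mupD Deta key).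
- move=> z y qy; rewrite -[RHS]subr_eq0.
  have -> : root N0^i z = root D^i z.
    by rewrite [in RHS]DM map_polyZ /= rootZ // rmorphXn expf_neq0 // fmorph_eq0.
  rewrite rootE -[RHS]orbb -mulf_eq0; congr (_ == 0).
  rewrite /D rmorphB rmorphXn rmorphMn /= hornerD hornerN horner_exp hornerMn.
  move/eqP: qy => e; apply/eqP; rewrite -subr_eq0 -(mulr0 (- 4)) -[X in _ == _ * X]e.
  by apply/eqP; ring.
move=> d P a y d0 Pd Pa qy.
have [ad Pfac] := irr_root Pd Pa; have [mP sP irrP] := IrrP Pd.
pose S := (\sum_(j < d) Q ^ j)%N.
(* Reciprocity: the double product over the roots of [N0] and of [P] is read the other way.
   Reversing the differences costs one sign for each root of [N0], and their number [w.*2] is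
   even. *)
have nP : n P = N0^i.[a] ^+ S.
  rewrite /n; under eq_bigr => z _ do rewrite Pfac horner_prod.
  rewrite exchange_big /= /S; rewrite -prodrXr; apply: eq_bigr => j _.
  rewrite hornerQ Ms horner_prod.
  rewrite (eq_bigr (fun z => - 1 * (a ^+ (Q ^ j) - z))) => [|z _]; last first.
    by rewrite !hornerE mulN1r opprB.
  rewrite big_split /= big_const_seq count_predT iter_mulr_1 ss.
  by rewrite -signr_odd odd_double expr0 mul1r; apply: eq_bigr => z _; rewrite !hornerE.
have [Ma|Ma] := eqVneq N0^i.[a] 0.
  apply: Or33; split; last by apply: (irr_dvd_root irrP Pa); apply/rootP.
  suff : n P == 0 by rewrite /X => ->.
  rewrite nP Ma expf_eq0 eqxx andbT /S; case: (d) d0 => // d' _.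
  by rewrite big_ord_recl.
have nP0 : n P != 0 by rewrite nP expf_neq0.
pose g := y *+ 2 - tau^i.[a].
have g2 : g ^+ 2 = iota l ^+ 2 * N0^i.[a].
  have -> : iota l ^+ 2 * N0^i.[a] = D^i.[a].
    by rewrite DM map_polyZ /= hornerZ rmorphXn.
  rewrite /D rmorphB rmorphXn rmorphMn /= hornerD hornerN horner_exp hornerMn /g.
  move/eqP: qy => e; apply/eqP; rewrite -subr_eq0 -(mulr0 4) -[X in _ == 4 * X]e; apply/eqP; ring.
have QdS : (Q ^ d = (S * h).*2.+1)%N.
  have r0 : (0 < Q ^ d)%N by rewrite expn_gt0 (ltn_trans _ (finNzRing_gt1 K)).
  have Q1 : Q.-1 = h.*2 by rewrite [in LHS]Qh.
  by rewrite -(prednK r0) predn_exp Q1 -doubleMl mulnC.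
have gQ : g ^+ (Q ^ d) = g * n P ^+ h.
  have lQ : iota l ^+ (S * h).*2 = 1.
    have := iotaQ iota d l; rewrite QdS exprS => /eqP.
    by rewrite -subr_eq0 -[X in _ - X]mulr1 -mulrBr mulf_eq0 fmorph_eq0 (negPf l0) subr_eq0 => /eqP.
  rewrite QdS exprS; congr (_ * _); rewrite -mul2n exprM g2 exprMn -exprM mul2n lQ mul1r.
  by rewrite nP exprM.
have yQ : y ^+ (Q ^ d) *+ 2 = g ^+ (Q ^ d) + tau^i.[a].
  rewrite /g (exprQB iota) hornerQ ad subrK -[y *+ 2]mulr_natl exprMn.
  by rewrite -{1}(rmorph_nat iota) iotaQ rmorph_nat mulr_natl.
have two_inj (u v : W) : u *+ 2 = v *+ 2 -> u = v.
  by rewrite -[u *+ 2]mulr_natl -[v *+ 2]mulr_natl => /(mulfI two0).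
rewrite /X (negPf nP0); case: (n_pm P nP0) => e; rewrite e ?eqxx ?m1_neq1.
  by apply: Or31; split=> //; apply: two_inj; rewrite yQ gQ e mulr1 subrK.
apply: Or32; split=> //; apply: two_inj; rewrite yQ gQ e /g; ring.
Qed.
End OddCharacter.

Section PartialFractions.
Variable F : fieldType.
Implicit Types (s : seq F) (g : {poly F}).

Lemma deriv_prod_XsubC s x : x \notin s ->
  (\prod_(z <- s) ('X - z%:P))^`().[x] / (\prod_(z <- s) ('X - z%:P)).[x]
  = \sum_(z <- s) (x - z)^-1.
Proof.
elim: s => [|z s IH]; first by rewrite !big_nil derivC horner0 mul0r.
rewrite inE negb_or => /andP[xz xs]; rewrite !big_cons -IH // derivM derivXsubC mul1r.
rewrite hornerD !hornerM !hornerE /=.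
set P := (\prod_(_ <- _) _).[x].
have P0 : P != 0 by rewrite -rootE root_prod_XsubC.
have xz0 : x - z != 0 by rewrite subr_eq0.
by field; rewrite P0 xz0.
Qed.

Lemma lagrange_fractions s g x : uniq s -> (size g <= size s)%N -> x \notin s ->
  \sum_(z <- s) g.[z] / (\prod_(y <- s) ('X - y%:P))^`().[z] / (x - z)
  = g.[x] / (\prod_(y <- s) ('X - y%:P)).[x].
Proof.
move=> us sg xs; set M := \prod_(y <- s) _.
pose L z := \prod_(y <- rem z s) ('X - y%:P).
have ML z : z \in s -> M = ('X - z%:P) * L z by move=> zs; rewrite /M (big_rem z).
have LL z : z \in s -> M^`().[z] = (L z).[z].
  move=> zs; rewrite (ML z zs) derivM derivXsubC mul1r hornerD !hornerM hornerXsubC.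
  by rewrite subrr mul0r addr0.
have L0 z : z \in s -> (L z).[z] != 0.
  by move=> zs; rewrite -rootE root_prod_XsubC mem_rem_uniqF.
have Mx : M.[x] != 0 by rewrite -rootE root_prod_XsubC.
have : g - \sum_(z <- s) (g.[z] / (L z).[z]) *: L z = 0.
  apply: (@roots_geq_poly_eq0 _ _ s) => //.
    apply/allP => z zs; rewrite rootE hornerD hornerN horner_sum (bigD1_seq z) //= hornerZ.
    rewrite divfK ?L0 // big_seq_cond big1 ?addr0 ?subrr // => y /andP[ys yz].
    by rewrite hornerZ; apply/eqP; rewrite mulf_eq0 orbC -rootE root_prod_XsubC
       mem_rem_uniq // inE eq_sym yz zs.
  rewrite (leq_trans (size_polyD _ _)) // size_polyN geq_max sg /=.
  rewrite big_seq; elim/big_ind: _ => [|u v su sv|z zs]; first by rewrite size_poly0.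
    by rewrite (leq_trans (size_polyD _ _)) // geq_max su.
  rewrite (leq_trans (size_scale_leq _ _)) // size_prod_XsubC size_rem // prednK //.
  by case: (s) zs.
move/eqP; rewrite subr_eq0 => /eqP eg.
rewrite [in RHS]eg horner_sum mulr_suml big_seq [RHS]big_seq; apply: eq_bigr => z zs.
rewrite LL // hornerZ [in RHS](ML z zs) hornerM hornerXsubC.
have Lx : (L z).[x] != 0.
  by apply: contraNneq Mx => Lx; rewrite (ML z zs) hornerM Lx mulr0.
have xz : x - z != 0.
  by rewrite subr_eq0; apply: contraNneq xs => ->.
by field; rewrite Lx xz L0.
Qed.
End PartialFractions.

(* Infinite descent at a simple zero of [t]. *)
Lemma even_descent (F : fieldType) (z A : F) (t g B s v : {poly F}) :
  A != 0 -> root t z -> t^`().[z] != 0 -> g.[z] != 0 ->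
  s ^+ 2 + s * v * t * A%:P + v ^+ 2 * t * (g * A%:P ^+ 2 + B * t) = 0 -> v = 0.
Proof.
move=> A0 /factor_theorem[t' def_t] dt gz.
have t'z : t'.[z] != 0.
  by move: dt; rewrite def_t derivM derivXsubC mulr1 hornerD hornerM hornerXsubC subrr mulr0 add0r.
have m0 : 'X - z%:P != 0 by rewrite polyXsubC_eq0.
have [n] := ubnP (size v); elim: n s v => // n IH s v ltn eq0.
apply/eqP; apply: contraT => v0.
have /factor_theorem[s1 def_s] : root s z.
  rewrite rootE; move/(congr1 (fun p => p.[z])): eq0.
  rewrite def_t !(hornerXsubC, horner_exp, hornerD, hornerM, hornerC) subrr.
  by rewrite !(mulr0, mul0r, addr0) => /eqP; rewrite expf_eq0.
have eq1 : ('X - z%:P) * s1 ^+ 2 + s1 * v * t * A%:P + v ^+ 2 * t' * (g * A%:P ^+ 2 + B * t) = 0.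
  by apply: (mulfI m0); rewrite mulr0 -eq0 def_s [in RHS]def_t def_t; ring.
have /factor_theorem[v1 def_v] : root v z.
  rewrite rootE; move/(congr1 (fun p => p.[z])): eq1.
  rewrite def_t !(hornerXsubC, horner_exp, hornerD, hornerM, hornerC) subrr.
  rewrite !(mulr0, mul0r, addr0, add0r) => /eqP.
  by rewrite !mulf_eq0 (negPf t'z) (negPf gz) (negPf A0) !orbF orbb.
have v1_0 : v1 = 0.
  apply: (IH s1); last first.
    by apply: (mulfI (expf_neq0 2 m0)); rewrite mulr0 -eq0 def_s def_v; ring.
  move: ltn v0; rewrite def_v mulf_eq0 negb_or => ltn /andP[v10 _].
  by move: ltn; rewrite size_Mmonic ?monicXsubC // size_XsubC addn2.
by rewrite def_v v1_0 mul0r eqxx in v0.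
Qed.

Section EvenCharacter.
Variables (K : finFieldType) (W : closedFieldType) (iota : {rmorphism K -> W}).
Variables (tau g : {poly K}) (w h : nat).
Local Notation Q := #|K|.
Local Notation "p ^i" := (map_poly iota p) (at level 2, format "p ^i").
Hypothesis cardQ : Q = (2 ^ h)%N.
Hypothesis w_gt0 : (0 < w)%N.
Hypothesis size_tau : size tau = w.+1.
Hypothesis size_g : (size g <= w)%N.
Hypothesis sep_tau : separable_poly tau.
Hypothesis cop_g : coprimep g tau.

Let char2 : 2%N \in [pchar W].
Proof. by rewrite (fmorph_pchar iota); apply: card_finPcharP cardQ _. Qed.

Let oppW (x : W) : - x = x. Proof. exact: oppr_pchar2. Qed.
Let addWW (x : W) : x + x = 0. Proof. exact: addrr_pchar2. Qed.

Let sqrD i (x y : W) : (x + y) ^+ (2 ^ i) = x ^+ (2 ^ i) + y ^+ (2 ^ i).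
Proof. by apply: exprDn_pchar; rewrite pnatX pnatE // char2. Qed.

Let sqr_sum (I : Type) (r : seq I) (F : I -> W) i :
  (\sum_(j <- r) F j) ^+ (2 ^ i) = \sum_(j <- r) F j ^+ (2 ^ i).
Proof.
elim/big_rec2: _ => [|j x y _ <-]; last exact: sqrD.
by rewrite expr0n expn_eq0.
Qed.

Definition tr2 n (x : W) := \sum_(i < n) x ^+ (2 ^ i).

Let tr2D n x y : tr2 n (x + y) = tr2 n x + tr2 n y.
Proof. by rewrite /tr2 -big_split; apply: eq_bigr => i _; apply: sqrD. Qed.

Let tr2_sqr n x : tr2 n x ^+ 2 + tr2 n x = x ^+ (2 ^ n) + x.
Proof.
elim: n => [|n IH]; first by rewrite /tr2 big_ord0 expr0n !addr0 expr1 addWW.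
rewrite /tr2 big_ord_recr /= -/(tr2 n x) (sqrD 1) -exprM -expnSr.
set S := tr2 n x in IH *; set b := x ^+ (2 ^ n) in IH *.
transitivity ((S ^+ 2 + S) + (x ^+ (2 ^ n.+1) + b)); first by rewrite expn1; ring.
rewrite IH; transitivity (x ^+ (2 ^ n.+1) + x + (b + b)); first by ring.
by rewrite addWW addr0.
Qed.

Let tr2_recl n x : tr2 n.+1 x = x + tr2 n x ^+ 2.
Proof.
rewrite /tr2 big_ord_recl expr1 (sqr_sum _ _ 1); congr (_ + _).
by apply: eq_bigr => i _; rewrite -exprM -expnSr.
Qed.

Let artin_schreier n u f : u ^+ 2 = u + f ^+ 2 -> u ^+ (2 ^ n) = u + tr2 n f ^+ 2.
Proof.
move=> eu; elim: n => [|n IH]; first by rewrite expr1 /tr2 big_ord0 expr0n addr0.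
by rewrite expnSr exprM IH tr2_recl !(sqrD 1) eu addrA.
Qed.

Let tr2_bool x : x ^+ Q = x -> tr2 h x = 0 \/ tr2 h x = 1.
Proof.
move=> fx; have := tr2_sqr h x; rewrite -cardQ fx addWW => e.
have : tr2 h x * (tr2 h x + 1) == 0 by rewrite -e; apply/eqP; ring.
rewrite mulf_eq0 addr_eq0 oppW => /orP[] /eqP; [left|right] => //.
Qed.

Let tr2_mul n d x : \sum_(i < n) (\sum_(j < d) x ^+ (2 ^ (n * j))) ^+ (2 ^ i) = tr2 (n * d) x.
Proof.
elim: d => [|d IH].
  rewrite muln0 /tr2 [RHS]big_ord0 big1 // => i _.
  by rewrite big_ord0 expr0n expn_eq0.
under eq_bigr => i _ do rewrite big_ord_recr sqrD.
rewrite big_split IH mulnSr /tr2 big_split_ord; congr (_ + _).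
by apply: eq_bigr => i _; rewrite -exprM -expnD.
Qed.

(** With [y = u tau] the equation becomes [u^2 = u + (g / tau)^2], and Frobenius moves [u] by the
    absolute trace of [g / tau] at [a]. Partial fractions of [g / tau] turn the sum of its values
    over the roots of [P] into [T P], a combination of logarithmic derivatives of [P] at the roots
    of [tau]. So [T (P * R) = T P + T R]; since [T] also involves the derivative of [P], the modulus
    is [M ^+ 2]. *)
Lemma even_character : quad_character iota tau (g ^+ 2) w.
Proof.
have tau0 : tau != 0 by rewrite -size_poly_gt0 size_tau.
pose l := lead_coef tau; have l0 : l != 0 by rewrite lead_coef_eq0.
have [M [mM sM sepM tauM]] : exists M : {poly K},
    [/\ M \is monic, size M = w.+1, separable_poly M & tau = l *: M].
  exists (l^-1 *: tau); rewrite monicE lead_coefZ mulVf // size_scale ?invr_eq0 //.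
  by rewrite (eqp_separable (eqp_scale _ _)) ?invr_eq0 // scalerA divff // scale1r.
pose g1 := l^-1 *: g.
have [s [us Ms permQ]] := separable_roots iota mM sepM.
have ss : size s = w.
  by apply: succn_inj; rewrite -sM -(size_map_poly iota) Ms size_prod_XsubC.
have Mroot z : root M^i z = (z \in s) by rewrite Ms root_prod_XsubC.
have dM0 z : z \in s -> M^i^`().[z] != 0.
  rewrite -Mroot deriv_map => zs; apply: coprimep_root zs.
  by rewrite coprimep_map; move: sepM; rewrite unlock.
pose n (P : {poly K}) : W := \prod_(z <- s) P^i.[z].
have nM P R : n (P * R) = n P * n R.
  by rewrite /n -big_split; apply: eq_bigr => z _; rewrite rmorphM hornerM.
have nP_neq0 P z : n P != 0 -> z \in s -> P^i.[z] != 0.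
  by move=> nP zs; apply: contraNneq nP => Pz; rewrite /n (big_rem z) //= Pz mul0r.
pose c z := g1^i.[z] / (M^i)^`().[z].
pose T (P : {poly K}) : W := \sum_(z <- s) c z * ((P^i)^`().[z] / P^i.[z]).
have TM P R : n P != 0 -> n R != 0 -> T (P * R) = T P + T R.
  move=> nP nR; rewrite /T -big_split big_seq [RHS]big_seq; apply: eq_bigr => z zs /=.
  have Pz := nP_neq0 P z nP zs; have Rz := nP_neq0 R z nR zs.
  rewrite rmorphM derivM hornerD !hornerM -mulrDr; congr (_ * _).
  by field; rewrite Pz Rz.
have hQ (p : {poly K}) x : p^i.[x] ^+ Q = p^i.[x ^+ Q].
  by have := hornerQ iota 1 p x; rewrite expn1.
have TQ P : T P ^+ Q = T P.
  rewrite {1}cardQ /T sqr_sum -cardQ -[RHS](perm_big _ permQ) big_map.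
  by apply: eq_bigr => z _; rewrite /c !deriv_map !exprMn !exprVn !hQ.
pose X P : int := if n P == 0 then 0 else if tr2 h (T P) == 0 then 1 else - 1.
exists X, (M ^+ 2), tau^i; split; split.
- by rewrite -addnn expr2 monM // mem_mon mM sM eqxx.
- move=> P R; rewrite /X nM mulf_eq0.
  have [|nP] := eqVneq (n P) 0; first by rewrite mul0r.
  have [|nR] := eqVneq (n R) 0; first by rewrite mulr0.
  rewrite /= TM // tr2D.
  case: (tr2_bool (TQ P)) => ->; case: (tr2_bool (TQ R)) => ->;
    by rewrite ?add0r ?addr0 ?addWW ?eqxx ?oner_eq0.
- have -> : X 1 = if n 1 == 0 then 0 else if tr2 h (T 1) == 0 then 1 else - 1 by [].
  have -> : n 1 = 1 by rewrite /n big1 // => z _; rewrite rmorph1 hornerC.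
  have -> : T 1 = 0.
    by rewrite /T big1 // => z _; rewrite rmorph1 derivC horner0 mul0r mulr0.
  by rewrite oner_eq0 /tr2 big1 ?eqxx // => i _; rewrite expr0n expn_eq0.
- move=> P; have modz z : z \in s -> P^i.[z] = (P %% M ^+ 2)^i.[z]
      /\ (P^i)^`().[z] = ((P %% M ^+ 2)^i)^`().[z].
    move=> zs; have Mz : M^i.[z] = 0 by apply/eqP; rewrite -rootE Mroot.
    have -> : P^i = (P %/ M ^+ 2)^i * (M^i * M^i) + (P %% M ^+ 2)^i.
      by rewrite -rmorphM -expr2 -rmorphM -rmorphD -divp_eq.
    rewrite !(derivD, derivM, hornerD, hornerM) Mz.
    by rewrite !(mulr0, mul0r, add0r, addr0).
  rewrite /X; have -> : n (P %% M ^+ 2) = n P.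
    by rewrite /n big_seq [RHS]big_seq; apply: eq_bigr => z /modz[-> _].
  suff -> : T (P %% M ^+ 2) = T P by [].
  by rewrite /T big_seq [RHS]big_seq; apply: eq_bigr => z /modz[-> ->].
- move=> P; rewrite /X; case: ifP => // /negbT nP _.
  by apply: coprimep_expr; apply: (coprimep_roots Ms) => z; apply: nP_neq0.
- by rewrite map_poly_eq0.
- move=> eta eta0 u v eq0.
  have zs : s`_0 \in s by rewrite mem_nth // ss.
  have tz : root tau^i s`_0 by rewrite tauM map_polyZ /= rootZ ?fmorph_eq0 // Mroot.
  set A := tau^i.[eta] in eta0 eq0.
  set B := (g ^+ 2)^i.[eta] in eq0.
  (* In characteristic 2, substituting [s = u + v g A] absorbs the square [v^2 g^2 A^2], and all
     remaining terms are divisible by [tau]. *)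
  apply: (@even_descent _ s`_0 A tau^i g^i B%:P (u + v * g^i * A%:P) v eta0 tz).
  - by rewrite tauM map_polyZ /= derivZ hornerZ mulf_neq0 ?fmorph_eq0 ?dM0.
  - have : coprimep tau^i g^i by rewrite coprimep_map coprimep_sym.
    by move/coprimep_root/(_ tz).
  have pp (p : {poly W}) : p + p = 0.
    by rewrite -mulr2n -scaler_nat (pcharf0 char2) scale0r.
  rewrite -[RHS]addr0 -[X in _ = _ + X](pp (u * v * g^i * A%:P + v ^+ 2 * g^i * tau^i * A%:P ^+ 2
    + v ^+ 2 * B%:P * g^i ^+ 2 *+ 2)) -eq0.
  by rewrite rmorphB rmorphMn !rmorphXn /=; ring.
- move=> z y qy; rewrite oppW eq_sym -subr_eq0 addrK rmorphXn tauM map_polyZ /=.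
  by rewrite hornerZ mulf_eq0 fmorph_eq0 (negPf l0) rootE horner_exp expf_eq0.
move=> d P a y d0 Pd Pa qy.
have [ad Pfac] := irr_root Pd Pa; have [mP sP irrP] := IrrP Pd.
have nP_eq0 z : z \in s -> P^i.[z] = 0 -> P %| M.
  by move=> zs Pz; apply: (irr_dvd_root (iota := iota) (a := z) irrP); [apply/rootP|rewrite Mroot].
have [as_|as_] := boolP (a \in s).
  apply: Or33; split; last by rewrite expr2 dvdp_mulr // (nP_eq0 a) // (rootP Pa).
  by rewrite /X /n (big_rem a) //= (rootP Pa) mul0r eqxx.
have nP : n P != 0.
  rewrite /n prodf_seq_neq0; apply/allP => z zs /=; apply: contraNneq as_ => Pz.
  have /dvdpP[q Mq] := nP_eq0 z zs Pz.
  by rewrite -Mroot Mq rmorphM rootM Pa orbT.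
have Ma : M^i.[a] != 0 by rewrite -rootE Mroot.
have taua : tau^i.[a] != 0 by rewrite tauM map_polyZ hornerZ mulf_neq0 ?fmorph_eq0.
pose f := g^i.[a] / tau^i.[a].
have Mj j : a ^+ (Q ^ j) \notin s.
  by rewrite -Mroot rootE -hornerQ expf_neq0.
have TP : T P = \sum_(j < d) f ^+ (2 ^ (h * j)).
  pose r := [seq a ^+ (Q ^ j) | j : 'I_d <- index_enum 'I_d].
  have Pr : P^i = \prod_(x <- r) ('X - x%:P) by rewrite big_map.
  have Tz z : z \in s -> (P^i)^`().[z] / P^i.[z] = \sum_(j < d) (a ^+ (Q ^ j) - z)^-1.
    move=> zs; rewrite Pr deriv_prod_XsubC; last first.
      by rewrite -root_prod_XsubC -Pr rootE nP_neq0.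
    by rewrite big_map; apply: eq_bigr => j _; congr (_^-1); rewrite -[LHS]oppW opprB.
  transitivity (\sum_(z <- s) \sum_(j < d) c z / (a ^+ (Q ^ j) - z)).
    by rewrite /T big_seq [RHS]big_seq; apply: eq_bigr => z zs; rewrite Tz // mulr_sumr.
  rewrite exchange_big; apply: eq_bigr => j _ /=.
  have sg1 : (size g1^i <= size s)%N.
    by rewrite size_map_poly ss (leq_trans (size_scale_leq _ _)).
  have := lagrange_fractions us sg1 (Mj j); rewrite -Ms /c => ->.
  rewrite expnM -cardQ /f exprMn exprVn !hornerQ tauM map_polyZ /g1 map_polyZ !hornerZ fmorphV.
  by field; rewrite fmorph_eq0 l0 -rootE Mroot Mj.
have trT : tr2 h (T P) = tr2 (h * d) f.
  by rewrite -tr2_mul /tr2; apply: eq_bigr => i _; rewrite TP.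
pose u := y / tau^i.[a].
have u2 : u ^+ 2 = u + f ^+ 2.
  rewrite /u /f; apply: (mulIf (expf_neq0 2 taua)); rewrite mulrDl -!exprMn !divfK //.
  rewrite [X in X + _](_ : _ = tau^i.[a] * y); last by field.
  move/eqP: qy; rewrite rmorphXn horner_exp /= => e.
  rewrite -[X in _ = _ + X]oppW; apply/eqP; rewrite -subr_eq0 -[X in _ == X]e.
  by apply/eqP; ring.
have yQ : y ^+ (Q ^ d) = y + tr2 (h * d) f ^+ 2 * tau^i.[a].
  have -> : y = u * tau^i.[a] by rewrite /u divfK.
  rewrite exprMn hornerQ ad cardQ -expnM (artin_schreier _ u2) mulrDl //.
have XP : X P = if tr2 (h * d) f == 0 then 1 else - 1 by rewrite /X (negPf nP) trT.
case: (tr2_bool (TQ P)); rewrite trT => e; rewrite XP yQ e.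
  by apply: Or31; rewrite eqxx expr0n mul0r addr0.
apply: Or32; rewrite oner_eq0 expr1n mul1r; split=> //.
by rewrite addrC oppW.
Qed.

End EvenCharacter.

(** The case of places of degree one. The alternatives are arranged so that at least [1 - S a] roots
    [y] are sent by Frobenius to the other root [y']: nothing is claimed for 1, two distinct roots
    for -1, one double root for 0. *)
Lemma quad_character_sum (K : finFieldType) (W : closedFieldType)
    (iota : {rmorphism K -> W}) (tau nu : {poly K}) (w : nat) :
  (0 < w)%N -> (size tau <= w.+1)%N -> (size nu <= w.*2.+1)%N ->
  quad_character iota tau nu w ->
  exists2 S : K -> int, (\sum_a S a) ^+ 2 <= (w.*2.-1 ^ 2 * #|K|)%N%:R &
  forall a y, quad_root iota tau nu (iota a) y -> let y' := iota tau.[a] - y in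
  [\/ S a = 1, [/\ S a = - 1, y ^+ #|K| = y' & y != y'] | S a = 0 /\ y ^+ #|K| = y'].
Proof.
move=> w0 st sn [X [N [b [[Nm XM X1 Xmod Xcop] [b0 indep disc frob]]]]].
exists (fun a => X ('X - a%:P)).
  exact: (weil_bound w0 st sn Nm XM X1 Xmod Xcop frob b0 indep).
move=> a y qy y'.
have ra : root (map_poly iota ('X - a%:P)) (iota a).
  by rewrite rmorphB /= map_polyX map_polyC root_XsubC.
have Ia : 'X - a%:P \in Irr K 1.
  rewrite mem_Irr mem_mon monicXsubC size_XsubC eqxx /=.
  by apply/irreducibleP; apply: irredp_XsubC.
have ey' : (map_poly iota tau).[iota a] - y = y' by rewrite horner_map.
have disc_a := disc _ _ qy; rewrite ey' in disc_a.
have := frob 1%N _ _ y isT Ia ra qy; rewrite expn1 ey'.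
case=> [[-> _]|[XN yQ]|[X0 dvN]]; [exact: Or31|apply: Or32|apply: Or33].
  split=> //; rewrite -disc_a; apply/negP => rN.
  have : coprimep ('X - a%:P) N by apply: Xcop; rewrite XN.
  by rewrite -(coprimep_map iota) => /coprimep_root/(_ ra); rewrite -rootE rN.
split=> //; have yy' : y = y'.
  apply/eqP; rewrite -disc_a; have /dvdpP[R ->] := dvN.
  by rewrite rmorphM rootM ra orbT.
have := quad_rootQ 1 qy; rewrite expn1 -rmorphXn expf_card => qyQ.
by case: (quad_root_uniq qy qyQ); rewrite ?ey' // -yy'.
Qed.

(** * Points on double covers with prescribed trace and norm *)

Section FixedField.
Variables (L : finFieldType) (phi : {rmorphism L -> L}).
Definition fixed_by : {pred L} := [pred x | phi x == x].
Lemma fixed_by_divring : divring_closed fixed_by.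
Proof.
split=> [|x y|x y]; rewrite !inE ?rmorph1 // => /eqP fx /eqP fy.
  by rewrite rmorphB fx fy.
by rewrite fmorph_div fx fy.
Qed.
HB.instance Definition _ := GRing.isDivringClosed.Build L fixed_by fixed_by_divring.
Definition fixed_field := {x : L | fixed_by x}.
HB.instance Definition _ := SubChoice.on fixed_field.
HB.instance Definition _ := Finite.on fixed_field.
HB.instance Definition _ := [SubChoice_isSubIntegralDomain of fixed_field by <:].
HB.instance Definition _ := [SubIntegralDomain_isSubField of fixed_field by <:].
End FixedField.

Section PowerMorphism.
Variables (L : finFieldType) (m : nat) (mL : [pchar L].-nat m).
Definition pow_morph of [pchar L].-nat m := fun x : L => x ^+ m.
Lemma pow_morph_additive : zmod_morphism (pow_morph mL).
Proof.
move=> x y; rewrite /pow_morph; apply/eqP; rewrite eq_sym subr_eq.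
by rewrite -(exprDn_pchar _ _ mL) subrK.
Qed.
Lemma pow_morph_multiplicative : monoid_morphism (pow_morph mL).
Proof. by split=> [|x y]; rewrite /pow_morph ?expr1n ?exprMn. Qed.
HB.instance Definition _ := GRing.isZmodMorphism.Build L L (pow_morph mL) pow_morph_additive.
HB.instance Definition _ := GRing.isMonoidMorphism.Build L L (pow_morph mL) pow_morph_multiplicative.
End PowerMorphism.

Section FixedByPower.
Variables (L : finFieldType) (Q : nat).
Hypothesis QL : [pchar L].-nat Q.
Local Notation bar := (pow_morph QL).
Local Notation subK := (fixed_field bar).

Lemma subKP x : bar x = x -> exists a : subK, val a = x.
Proof.
move=> fx; have px : fixed_by bar x by rewrite /fixed_by /= fx.
by exists (Sub x px); rewrite SubK.
Qed.

Lemma bar_val (a : subK) : bar (val a) = val a.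
Proof. by apply/eqP; have := valP a. Qed.

(** [X^Q - X] divides [X^(Q^m) - X], a product of distinct linear factors over [L]; hence it has
    exactly [Q] roots there. *)
Lemma card_subK m : (0 < m)%N -> #|L| = (Q ^ m)%N -> #|{: subK}| = Q.
Proof.
move=> m0 cardL; have Q1 : (1 < Q)%N.
  by have := finNzRing_gt1 L; rewrite cardL; case: (Q) => [|[|]] //; rewrite ?exp0n ?exp1n.
have sX : size ('X^Q - 'X : {poly L}) = Q.+1.
  by rewrite size_polyDl size_polyXn // size_polyN size_polyX ltnS.
have dv : 'X^Q - 'X %| \prod_(x : L) ('X - x%:P).
  rewrite -finField_genPoly cardL; elim: (m) => [|j IHj]; first by rewrite subrr dvdp0.
  have -> : 'X^(Q ^ j.+1) - 'X = ('X^(Q ^ j) - 'X) ^+ Q + ('X^Q - 'X) :> {poly L}.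
    have QLp : [pchar {poly L}].-nat Q.
      apply: sub_in_pnat QL => p _; apply: (rmorph_pchar (@polyC L)).
    have := exprDn_pchar ('X^(Q ^ j) - 'X : {poly L}) 'X QLp; rewrite subrK expnSr exprM => ->.
    by rewrite addrA.
  apply: dvdp_add => //; apply: (dvdp_trans IHj).
  by case: (Q) Q1 => // i _; rewrite exprS dvdp_mulr.
have [k em] := dvdp_prod_XsubC dv.
have /eqP := eqp_size em; rewrite sX size_prod_XsubC eqSS => /eqP sm.
apply/eqP; rewrite eqn_leq; apply/andP; split.
  rewrite cardE -(size_map val) -ltnS -sX.
  apply: max_poly_roots; first by rewrite -size_poly_gt0 sX.
    apply/allP => _ /mapP[a _ ->]; rewrite rootE !hornerE.
    by rewrite -/(pow_morph QL _) bar_val subrr.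
  by rewrite map_inj_uniq ?enum_uniq //; apply: val_inj.
have im x : x \in mask k (index_enum L) -> exists a : subK, val a = x.
  move=> xm; apply: subKP; apply/eqP; rewrite -subr_eq0.
  have : root ('X^Q - 'X) x by rewrite (eqp_root em) root_prod_XsubC.
  by rewrite rootE !hornerE.
have um : uniq (mask k (index_enum L)) by rewrite mask_uniq // index_enum_uniq.
rewrite cardE -(size_map val) [Q in (Q <= _)%N]sm; apply: uniq_leq_size um _ => x /im[a <-].
by rewrite map_f // mem_enum.
Qed.
End FixedByPower.

Section QuadraticExtension.
Variables (L : finFieldType) (Q : nat).
Hypothesis QL : [pchar L].-nat Q.
Hypothesis cardL : #|L| = (Q * Q)%N.
Local Notation bar := (pow_morph QL).
Local Notation subK := (fixed_field bar).

Lemma barK : involutive bar.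
Proof. by move=> x; rewrite /pow_morph -exprM -cardL expf_card. Qed.

(* Points of the double cover, twisted so that the two sheets are swapped by [bar]. *)
Definition twisted_roots (t u : L) : {set L} :=
  [set y | (y + bar y == t) && (y * bar y == u)].

Lemma twisted_roots_count (W : closedFieldType) (e : {rmorphism L -> W})
    (iota : {rmorphism subK -> W}) (tau nu : {poly subK}) (S : subK -> int) (a : subK) :
  (forall b, iota b = e (val b)) ->
  (forall y, quad_root iota tau nu (iota a) y -> let y' := iota tau.[a] - y in
    [\/ S a = 1, [/\ S a = - 1, y ^+ Q = y' & y != y'] | S a = 0 /\ y ^+ Q = y']) ->
  1 - S a <= #|twisted_roots (val tau.[a]) (val nu.[a])|%:R.
Proof.
move=> iotaE Sa; have [y qy] := ex_quad_root iota tau nu (iota a).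
pose y' := e (val tau.[a]) - y.
have eprod : y * y' = e (val nu.[a]).
  move/eqP: qy; rewrite !horner_map !iotaE /y' => ee.
  by apply/eqP; rewrite -subr_eq0 -oppr_eq0 -[X in _ == X]ee; apply/eqP; ring.
have mem : y ^+ Q = y' -> exists2 x, e x = y & x \in twisted_roots (val tau.[a]) (val nu.[a]).
  move=> yQ; have y'Q : y' ^+ Q = y.
    have QW : [pchar W].-nat Q by rewrite (eq_pnat _ (fmorph_pchar e)).
    have := exprDn_pchar y' y QW; rewrite yQ /y' subrK -rmorphXn /=.
    by rewrite -[_ ^+ Q]/(bar (val tau.[a])) bar_val -/y' => eqy; rewrite -[LHS](addrK y') -eqy /y' subKr.
  have [x ex] : exists x, y = e x by apply: fixQ_iota; rewrite cardL exprM yQ y'Q.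
  have ebx : e (bar x) = y' by rewrite /pow_morph rmorphXn /= -ex.
  exists x => //; rewrite inE -!(inj_eq (fmorph_inj e)) rmorphD rmorphM /= ebx -ex eprod.
  by rewrite /y' addrC subrK !eqxx.
have ey' : iota tau.[a] - y = y' by rewrite iotaE.
have := Sa y qy; rewrite /= ey'; case=> [->|[-> yQ neq]|[-> yQ]]; first by rewrite subrr.
  have [x ex xT] := mem yQ.
  have xT' : bar x \in twisted_roots (val tau.[a]) (val nu.[a]).
    by move: xT; rewrite !inE barK addrC [bar x * x]mulrC.
  have neqx : bar x != x.
    by rewrite -(inj_eq (fmorph_inj e)) rmorphXn /= ex yQ eq_sym.
  have : (#|[set x; bar x]| <= #|twisted_roots (val tau.[a]) (val nu.[a])|)%N.
    by apply/subset_leq_card/subsetP => z; rewrite !inE => /orP[] /eqP ->; move: xT xT'; rewrite !inE.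
  by rewrite cards2 eq_sym neqx opprK -(ler_nat int) /=.
have [x _ xT] := mem yQ; rewrite subr0 (ler_nat int 1) card_gt0.
by apply/set0Pn; exists x.
Qed.
End QuadraticExtension.

Section Parity.
Variable K : finFieldType.

Lemma card_parity : (odd #|K| /\ 2%:R != 0 :> K) \/
  (exists h, #|K| = (2 ^ h)%N) /\ 2%:R = 0 :> K.
Proof.
have [p pp pK] := finPcharP K; have := pchar_nat_card K.
rewrite (eq_pnat _ (pcharf_eq pK)) => /p_natP[h Kh].
have [p2|op] := even_prime pp.
  by right; split; [exists h; rewrite -p2|rewrite p2 in pK; apply: pcharf0 pK].
left; rewrite Kh oddX op orbT; split=> //; rewrite -(dvdn_pcharf pK).
by apply: contraTN op => /(dvdn_leq (isT : (0 < 2)%N)); case: (p) pp => [|[|[|]]].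
Qed.

Lemma char2_sqrt h (x : K) : #|K| = (2 ^ h)%N -> exists y, x = y ^+ 2.
Proof.
case: h => [|h] cF; first by have := finNzRing_gt1 K; rewrite cF.
by exists (x ^+ (2 ^ h)); rewrite -exprM mulnC -expnS -cF expf_card.
Qed.
End Parity.

Lemma coprimep_subMl (F : fieldType) (p q r : {poly F}) :
  coprimep (r * q - p) q = coprimep p q.
Proof.
by rewrite coprimep_sym coprimep_addl_mul -scaleN1r coprimepZr ?oppr_eq0 ?oner_eq0 // coprimep_sym.
Qed.

Lemma size_linear_leq (R : nzRingType) (a b : R) : (size (a *: 'X + b%:P)%R <= 2)%N.
Proof.
apply: (leq_trans (size_polyD _ _)); rewrite geq_max (leq_trans (size_scale_leq _ _)) ?size_polyX //.
exact: leq_trans (size_polyC_leq1 _) _.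
Qed.

(** * The characters of the two curves *)

Section Curves.
Variables (K : finFieldType) (c u : K) (m : nat).
Hypotheses (m_gt1 : (1 < m)%N) (m0 : m%:R = 0 :> K).
Hypotheses (c0 : c != 0) (c1 : c != 1) (u0 : u != 0).

(** For [y] of norm [c] and trace [t], the norm of [1 + delta v] at [v = y / delta] is [1 + t + c].
    This is the [t] for which it equals [u b^(m-1)]; with [u = (1 - c) sigma(theta) / theta] that
    means [a = (1 / b)^(sigma - 1)]. *)
Definition kummer_trace : {poly K} := u *: 'X^(m.-1) - (1 + c)%:P.

Lemma size_kummer_trace : size kummer_trace = m.-1.+1.
Proof.
rewrite size_polyDl size_scale // size_polyXn // size_polyN ltnS.
by apply: leq_trans (size_polyC_leq1 _) _; case: (m) m_gt1 => [|[]].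
Qed.

(** Since [m = 0] in [K], the derivative of the trace is a nonzero multiple of [X^(m-2)], so
    multiple roots can only occur at 0, or on the trace, where the discriminant is [- 4 c]. At 0 the
    discriminant is [(1 - c)^2]; in characteristic 2 the trace itself must be separable, and at 0 it
    is [1 + c], nonzero as [c <> 1]. *)
Lemma kummer_character (W : closedFieldType) (iota : {rmorphism K -> W}) :
  quad_character iota kummer_trace c%:P m.-1.
Proof.
have w0 : (0 < m.-1)%N by case: (m) m_gt1 => [|[]].
have stau := size_kummer_trace.
have ltau : lead_coef kummer_trace = u.
  rewrite lead_coefDl ?lead_coefZ ?lead_coefXn ?mulr1 // size_scale // size_polyXn size_polyN ltnS.
  exact: leq_trans (size_polyC_leq1 _) w0.
have tau' : kummer_trace^`() = - u *: 'X^(m.-2).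
  rewrite derivB derivZ derivXn derivC subr0 -scaler_nat scalerA; congr (_ *: _).
  by rewrite -[m.-1]subn1 natrB ?(ltnW m_gt1) // m0 sub0r mulrN1.
have tau0 : kummer_trace.[0] = - (1 + c).
  by rewrite !hornerE expr0n; case: (m.-1) w0 => // ? _; rewrite mulr0 sub0r.
have copX (p : {poly K}) : p.[0] != 0 -> coprimep p (- u *: 'X^(m.-2)).
  move=> p0; rewrite coprimepZr ?oppr_eq0 // coprimep_expr //.
  by rewrite -['X]subr0 -polyC0 coprimep_XsubC.
case: (card_parity K) => [[oK two]|[[h Kh] two]]; last first.
  have [k ck] := char2_sqrt c Kh.
  have c1' : 1 + c != 0.
    apply: contraNneq c1 => e; rewrite -subr_eq0 (_ : c - 1 = 2%:R * c - (1 + c)); last by ring.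
    by rewrite two e mul0r subrr.
  have k0 : k != 0 by apply: contraNneq c0 => ek; rewrite ck ek expr0n.
  have -> : c%:P = k%:P ^+ 2 :> {poly K} by rewrite ck rmorphXn.
  apply: (even_character iota Kh w0 stau) => //.
  - exact: leq_trans (size_polyC_leq1 _) w0.
  - by rewrite unlock tau' copX // tau0 oppr_eq0.
  - by rewrite coprimep_sym -[k%:P]mulr1 mul_polyC coprimepZr // coprimep1.
have four : 4%:R != 0 :> K by rewrite -[4%N]/((2 * 2)%N) natrM mulf_neq0.
have st2 : size (kummer_trace ^+ 2) = m.-1.*2.+1 by rewrite expr2 size_mul -?size_poly_gt0 stau // addnS addSn addnn.
have sn4 : (size (- (c%:P *+ 4) : {poly K}) <= 1)%N by rewrite size_polyN -polyCMn size_polyC_leq1.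
have lt_s : (size (- (c%:P *+ 4))%R < size (kummer_trace ^+ 2)%R)%N.
  by rewrite st2; apply: leq_ltn_trans sn4 _; rewrite ltnS double_gt0.
apply: (@odd_character _ _ _ _ _ _ u) => //.
- by rewrite size_polyDl.
- by rewrite lead_coefDl // lead_coef_exp ltau.
rewrite unlock derivB derivMn derivC mul0rn subr0 deriv_exp expr1 -mulr_natl.
rewrite -polyC_natr mul_polyC coprimepZr // coprimepMr tau'; apply/andP; split.
  apply: copX; rewrite hornerD hornerN horner_exp hornerMn hornerC tau0 sqrrN.
  rewrite (_ : _ - _ = (1 - c) ^+ 2); last by rewrite -[c *+ 4]mulr_natl; ring.
  by rewrite expf_neq0 // subr_eq0 eq_sym.
rewrite expr2 coprimep_subMl coprimep_sym -polyCMn -[X in coprimep _ X]mulr1 mul_polyC coprimepZr ?coprimep1 //.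
by rewrite -mulr_natl mulf_neq0.
Qed.

Variables (d t v : K).
(** The first curve in the coordinate [b]: as [b^m] is additive in [b], trace and norm at
    [z = b + omega] are polynomials. In the application [t] and [v] are the trace and norm of
    [sigma omega], and [d] is the value at [b = 0]. *)
Definition additive_trace : {poly K} := u *: 'X - (1 + c) *: 'X^m + d%:P.
Definition additive_norm : {poly K} := c *: ('X^(m.*2) + t *: 'X^m + v%:P).

Lemma size_additive_trace : (size additive_trace <= m.+1)%N.
Proof.
rewrite /additive_trace addrAC; apply: (leq_trans (size_polyD _ _)); rewrite geq_max size_polyN.
rewrite [X in _ && X](leq_trans (size_scale_leq _ _)) ?size_polyXn // andbT.
exact: leq_trans (size_linear_leq _ _) (leqW m_gt1).
Qed.

Lemma size_additive_norm : (size additive_norm <= m.*2.+1)%N.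
Proof.
apply: (leq_trans (size_scale_leq _ _)); rewrite -addrA.
apply: (leq_trans (size_polyD _ _)); rewrite geq_max size_polyXn leqnn /=.
apply: (leq_trans (size_polyD _ _)); rewrite geq_max (leq_trans (size_polyC_leq1 _)) // andbT.
by apply: (leq_trans (size_scale_leq _ _)); rewrite size_polyXn ltnS -addnn leq_addr.
Qed.

Lemma additive_trace_deriv : additive_trace^`() = u%:P.
Proof.
rewrite derivD derivB !derivZ derivX derivXn derivC addr0 -[_ *+ m]mulr_natl -polyC_natr m0.
by rewrite mul0r scaler0 subr0 alg_polyC.
Qed.

Lemma coprimep_unit (p : {poly K}) (a : K) : a != 0 -> coprimep p a%:P.
Proof. by move=> a0; rewrite -[a%:P]mulr1 mul_polyC coprimepZr // coprimep1. Qed.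

Hypothesis cop : coprimep additive_norm additive_trace.

(** As [m = 0] in [K], the norm has derivative 0 and the trace has derivative [u], so the
    discriminant is separable as soon as it is coprime to the trace, which is [cop]. Its leading
    coefficient is [(1 + c)^2 - 4 c = (1 - c)^2], the required square. *)
Lemma additive_character_odd (W : closedFieldType) (iota : {rmorphism K -> W}) :
  2%:R != 0 :> K -> odd #|K| ->
  quad_character iota additive_trace additive_norm m.
Proof.
move=> two oK.
have four : 4%:R != 0 :> K by rewrite -[4%N]/((2 * 2)%N) natrM mulf_neq0.
pose P0 := (u *: 'X + d%:P) ^+ 2 - (c * v *+ 4)%:P.
pose P1 := - ((1 + c) *+ 2) *: (u *: 'X + d%:P) - (c * t *+ 4)%:P.
have DE : additive_trace ^+ 2 - additive_norm *+ 4 = (1 - c) ^+ 2 *: 'X^(m.*2) + (P0 + P1 * 'X^m).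
  rewrite /additive_trace /additive_norm /P0 /P1 -muln2 exprM -!mul_polyC.
  by rewrite ?(polyCMn, polyCM, polyCD, polyCN, rmorphXn) /=; ring.
have c12 : (1 - c) ^+ 2 != 0 by rewrite expf_neq0 // subr_eq0 eq_sym.
have sR : (size (P0 + P1 * 'X^m)%R < size ((1 - c) ^+ 2 *: 'X^(m.*2) : {poly K}))%N.
  rewrite size_scale // size_polyXn ltnS.
  have sl : (size (u *: 'X + d%:P)%R <= 2)%N by apply: size_linear_leq.
  apply: (leq_trans (size_polyD _ _)); rewrite geq_max; apply/andP; split.
    apply: (leq_trans (size_polyD _ _)); rewrite geq_max size_polyN; apply/andP; split.
      rewrite expr2; apply: leq_trans (size_polyMleq _ _) _.
      by move: sl m_gt1; move: (size _) => z; lia.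
    apply: leq_trans (size_polyC_leq1 _) _; lia.
  apply: leq_trans (size_polyMleq _ _) _; rewrite size_polyXn addnS /=.
  have : (size P1 <= 2)%N.
    apply: (leq_trans (size_polyD _ _)); rewrite geq_max size_polyN.
    by rewrite (leq_trans (size_scale_leq _ _)) // (leq_trans (size_polyC_leq1 _)).
  by move: m_gt1; move: (size _) => z; lia.
apply: (@odd_character _ _ _ _ _ _ (1 - c)) => //.
- exact: ltnW.
- by rewrite DE size_polyDl // size_scale // size_polyXn.
- by rewrite DE lead_coefDl // lead_coefZ lead_coefXn mulr1.
rewrite unlock derivB derivMn deriv_exp additive_trace_deriv.
have -> : additive_norm^`() = 0.
  have dX : ('X^m)^`() = 0 :> {poly K}.
    by rewrite derivXn -mulr_natl -polyC_natr m0 mul0r.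
  rewrite /additive_norm -muln2 exprM derivZ !derivD derivZ deriv_exp dX derivC.
  by rewrite mul0r mul0rn scaler0 !addr0 scaler0.
rewrite mul0rn subr0 expr1 -mulr_natl -polyC_natr mul_polyC coprimepZr // mul_polyC coprimepZr //.
rewrite expr2 coprimep_subMl -mulr_natl -polyC_natr mul_polyC coprimepZl //.
Qed.

(* The cover has the form [Y^2 - tau Y + g^2] only after [Y] is shifted by [j tau];
   [j = c / (1 + c)] is the choice for which the leading term of [g] cancels. *)
Lemma additive_character_even h : 2%:R = 0 :> K -> #|K| = (2 ^ h)%N ->
  exists (g : {poly K}) (j : K), [/\ (size g <= m)%N, g ^+ 2 = additive_norm + (j ^+ 2 + j) *: additive_trace ^+ 2 &
  forall (W : closedFieldType) (iota : {rmorphism K -> W}),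
    quad_character iota additive_trace (g ^+ 2) m].
Proof.
move=> two Kh.
have c1' : 1 + c != 0.
  apply: contraNneq c1 => e; rewrite -subr_eq0 (_ : c - 1 = 2%:R * c - (1 + c)); last by ring.
  by rewrite two e mul0r subrr.
have [k ck] := char2_sqrt c Kh; have [t1 et] := char2_sqrt t Kh; have [v1 ev] := char2_sqrt v Kh.
have k0 : k != 0 by apply: contraNneq c0 => ek; rewrite ck ek expr0n.
have [m' em] : exists m', m = m'.*2.
  exists m./2; case om : (odd m); last by rewrite -[LHS]odd_double_half om.
  have /eqP := m0; rewrite -[m]odd_double_half om natrD -muln2 natrM two mulr0 addr0.
  by rewrite oner_eq0.
pose g0 : {poly K} := k *: ('X^m + t1 *: 'X^m' + v1%:P).
pose b := k / (1 + c).
have twoP : 2%:R = 0 :> {poly K} by rewrite -polyC_natr two.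
have g02 : g0 ^+ 2 = additive_norm.
  rewrite /g0 /additive_norm ck et ev em -!mul_polyC.
  rewrite -[m'.*2.*2]muln2 -[m'.*2]muln2 !exprM ?(polyCMn, polyCM, polyCD, polyCN, rmorphXn) /=.
  apply/eqP; rewrite -subr_eq0; set Y := 'X^m'; set A := _%:P; set B := t1%:P; set C := v1%:P.
  rewrite (_ : _ - _ = 2%:R * (A ^+ 2 * (B * Y ^+ 3 + C * Y ^+ 2 + B * C * Y))); last by ring.
  by rewrite twoP mul0r.
pose g := g0 + b *: additive_trace.
have sg : (size g <= m)%N.
  have -> : g = k *: (t1 *: 'X^m' + v1%:P) + b *: (u *: 'X + d%:P).
    apply/eqP; rewrite /g /g0 /additive_trace -subr_eq0 -!mul_polyC.
    rewrite (_ : _ - _ = (k%:P - b%:P * (1 + c)%:P) * 'X^m); last by ring.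
    by rewrite -polyCM /b divfK // subrr mul0r.
  have m'm : (m' < m)%N by lia.
  apply: (leq_trans (size_polyD _ _)); rewrite geq_max; apply/andP; split.
    apply: (leq_trans (size_scale_leq _ _)); apply: (leq_trans (size_polyD _ _)).
    rewrite geq_max (leq_trans (size_scale_leq _ _)) ?size_polyXn //=.
    exact: leq_trans (size_polyC_leq1 _) (ltnW m_gt1).
  by apply: (leq_trans (size_scale_leq _ _)); apply: leq_trans (size_linear_leq _ _) _.
have st : size additive_trace = m.+1.
  have e : additive_trace = - (1 + c) *: 'X^m + (u *: 'X + d%:P).
    by rewrite /additive_trace -!mul_polyC polyCN; ring.
  rewrite e size_polyDl size_scale ?oppr_eq0 // size_polyXn // ltnS.
  exact: leq_trans (size_linear_leq _ _) _.
exists g, (c / (1 + c)); split=> //.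
  rewrite /g -g02 -mul_polyC -mul_polyC.
  have -> : (c / (1 + c)) ^+ 2 + c / (1 + c) = b ^+ 2.
    rewrite /b [in RHS]expr_div_n -ck; apply/eqP; rewrite -subr_eq0.
    rewrite (_ : _ - _ = 2%:R * c ^+ 2 / (1 + c) ^+ 2); last by field.
    by rewrite two !mul0r.
  rewrite rmorphXn /=; apply/eqP; rewrite -subr_eq0.
  rewrite (_ : _ - _ = 2%:R * (g0 * b%:P * additive_trace)); last by ring.
  by rewrite twoP mul0r.
move=> W iota; apply: (even_character iota Kh _ st sg).
- exact: ltnW.
- by rewrite unlock additive_trace_deriv coprimep_unit.
rewrite /g addrC -mul_polyC coprimep_sym coprimep_addl_mul coprimep_sym.
by rewrite -(@coprimep_pexpl _ 2) // g02.
Qed.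
End Curves.

Section TwistedCounts.
Variables (L : finFieldType) (Q : nat).
Hypothesis QL : [pchar L].-nat Q.
Hypothesis cardL : #|L| = (Q * Q)%N.
Local Notation bar := (pow_morph QL).
Local Notation K := (fixed_field bar).
Local Notation T := (twisted_roots QL).

Lemma card_fixed : #|{: K}| = Q.
Proof. by apply: (@card_subK _ _ _ 2); rewrite // expnS expn1. Qed.

Lemma twisted_count (tau nu : {poly K}) (w : nat) :
  (0 < w)%N -> (size tau <= w.+1)%N -> (size nu <= w.*2.+1)%N ->
  (forall (W : closedFieldType) (iota : {rmorphism K -> W}), quad_character iota tau nu w) ->
  exists2 E : int, E ^+ 2 <= (w.*2.-1 ^ 2 * Q)%N%:R &
    Q%:R - E <= (\sum_a #|T (val tau.[a]) (val nu.[a])|)%N%:R.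
Proof.
move=> w0 st sn qc; have [W [e _]] := countable_algebraic_closure L.
pose iota : {rmorphism K -> W} := e \o val.
have [S S2 Sa] := quad_character_sum w0 st sn (qc W iota).
have cK := card_fixed.
exists (\sum_a S a); first by apply: le_trans S2 _; rewrite cK.
apply: le_trans (_ : \sum_a (1 - S a) <= _); last first.
  rewrite natr_sum; apply: ler_sum => a _.
  apply: (twisted_roots_count cardL (e := e) (iota := iota)) => // y qy.
  by have := Sa a y qy; rewrite cK.
by rewrite sumrB sumr_const cK.
Qed.

Variables (c u : K) (m : nat).
Hypotheses (m_gt1 : (1 < m)%N) (m0 : m%:R = 0 :> K).
Hypotheses (c0 : c != 0) (c1 : c != 1) (u0 : u != 0).

Lemma kummer_count :
  exists2 E : int, E ^+ 2 <= (m.-1.*2.-1 ^ 2 * Q)%N%:R &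
    Q%:R - E <= (\sum_a #|T (val (kummer_trace c u m).[a]) (val c)|)%N%:R.
Proof.
have w0 : (0 < m.-1)%N by case: (m) m_gt1 => [|[]].
have [] := @twisted_count (kummer_trace c u m) c%:P m.-1 w0.
- by rewrite size_kummer_trace.
- exact: leq_trans (size_polyC_leq1 _) _.
- by move=> W iota; apply: kummer_character.
move=> E E2 EL; exists E => //.
by under [X in _ <= X%:R]eq_bigr => a _ do rewrite -[X in T _ (val X)](hornerC c a).
Qed.

(** In characteristic 2, adding [j t] to [y] keeps the trace and adds [(j^2 + j) t^2] to the norm;
    this undoes the shift that made the norm a square [g ^+ 2]. *)
Lemma twisted_roots_shift (t v j : L) : 2%:R = 0 :> L -> bar t = t -> bar j = j ->
  (#|T t (v + (j ^+ 2 + j) * t ^+ 2)%R| <= #|T t v|)%N.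
Proof.
move=> two bt bj; rewrite -(card_imset _ (addIr (j * t))); apply: subset_leq_card.
apply/subsetP => _ /imsetP[x xT ->]; move: xT.
rewrite !inE rmorphD rmorphM /= bt bj => /andP[/eqP s /eqP p].
have bx : bar x = t - x by rewrite -s addrC addKr.
move: p; rewrite bx => p; apply/andP; split; apply/eqP.
  by rewrite (_ : x + _ + _ = t + 2%:R * (j * t)); [rewrite two mul0r addr0|ring].
apply: (addIr ((j ^+ 2 + j) * t ^+ 2)); rewrite -p.
rewrite (_ : (x + j * t) * (t - x + j * t) + _ = x * (t - x) + 2%:R * ((j ^+ 2 + j) * t ^+ 2)); last by ring.
by rewrite two mul0r addr0.
Qed.

Variables (d t v : K).
Hypothesis cop : coprimep (additive_norm c m t v) (additive_trace c u m d).

Lemma additive_count :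
  exists2 E : int, E ^+ 2 <= (m.*2.-1 ^ 2 * Q)%N%:R &
    Q%:R - E <= (\sum_a #|T (val (additive_trace c u m d).[a]) (val (additive_norm c m t v).[a])|)%N%:R.
Proof.
have w0 : (0 < m)%N by apply: ltnW.
have st := size_additive_trace c u m_gt1 d.
case: (card_parity K) => [[oK two]|[[h Kh] two]].
  apply: twisted_count => //; first exact: size_additive_norm.
  by move=> W iota; apply: additive_character_odd.
have [g [j [sg g2 qc]]] := additive_character_even m_gt1 m0 c0 c1 u0 cop two Kh.
have sg2 : (size (g ^+ 2)%R <= m.*2.+1)%N.
  rewrite expr2; apply: leq_trans (size_polyMleq _ _) _.
  by move: sg; move: (size g) => z; lia.
have [E E2 EL] := twisted_count w0 st sg2 qc.
exists E => //; apply: le_trans EL _; rewrite ler_nat; apply: leq_sum => a _.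
have two' : 2%:R = 0 :> L by have := congr1 val two; rewrite rmorph_nat rmorph0.
rewrite g2; move: (additive_trace _ _ _ _) (additive_norm _ _ _ _) => tr nm.
rewrite hornerD hornerZ horner_exp rmorphD rmorphM rmorphD !rmorphXn /=.
by apply: twisted_roots_shift => //; apply: bar_val.
Qed.

End TwistedCounts.

(** * The map f on a scattered set *)

Section Eigenvalues.
Variables (L : finFieldType) (sig bar : {rmorphism L -> L}).
Hypotheses (barK : involutive bar) (sig_bar : forall x, sig (bar x) = bar (sig x)).
Variables (delta omega : L).
Hypothesis omegaN : bar omega != omega.
Hypothesis delta0 : delta != 0.
Definition binomial_map x := sig x + delta * sig (bar x).

Lemma rmorph_surj v : exists w, sig w = v.
Proof.
have := inj_card_onto (fmorph_inj sig) (leqnn _) v.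
by move=> /codomP[w ->]; exists w.
Qed.

(** The average [t + bar v * bar t] solves the equation for every [t]. It vanishes at [t = 1] only
    if [v = -1], and then [t = omega] works. *)
Lemma hilbert90 v : v * bar v = 1 -> exists2 x, x != 0 & bar x = v * x.
Proof.
move=> Nv; have ex t : bar (t + bar v * bar t) = v * (t + bar v * bar t).
  by rewrite rmorphD rmorphM !barK mulrDr !mulrA Nv mul1r addrC.
have [e1|ne1] := eqVneq (1 + bar v * bar 1) 0; last by exists (1 + bar v * bar 1).
exists (omega + bar v * bar omega); rewrite ?ex //.
have -> : bar v = - 1 by move: e1; rewrite rmorph1 mulr1 addrC => /eqP; rewrite addr_eq0 => /eqP.
by rewrite mulN1r subr_eq0 eq_sym.
Qed.

Lemma twisted_hilbert90 v : v * bar v = 1 -> exists2 x, x != 0 & sig (bar x) = v * sig x.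
Proof.
move=> Nv; have [w ew] := rmorph_surj v.
have [|x x0 ex] := @hilbert90 w.
  by apply: (fmorph_inj sig); rewrite rmorphM sig_bar ew Nv rmorph1.
by exists x => //; rewrite ex rmorphM ew.
Qed.

Lemma norm1_kernel : delta * bar delta = 1 ->
  exists2 x, x != 0 & forall a, bar a = a -> binomial_map (a * x) = a * binomial_map x.
Proof.
move=> N1; have [|x x0 ex] := @twisted_hilbert90 (- delta^-1).
  by rewrite rmorphN fmorphV mulrNN -invfM N1 invr1.
exists x => // a ba.
have fx : binomial_map x = 0 by rewrite /binomial_map ex; field.
by rewrite fx mulr0 /binomial_map !rmorphM /= ba ex; field.
Qed.

Hypothesis eigen : forall x l, x != 0 -> binomial_map (l * x) = l * binomial_map x -> bar l = l.
Let c := delta * bar delta.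
Hypothesis c1 : c != 1.
Let theta := omega - bar omega.
Definition shifted_norm v := (1 + delta * v) * (1 + bar delta * bar v).

Lemma bar_theta : bar theta = - theta.
Proof. by rewrite rmorphB barK opprB. Qed.

Lemma theta0 : theta != 0.
Proof. by rewrite subr_eq0 eq_sym. Qed.

Lemma one_addr_neq0 v : v * bar v = 1 -> 1 + delta * v != 0.
Proof.
move=> Nv; apply: contraNneq c1 => e; rewrite /c -[X in X == _]mulr1 -Nv.
have e' : 1 + bar delta * bar v = 0.
  by have := congr1 bar e; rewrite rmorphD rmorphM rmorph1 rmorph0.
apply/eqP; rewrite (_ : _ * _ = (delta * v) * (bar delta * bar v)); last by ring.
by move/eqP: e; move/eqP: e'; rewrite !addr_eq0 ![1 == _]eq_sym !eqr_oppLR => /eqP -> /eqP ->; rewrite mulrNN mulr1.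
Qed.

Lemma shifted_norm_neq0 v : v * bar v = 1 -> shifted_norm v != 0.
Proof.
move=> Nv; have e := one_addr_neq0 Nv; rewrite mulf_neq0 //.
by rewrite -(fmorph_eq0 bar) rmorphD !rmorphM !barK rmorph1.
Qed.

(* For [x] with [sig (bar x) = v * sig x], this is [f (bar z * x) = a * bar z * f x] with
   [a = (1 - c) * sig theta / (theta * shifted_norm v)], denominators cleared. *)
Definition aligned z v := (sig (bar z) + delta * v * sig z) * shifted_norm v * theta
  = (1 - c) * sig theta * bar z * (1 + delta * v).

(** The eigenvalue is [bar z / d]: the last hypothesis says [sig d = a d], which cancels the factor
    [a], and [bar z / d] is not fixed by [bar] since [z] is not. *)
Lemma aligned_eigen z d v : v * bar v = 1 -> bar z != z -> aligned z v ->
  bar d = d -> d != 0 -> sig d * shifted_norm v * theta = (1 - c) * sig theta * d -> False.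
Proof.
move=> Nv bz Az bd d0 ed; have [x x0 ex] := twisted_hilbert90 Nv.
have Nth : shifted_norm v * theta != 0 by rewrite mulf_neq0 ?shifted_norm_neq0 ?theta0.
have sd0 : sig d != 0 by rewrite fmorph_eq0.
have key : sig d * (bar z * (1 + delta * v)) = d * (sig (bar z) + delta * v * sig z).
  apply: (mulIf Nth).
  transitivity ((sig d * shifted_norm v * theta) * (bar z * (1 + delta * v))); first by ring.
  rewrite ed; transitivity (d * ((1 - c) * sig theta * bar z * (1 + delta * v))); first by ring.
  by rewrite -Az; ring.
have : bar (bar z / d) = bar z / d.
  apply: (eigen x0); rewrite /binomial_map !rmorphM /= barK !fmorphV bd ex.
  transitivity ((d * (sig (bar z) + delta * v * sig z)) * sig x / (sig d * d)).
    by field; rewrite d0 sd0.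
  by rewrite -key; field; rewrite d0 sd0.
rewrite rmorphM fmorphV bd barK => /(mulIf (invr_neq0 d0)) e.
by rewrite -e eqxx in bz.
Qed.

(** Both sides of [aligned] are additive in [z]. Subtracting the two relations removes [omega] and
    leaves [sig d = a d] for [d = b - b']. *)
Lemma aligned_inj b b' v : v * bar v = 1 -> bar b = b -> bar b' = b' ->
  aligned (b + omega) v -> aligned (b' + omega) v -> b = b'.
Proof.
move=> Nv bb bb' A1 A2; apply/eqP; rewrite -subr_eq0; apply/negPn/negP => d0.
apply: (aligned_eigen Nv _ A1 (_ : bar (b - b') = b - b') d0); last 1 first.
- have n0 := one_addr_neq0 Nv.
  apply: (mulIf n0); transitivity ((sig (bar (b + omega)) + delta * v * sig (b + omega)) * shifted_norm v * theta
     - (sig (bar (b' + omega)) + delta * v * sig (b' + omega)) * shifted_norm v * theta).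
    by rewrite !(rmorphD, rmorphN) /= bb bb'; ring.
  by rewrite A1 A2 !rmorphD /= bb bb'; ring.
- by rewrite rmorphD bb (inj_eq (addrI b)).
by rewrite rmorphB bb bb'.
Qed.

(** Once [1 + delta v] is cancelled, multiplication by [sig (bar z)] turns [aligned] into an
    identity for [(sig (bar z) + y) * (sig (bar z) + bar y)], where [y] enters only through its
    trace and norm. *)
Lemma aligned_of_point b y (z := b + omega) (v := y / (delta * sig z)) :
  bar b = b -> y * bar y = c * (sig z * sig (bar z)) ->
  (y + bar y) * theta = sig z * bar z - z * sig (bar z)
    - c * (z * sig z - bar z * sig (bar z)) ->
  [/\ v * bar v = 1, aligned z v & y = delta * v * sig z].
Proof.
move=> bb Ny Ty; have bz : bar z != z by rewrite rmorphD bb (inj_eq (addrI b)).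
have z0 : z != 0 by apply: contraNneq bz => ->; rewrite rmorph0.
have sz0 : sig z != 0 by rewrite fmorph_eq0.
have sbz0 : sig (bar z) != 0 by rewrite !fmorph_eq0.
have bd0 : bar delta != 0 by rewrite fmorph_eq0.
have yv : y = delta * v * sig z.
  by rewrite /v; move: (sig z) sz0 => w w0; field; rewrite ?delta0 ?w0.
have bzE : theta = z - bar z by rewrite /z rmorphD bb /theta; ring.
have byv : bar y = bar delta * bar v * sig (bar z).
  by rewrite [in LHS]yv !rmorphM /= sig_bar.
have Nv : v * bar v = 1.
  have c0 : c * (sig z * sig (bar z)) != 0 by rewrite !mulf_neq0.
  by apply: (mulIf c0); rewrite mul1r -[RHS]Ny byv yv /c; ring.
split=> //; rewrite /aligned /shifted_norm -yv.
transitivity ((sig (bar z) + y) * (1 + bar delta * bar v) * theta * (1 + delta * v)); first by ring.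
congr (_ * _); apply: (mulfI sbz0).
transitivity ((sig (bar z) + y) * (sig (bar z) + bar y) * theta).
  by rewrite byv; ring.
transitivity (sig (bar z) * (sig (bar z) * theta + (y + bar y) * theta) + (y * bar y) * theta).
  by ring.
rewrite Ty Ny bzE rmorphB /=; ring.
Qed.

Lemma norm_of_point y (v := y / delta) (t : L) : y * bar y = c -> y + bar y = t ->
  v * bar v = 1 /\ shifted_norm v = 1 + t + c.
Proof.
move=> Ny Ty; have bd0 : bar delta != 0 by rewrite fmorph_eq0.
split; first by rewrite /v rmorphM fmorphV mulrACA Ny -invfM divff // mulf_neq0.
rewrite /shifted_norm /v rmorphM fmorphV -{}Ty -{}Ny.
by field; rewrite ?delta0 ?bd0.
Qed.
End Eigenvalues.

Lemma card_dep_set (I J : finType) (T : I -> {set J}) :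
  #|[set w : I * J | w.2 \in T w.1]| = (\sum_i #|T i|)%N.
Proof.
under [RHS]eq_bigr => i _ do rewrite -sum1_card.
rewrite pair_big_dep /= sum1_card; apply: eq_card => w; rewrite !inE.
by case: w.
Qed.

Lemma leq_card_fibers (I J : finType) (A : {set I}) (g : I -> J) k :
  (forall v, (#|[set x in A | g x == v]| <= k)%N) -> (#|A| <= k * #|g @: A|)%N.
Proof.
move=> fib; rewrite -sum1_card (partition_big_imset g) /= mulnC -sum_nat_const.
apply: leq_sum => v _; rewrite sum1dep_card; apply: leq_trans (fib v).
by apply: subset_leq_card; apply/subsetP => x; rewrite !inE.
Qed.

(** * Counting *)

Section PointCount.
Variables (L : finFieldType) (Q m : nat).
Hypotheses (QL : [pchar L].-nat Q) (mL : [pchar L].-nat m) (m_gt1 : (1 < m)%N).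
Hypothesis cardL : #|L| = (Q * Q)%N.
Local Notation bar := (pow_morph QL).
Local Notation sig := (pow_morph mL).
Local Notation K := (fixed_field bar).
Local Notation T := (twisted_roots QL).

Lemma card_norm1 : (#|[set v : L | (v * bar v == 1)%R]| <= Q.+1)%N.
Proof.
have sX : size ('X^(Q.+1) - 1%:P : {poly L}) = Q.+2 by rewrite size_XnsubC.
rewrite cardE -ltnS -sX; apply: max_poly_roots; last exact: enum_uniq.
  by rewrite -size_poly_gt0 sX.
apply/allP => v; rewrite mem_enum inE => /eqP e.
by rewrite rootE !hornerE exprS -[v ^+ Q]/(bar v) e subrr.
Qed.

Lemma sig_bar x : sig (bar x) = bar (sig x).
Proof. by rewrite /pow_morph -!exprM mulnC. Qed.

Variables (q : nat) (delta omega : L).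
Hypothesis fixed_q : #|[set x : L | x ^+ q == x]| = q.
Hypothesis fixed_sig_bar : forall x, bar x = x -> sig x = x -> x ^+ q = x.
Hypothesis omegaN : bar omega != omega.
Hypothesis delta0 : delta != 0.
Hypothesis eigen : forall x l, x != 0 ->
  binomial_map sig bar delta (l * x) = l * binomial_map sig bar delta x -> bar l = l.
Let c := delta * bar delta.
Hypothesis c1 : c != 1.
Let theta := omega - bar omega.
Let u := (1 - c) * sig theta / theta.
Let z (b : K) : L := val b + omega.
Variables tP tM : K -> L.
Hypothesis tPE : forall b, tP b * theta = sig (z b) * bar (z b) - z b * sig (bar (z b))
    - c * (z b * sig (z b) - bar (z b) * sig (bar (z b))).
Hypothesis tME : forall b, tM b = u * val b ^+ m.-1 - (1 + c).
Local Notation TP b := (T (tP b) (c * (sig (z b) * sig (bar (z b))))).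
Local Notation TM b := (T (tM b) c).

Lemma kummer_point b y : y \in TM b ->
  [/\ (y / delta) * bar (y / delta) = 1, val b != 0 &
      shifted_norm bar delta (y / delta) = u * val b ^+ m.-1].
Proof.
rewrite inE => /andP[/eqP Ty /eqP Ny].
have [Nv NE] := norm_of_point delta0 Ny Ty.
have NE' : shifted_norm bar delta (y / delta) = u * val b ^+ m.-1.
  by rewrite NE tME; rewrite -/c; ring.
split=> //; have := shifted_norm_neq0 (barK QL cardL) c1 Nv.
rewrite NE' mulf_eq0 negb_or => /andP[_]; rewrite expf_eq0 negb_and.
by case: (m) m_gt1 => [|[]].
Qed.

(** The value [v] determines [y], and through the shifted norm also [b^(m-1)]. So the ratio of two
    admissible [b] is fixed by [sig] and by [bar], and is a nonzero element of the field of order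
    [q]. *)
Lemma kummer_fiber v :
  (#|[set w in [set w : K * L | w.2 \in TM w.1] | w.2 / delta == v]| <= q.-1)%N.
Proof.
set A := [set w in _ | _]; have [->|[w0 w0A]] := set_0Vmem A; first by rewrite cards0.
have theta0 : theta != 0 by apply: theta0.
have u0 : u != 0.
  by rewrite !mulf_neq0 ?invr_eq0 ?fmorph_eq0 // subr_eq0 eq_sym.
have AE w : w \in A -> [/\ w.2 = v * delta, val w.1 != 0 & shifted_norm bar delta v = u * val w.1 ^+ m.-1].
  rewrite !inE => /andP[/= wT /eqP ev].
  have [|_ b0 NE] := @kummer_point w.1 w.2; first by rewrite inE.
  by split=> //; [rewrite -ev divfK|rewrite -ev].
have [e0 b00 N0] := AE w0 w0A.
pose g (w : K * L) := val w.1 / val w0.1.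
have gI : {in A &, injective g}.
  move=> w w' /AE[e _ _] /AE[e' _ _] /(mulIf (_ : (val w0.1)^-1 != 0)) ee.
  case: w w' e e' ee => [w1 w2] [w1' w2'] /= -> -> ee; congr (_, _).
  by apply/val_inj/ee; rewrite invr_eq0.
rewrite -(card_in_imset gI) -fixed_q [X in (_ <= X.-1)%N](cardsD1 0) [0 \in _]inE expr0n.
have -> : (q == 0)%N = false.
  by apply/negP => /eqP q0; move: fixed_q; rewrite q0 => /eqP; rewrite cards_eq0 => /eqP/setP/(_ 1); rewrite !inE expr1n eqxx.
rewrite eqxx add1n /=; apply: subset_leq_card; apply/subsetP => _ /imsetP[w wA ->].
have [e b0 Nw] := AE w wA; rewrite !inE mulf_neq0 ?invr_eq0 //=; apply/eqP.
apply: fixed_sig_bar; first by rewrite /g rmorphM fmorphV /= !bar_val.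
rewrite /g /pow_morph -(prednK (ltnW m_gt1)) exprSr expr_div_n.
have -> : val w.1 ^+ m.-1 = val w0.1 ^+ m.-1 by apply: (mulfI u0); rewrite -Nw -N0.
by rewrite divff ?mul1r // expf_neq0.
Qed.

Lemma point_count :
  (q.-1 * \sum_b #|TP b| + \sum_b #|TM b| <= q.-1 * Q.+1)%N.
Proof.
have barK := barK QL cardL.
have theta0 : theta != 0 by apply: theta0.
rewrite -!card_dep_set.
set SP := [set w | _]; set SM := [set w | _ \in TM _].
pose gP (w : K * L) := w.2 / (delta * sig (z w.1)).
have PE w : w \in SP -> [/\ gP w * bar (gP w) = 1,
    aligned sig bar delta omega (z w.1) (gP w) & w.2 = delta * gP w * sig (z w.1)].
  rewrite !inE => /andP[/eqP Ty /eqP Ny].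
  apply: aligned_of_point => //; first exact: sig_bar; first exact: bar_val.
  by rewrite Ty tPE.
have gPI : {in SP &, injective gP}.
  move=> w w' /PE[Nv A e] /PE[_ A' e'] ee; rewrite -ee in A' e'.
  have eb : w.1 = w'.1.
    apply: val_inj; apply: (aligned_inj barK sig_bar omegaN eigen c1 Nv _ _ A A'); exact: bar_val.
  have e2 : w.2 = w'.2 by rewrite e e' eb.
  by rewrite [w]surjective_pairing [w']surjective_pairing eb e2.
have leM : (#|SM| <= q.-1 * #|[set w.2 / delta | w in SM]|)%N.
  by apply: leq_card_fibers kummer_fiber.
apply: leq_trans (leq_add (leqnn _) leM) _; rewrite -(card_in_imset gPI) -mulnDr leq_mul2l.
apply/orP; right; apply: leq_trans card_norm1.
rewrite -cardsUI (_ : _ :&: _ = set0) ?cards0 ?addn0.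
  apply: subset_leq_card; apply/subsetP => v; rewrite in_setU => /orP[] /imsetP[w wS ->]; rewrite inE.
    by have [-> _ _] := PE w wS.
  by rewrite inE in wS; have [-> _ _] := kummer_point wS.
apply/setP => v; rewrite !inE; apply/negP => /andP[/imsetP[w wP ->] /imsetP[w' wM ev]].
have [Nv A e] := PE w wP; rewrite inE in wM; have [_ b0 NE] := kummer_point wM.
(* A common value [v] would make [d = 1 / b], with [b] from the second curve, satisfy
   [sig d = a d]. *)
apply: (aligned_eigen barK sig_bar omegaN eigen c1 Nv _ A (_ : bar (val w'.1)^-1 = _)).
- by rewrite /z rmorphD /= bar_val (inj_eq (addrI _)).
- by rewrite fmorphV /= bar_val.
- by rewrite invr_eq0.
have sigE x : sig x = x * x ^+ m.-1 by rewrite -exprS (prednK (ltnW m_gt1)).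
rewrite ev NE /= -/c -/theta sigE exprVn.
have := expf_neq0 m.-1 b0; move: (_ ^+ m.-1) => B B0.
rewrite /u; move: theta (sig theta) theta0 => t st t0.
by field; apply/and3P; split.
Qed.
End PointCount.

Lemma natr_pnat_pchar (F : finFieldType) m : [pchar F].-nat m -> (1 < m)%N -> m%:R = 0 :> F.
Proof.
have [p pp pF] := finPcharP F; rewrite (eq_pnat _ (pcharf_eq pF)) => /p_natP[[|e] ->] // _.
by rewrite natrX (pcharf0 pF) expr0n.
Qed.

(** With [a = q - 1] and [B = a (2 m - 1) + (2 m - 3)] the counts give [Q - a <= B sqrt Q]. But
    [B + 1 <= sqrt Q] yields [Q - B sqrt Q >= sqrt Q > a], as [a <= B]. The two error terms come
    from [w = m] and [w = m - 1]; inequalities are squared to stay in the integers. *)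
Lemma count_contradiction (q m Q : nat) (P M : nat) (E1 E2 : int) :
  (1 < q)%N -> (1 < m)%N -> ((q.-1 * m.*2.-1 + m.-1.*2.-1).+1 ^ 2 <= Q)%N ->
  E1 ^+ 2 <= (m.-1.*2.-1 ^ 2 * Q)%N%:R -> E2 ^+ 2 <= (m.*2.-1 ^ 2 * Q)%N%:R ->
  Q%:R - E1 <= M%:R -> Q%:R - E2 <= P%:R ->
  (q.-1 * P + M <= q.-1 * Q.+1)%N -> False.
Proof.
case: q => [|[|q]] // _; case: m => [|[|m]] // _ hQ /= h1 h2 hM hP le.
pose X : int := Q%:R - q.+1%:R.
pose b1 : int := (m.*2.+1)%:R; pose b2 : int := (m.*2.+3)%:R.
have leX : X <= q.+1%:R * E2 + E1.
  have le' : q.+1%:R * P%:R + M%:R <= q.+1%:R * (Q%:R + 1) :> int.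
    by rewrite natr1 -!natrM -natrD ler_nat.
  have hP' : q.+1%:R * (Q%:R - E2) <= q.+1%:R * P%:R by rewrite ler_wpM2l.
  rewrite /X; move: le' hP' hM; rewrite !mulrDr mulrN mulr1.
  set A := _ * Q%:R; set B := _ * E2; set C := _ * P%:R; lra.
have e1 : E1 ^+ 2 <= b1 ^+ 2 * Q%:R by rewrite -natrX -natrM.
have e2 : E2 ^+ 2 <= b2 ^+ 2 * Q%:R by rewrite -natrX -natrM.
have [b10 b20] : 0 < b1 /\ 0 < b2 by rewrite !ltr0n.
have [a aE] : exists a : int, a = q.+1%:R by exists q.+1%:R.
have a0 : 0 < a by rewrite aE ltr0n.
pose B := a * b2 + b1.
have BQ : (B + 1) ^+ 2 <= Q%:R.
  by rewrite /B aE -natrM -natrD natr1 -natrX ler_nat.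
have aB : a <= B.
  by rewrite /B -[X in X <= _]mulr1 ler_wpDr ?(ltW b10) // ler_wpM2l ?(ltW a0) // ler1n.
move: leX e1 e2 BQ; rewrite /X -aE; move: (Q%:R : int) => R leX e1 e2 BQ.
(* The product of the two error bounds, obtained without square roots from
   [(b1 E2 - b2 E1)^2 >= 0]. *)
have cross : E1 * E2 <= b1 * b2 * R.
  have bb : 0 < b1 * b2 * 2 by rewrite !mulr_gt0.
  rewrite -(ler_pM2l bb).
  have s1 : b2 ^+ 2 * E1 ^+ 2 <= b2 ^+ 2 * (b1 ^+ 2 * R) by rewrite ler_wpM2l ?sqr_ge0.
  have s2 : b1 ^+ 2 * E2 ^+ 2 <= b1 ^+ 2 * (b2 ^+ 2 * R) by rewrite ler_wpM2l ?sqr_ge0.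
  have := sqr_ge0 (b1 * E2 - b2 * E1); nra.
have sq : (a * E2 + E1) ^+ 2 <= B ^+ 2 * R.
  have t1 : a ^+ 2 * E2 ^+ 2 <= a ^+ 2 * (b2 ^+ 2 * R) by rewrite ler_wpM2l ?sqr_ge0.
  have t2 : a * (E1 * E2) <= a * (b1 * b2 * R) by apply: ler_wpM2l cross; exact: ltW.
  rewrite /B; nra.
have X0 : 0 < R - a by nra.
have : (R - a) ^+ 2 <= B ^+ 2 * R.
  by apply: le_trans sq; rewrite ler_pXn2r // ?nnegrE ?ltW //; lra.
nra.
Qed.

Section CurvePair.
Variables (L : finFieldType) (Q m q : nat).
Hypotheses (QL : [pchar L].-nat Q) (mL : [pchar L].-nat m) (m_gt1 : (1 < m)%N).
Hypothesis cardL : #|L| = (Q * Q)%N.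
Local Notation bar := (pow_morph QL).
Local Notation sig := (pow_morph mL).
Local Notation K := (fixed_field bar).
Hypothesis q_gt1 : (1 < q)%N.
Hypothesis fixed_q : #|[set x : L | x ^+ q == x]| = q.
Hypothesis fixed_sig_bar : forall x, bar x = x -> sig x = x -> x ^+ q = x.
Hypothesis Q_large : ((q.-1 * m.*2.-1 + m.-1.*2.-1).+1 ^ 2 <= Q)%N.
Variable delta : L.
Hypothesis delta0 : delta != 0.

Lemma exists_not_fixed : exists omega, bar omega != omega.
Proof.
apply/existsP; rewrite -negb_forall; apply/negP => /forallP fx.
have : (#|L| <= #|{: K}|)%N.
  apply: (@leq_card _ _ (fun x => insubd (0 : K) x)) => x y /(congr1 val).
  by rewrite !val_insubd /fixed_by /= !fx.
have := finNzRing_gt1 K; rewrite (card_fixed QL cardL) cardL => Q1.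
by rewrite leqNgt -[X in (X < _)%N]muln1 ltn_pmul2l ?Q1 // ltnW.
Qed.

Lemma eigen_exists_norm_neq1 : delta * bar delta != 1 ->
  exists x l, [/\ x != 0, binomial_map sig bar delta (l * x) = l * binomial_map sig bar delta x
    & bar l != l].
Proof.
move=> c1.
case: (boolP [exists x, exists l, [&& x != 0,
   binomial_map sig bar delta (l * x) == l * binomial_map sig bar delta x & bar l != l]]).
  by move=> /existsP[x /existsP[l /and3P[x0 /eqP e bl]]]; exists x, l.
rewrite negb_exists => /forallP none; exfalso.
have eigen x l : x != 0 ->
    binomial_map sig bar delta (l * x) = l * binomial_map sig bar delta x -> bar l = l.
  move=> x0 e; have := none x; rewrite negb_exists => /forallP/(_ l).
  by rewrite x0 e eqxx /= negbK => /eqP.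
have [omega omegaN] := exists_not_fixed.
pose c := delta * bar delta; pose theta := omega - bar omega.
have barK := barK QL cardL.
have theta0 : theta != 0 by apply: theta0.
have bth : bar theta = - theta by apply: bar_theta.
have sbC := sig_bar QL mL.
have bc : bar c = c by rewrite /c rmorphM /= barK mulrC.
pose u := (1 - c) * sig theta / theta.
have bu : bar u = u.
  have b1c : bar (1 - c) = 1 - c by rewrite rmorphB rmorph1 /= bc.
  have bsth : bar (sig theta) = - sig theta by rewrite -sbC bth; apply: rmorphN.
  by rewrite /u fmorph_div rmorphM /= b1c bsth bth mulrN invrN mulrNN.
(* The right-hand side of the trace equation at [b = 0]. Both [C0] and [theta] change sign under
   [bar], so their quotient lies in [K]. *)
pose C0 := sig omega * bar omega - omega * sig (bar omega)
   - c * (omega * sig omega - bar omega * sig (bar omega)).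
have bC0 : bar (C0 / theta) = C0 / theta.
  rewrite rmorphM fmorphV /= bth invrN mulrN -mulNr; congr (_ / _).
  by rewrite /C0 /c !(rmorphB, rmorphM) /= -!sbC !barK; ring.
have bt : bar (sig omega + sig (bar omega)) = sig omega + sig (bar omega).
  by rewrite rmorphD /= -!sbC barK addrC.
have bv : bar (sig omega * sig (bar omega)) = sig omega * sig (bar omega).
  by rewrite rmorphM /= -!sbC barK mulrC.
have [cK ec] := subKP bc; have [uK eu] := subKP bu; have [dK ed] := subKP bC0.
have [tK et] := subKP bt; have [vK ev] := subKP bv.
have m0 : m%:R = 0 :> L by apply: natr_pnat_pchar.
have m0K : m%:R = 0 :> K by apply: val_inj; rewrite rmorph_nat m0 rmorph0.
have bd0 : bar delta != 0 by rewrite fmorph_eq0.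
have cK0 : cK != 0 by apply: contraNneq (mulf_neq0 delta0 bd0) => e; rewrite -/c -ec e rmorph0.
have cK1 : cK != 1 by apply: contraNneq c1 => e; rewrite -/c -ec e rmorph1.
have uK0 : uK != 0.
  have : u != 0.
    by rewrite !mulf_neq0 ?invr_eq0 ?fmorph_eq0 // subr_eq0 eq_sym.
  by apply: contraNneq => e; rewrite -eu e rmorph0.
have sigE x : x ^+ m = sig x by [].
have vtE b : val (additive_trace cK uK m dK).[b] =
    val uK * val b - (1 + val cK) * sig (val b) + val dK.
  rewrite /additive_trace !hornerE !(rmorphD, rmorphN, rmorphM) rmorphXn /=.
  by [].
have ktE b : val (kummer_trace cK uK m).[b] = val uK * val b ^+ m.-1 - (1 + val cK).
  by rewrite /kummer_trace !hornerE !(rmorphD, rmorphN, rmorphM) rmorphXn.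
have traceE b : val (additive_trace cK uK m dK).[b] * theta =
    (1 - c) * sig theta * val b - (1 + c) * sig (val b) * theta + C0.
  by rewrite vtE ec eu ed /u; field.
have bzE (b : K) : bar (val b + omega) = val b + bar omega.
  by rewrite (rmorphD bar) /= bar_val.
have szE (b : K) : sig (val b + omega) = sig (val b) + sig omega by apply: rmorphD.
have sbzE (b : K) : sig (bar (val b + omega)) = sig (val b) + sig (bar omega).
  by rewrite bzE; apply: rmorphD.
have normE b : val (additive_norm cK m tK vK).[b] =
    c * (sig (val b + omega) * sig (bar (val b + omega))).
  rewrite szE sbzE -[sig (val b)]sigE.
  move: (sig omega) (sig (bar omega)) et ev => so sbo et' ev'.
  have -> : (additive_norm cK m tK vK).[b] = cK * (b ^+ m.*2 + tK * b ^+ m + vK).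
    by rewrite /additive_norm !hornerE.
  rewrite rmorphM !rmorphD rmorphM !rmorphXn /= -muln2 exprM.
  by rewrite ec et' ev'; ring.
(* The norm is [c (X + omega)^m (X + bar omega)^m], and at [- omega] and [- bar omega] the trace
   takes the nonzero values [c sig(theta)] and [- c sig(theta)]. *)
have cop : coprimep (additive_norm cK m tK vK) (additive_trace cK uK m dK).
  have trN w : bar w != w -> w = omega \/ w = bar omega ->
      u * - w - (1 + c) * (- w) ^+ m + C0 / theta != 0.
    move=> bw ew; have -> : (- w) ^+ m = - sig w by rewrite sigE; apply: rmorphN.
    suff : (u * - w - (1 + c) * - sig w + C0 / theta) * theta != 0.
      by apply: contraNneq => ->; rewrite mul0r.
    have cts0 : c * theta * sig theta != 0 by rewrite !mulf_neq0 ?fmorph_eq0.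
    have stE : sig theta = sig omega - sig (bar omega) by apply: rmorphB.
    have -> : (u * - w - (1 + c) * - sig w + C0 / theta) * theta =
        (1 - c) * sig theta * - w + (1 + c) * sig w * theta + C0 by rewrite /u; field.
    case: ew => ->.
      by rewrite (_ : _ + C0 = c * theta * sig theta) // stE /theta /C0; ring.
    rewrite (_ : _ + C0 = - (c * theta * sig theta)) ?oppr_eq0 //.
    by rewrite stE /theta /C0; ring.
  have mapN (f : {rmorphism K -> L}) : map_poly f (additive_norm cK m tK vK) =
      f cK *: ('X^(m.*2) + f tK *: 'X^m + (f vK)%:P).
    by rewrite /additive_norm map_polyZ !rmorphD /= map_polyZ !map_polyXn map_polyC.
  have mapT (f : {rmorphism K -> L}) : map_poly f (additive_trace cK uK m dK) =
      f uK *: 'X - (1 + f cK) *: 'X^m + (f dK)%:P.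
    rewrite /additive_trace !rmorphD rmorphN /= !map_polyZ map_polyX map_polyXn map_polyC /=.
    by rewrite rmorphD rmorph1.
  pose vm : {rmorphism K -> L} := val.
  rewrite -(coprimep_map vm).
  have mLp : [pchar {poly L}].-nat m.
    by apply: sub_in_pnat mL => p _; apply: (rmorph_pchar (@polyC L)).
  have -> : map_poly vm (additive_norm cK m tK vK) =
      c *: (('X - (- omega)%:P) ^+ m * ('X - (- bar omega)%:P) ^+ m).
    rewrite mapN !polyCN !opprK !(exprDn_pchar _ _ mLp) -!polyC_exp !sigE [vm cK]ec [vm tK]et [vm vK]ev -muln2 exprM -!mul_polyC polyCD polyCM; congr (_ * _); ring.
  have -> : map_poly vm (additive_trace cK uK m dK) = u *: 'X - (1 + c) *: 'X^m + (C0 / theta)%:P.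
    by rewrite mapT [vm cK]ec [vm uK]eu [vm dK]ed.
  rewrite coprimepZl ?mulf_neq0 // coprimepMl; apply/andP.
  by split; apply: coprimep_expl; rewrite coprimep_sym coprimep_XsubC rootE !hornerE trN //;
     [left|rewrite barK eq_sym|right].
have [E1 E12 EM] := kummer_count cardL m_gt1 m0K cK0 cK1 uK0.
have [E2 E22 EP] := additive_count cardL m_gt1 m0K cK0 cK1 uK0 cop.
have := count_contradiction q_gt1 m_gt1 Q_large E12 E22 EM EP; apply.
apply: leq_trans (point_count m_gt1 cardL fixed_q fixed_sig_bar omegaN delta0 eigen c1 
  (tP := fun b => val (additive_trace cK uK m dK).[b])
  (tM := fun b => val (kummer_trace cK uK m).[b]) _ _).
- rewrite leq_eqVlt; apply/orP; left; apply/eqP; congr (_ * _ + _)%N.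
    by apply: eq_bigr => b _; rewrite normE.
  by apply: eq_bigr => b _; rewrite ec.
- move=> b; rewrite traceE bzE szE -bzE sbzE bzE -/c /C0 /theta.
  have -> : sig (omega - bar omega) = sig omega - sig (bar omega) by apply: rmorphB.
  by ring.
by move=> b; rewrite ktE ec eu.
Qed.
End CurvePair.

(** The number squared is at most [2 q q^s], and its square is bounded by [q^(4 s + 1)] as soon as
    [4 q <= q^(2 s)]. This fails only for [s = 1] with [q] equal to 2 or 3, where the numbers are
    compared directly. *)
Lemma large_exponent q n s : (1 < q)%N -> (0 < s)%N -> (4 * s + 1 <= n)%N ->
  ((q.-1 * (q ^ s).*2.-1 + (q ^ s).-1.*2.-1).+1 ^ 2 <= q ^ n)%N.
Proof.
move=> q1 s0 ns; apply: leq_trans (leq_pexp2l (ltnW q1) ns).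
have -> : (q ^ (4 * s + 1) = q * (q ^ s) ^ 4)%N by rewrite -expnM expnD expn1 mulnC (mulnC 4%N).
have [qs|q4] := leqP (4 * q) ((q ^ s) ^ 2).
  apply: leq_trans (_ : (2 * q * q ^ s) ^ 2 <= _)%N.
    rewrite leq_exp2r //; have : (0 < q ^ s)%N by rewrite expn_gt0 (ltnW q1).
    by move: (q ^ s)%N => m m0; case: q q1 {ns qs} => [|[|q]] // _; case: m m0 => // m _; rewrite -!mul2n /=; lia.
  rewrite (_ : (2 * q * q ^ s) ^ 2 = q * ((4 * q) * (q ^ s) ^ 2))%N; last by ring.
  by rewrite leq_mul2l (_ : (q ^ s) ^ 4 = (q ^ s) ^ 2 * (q ^ s) ^ 2)%N ?leq_mul2r ?qs ?orbT // -expnD.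
have s1 : s = 1%N.
  case: s s0 q4 {ns} => [|[|s]] // _; rewrite -expnM => q4.
  have : (q ^ 4 <= q ^ (s.+2 * 2))%N by rewrite leq_exp2l //; lia.
  have : (4 * q <= q ^ 4)%N.
    rewrite (_ : q ^ 4 = q ^ 2 * q * q)%N; last by ring.
    by rewrite leq_mul2r (leq_trans (_ : 4 <= 2 ^ 2 * 2)%N) ?orbT // leq_mul ?leq_exp2r.
  by move=> h1 h2; have := leq_trans h1 h2; rewrite leqNgt q4.
move: q4; rewrite s1 expn1 -mulnn ltn_mul2r => /andP[_]; clear -q1.
by case: q q1 => [|[|[|[|]]]].
Qed.

Lemma expr_iter_fixed (R : pzSemiRingType) (x : R) q i : x ^+ q = x -> x ^+ (q ^ i) = x.
Proof. by move=> e; elim: i => [|i IHi]; rewrite ?expr1 // expnS exprM e. Qed.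

Lemma expr_fixed_coprime (R : pzSemiRingType) (x : R) q n s : (0 < n)%N -> coprime n s ->
  x ^+ (q ^ n) = x -> x ^+ (q ^ s) = x -> x ^+ q = x.
Proof.
move=> n0 cop en es; have [a b eab _] := egcdnP s n0; move: eab.
rewrite (eqP cop) => eab; have := expr_iter_fixed a en.
rewrite -expnM mulnC eab expnD expn1 exprM mulnC expnM.
by rewrite (expr_iter_fixed b es).
Qed.

(** * Scatteredness and the conclusion *)

Section Scattered.
Variables (L : finFieldType) (q n s : nat).
Hypotheses (q_gt1 : (1 < q)%N) (n0 : (0 < n)%N) (qL : [pchar L].-nat q).
Hypothesis cardL : #|L| = (q ^ (2 * n))%N.
Hypotheses (nL : [pchar L].-nat (q ^ n)%N) (sL : [pchar L].-nat (q ^ s)%N).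
Local Notation sig := (pow_morph sL).
Local Notation bar := (pow_morph nL).
Local Notation F := (fixed_field (pow_morph qL)).

Lemma f_dsE delta x : f_ds q n s delta x = binomial_map sig bar delta x.
Proof. by rewrite /f_ds /binomial_map /= /pow_morph -exprM -expnD. Qed.

Lemma card_ground : #|{: F}| = q.
Proof. by apply: card_subK cardL; rewrite muln_gt0. Qed.

(** If [l] were outside the field of order [q], the [q^2] combinations of [x] and [l x] over it
    would give elements of [U] on the line of [(x, f x)], so the weight would be at least 2. *)
Lemma scattered_eigen delta x l : scattered q n s delta -> x != 0 ->
  binomial_map sig bar delta (l * x) = l * binomial_map sig bar delta x -> l ^+ q = l.
Proof.
move=> sc x0 el; set f := binomial_map sig bar delta in el.
pose v := (x, f x).
have vU : v \in U_ds q n s delta by rewrite inE /= f_dsE.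
have v0 : v != 0 by apply: contraNneq x0 => /(congr1 fst) /= ->.
have := sc v vU v0; rewrite /weight => w1; apply/eqP/negPn/negP => lq.
have fixed (a : F) i : val a ^+ (q ^ i) = val a.
  by apply: expr_iter_fixed; have := bar_val a.
have flin (a b : F) y z : f (val a * y + val b * z) = val a * f y + val b * f z.
  rewrite /f /binomial_map !rmorphD !rmorphM /=.
  by rewrite /pow_morph !fixed /=; ring.
pose g (ab : F * F) := let t := val ab.1 + val ab.2 * l in (t * x, t * f x).
have gI : injective g.
  move=> [a b] [a' b'] /(congr1 fst) /= /(mulIf x0) e.
  have e' : val (a - a') = val (b' - b) * l.
    by rewrite !rmorphB mulrBl; apply/eqP; rewrite subr_eq addrAC eq_sym subr_eq addrC e.
  have [eb|nb] := eqVneq b' b.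
    by move: e'; rewrite eb subrr rmorph0 mul0r => /eqP; rewrite fmorph_eq0 subr_eq0 => /eqP ->.
  have nb0 : val (b' - b) != 0 by rewrite fmorph_eq0 subr_eq0.
  case/eqP: lq; have -> : l = val ((a - a') / (b' - b)).
    by rewrite fmorph_div; apply: (mulfI nb0); rewrite -e' mulrC divfK.
  by have := bar_val ((a - a') / (b' - b)).
have sub : (#|[set g ab | ab in setT]| <= #|U_ds q n s delta :&: Lspan v|)%N.
  apply: subset_leq_card; apply/subsetP => _ /imsetP[[a b] _ ->].
  rewrite !inE /= f_dsE -/f; apply/andP; split; last first.
    by apply/existsP; exists (val a + val b * l).
  by rewrite !mulrDl -!mulrA flin el.
have : (q ^ 2 <= #|U_ds q n s delta :&: Lspan v|)%N.
  by apply: leq_trans sub; rewrite card_imset // cardsT card_prod card_ground expnS expn1.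
by move/(trunc_log_max q_gt1); rewrite w1.
Qed.
End Scattered.

Theorem theorem4p1 (p k : nat) (q n s : nat) (L : finFieldType) :
  prime p -> (0 < k)%N -> q = (p ^ k)%N ->
  (0 < n)%N -> (0 < s)%N -> coprime n s ->
  #|L| = (q ^ (2 * n))%N ->
  (if ((q == 3%N) && (1 < s)%N) || ((q == 2%N) && (2 < s)%N)
   then (4 * s + 2 <= n)%N else (4 * s + 1 <= n)%N) ->
  forall delta : L, delta != 0 -> ~ scattered q n s delta.
Proof.
move=> pp k0 qE n0 s0 cop cardL hn delta delta0 sc.
have q1 : (1 < q)%N by rewrite qE -{1}(expn0 p) ltn_exp2l ?prime_gt1.
have ns : (4 * s + 1 <= n)%N by case: ifP hn => _ //; apply: leq_trans; rewrite leq_add2l.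
have qL : [pchar L].-nat q.
  by have := pchar_nat_card L; rewrite cardL pnatX muln_eq0 /= -leqn0 leqNgt n0 orbF.
have nL : [pchar L].-nat (q ^ n)%N by rewrite pnatX qL.
have sL : [pchar L].-nat (q ^ s)%N by rewrite pnatX qL.
have cardL2 : #|L| = (q ^ n * q ^ n)%N by rewrite -expnD addnn -mul2n.
have eigen x l := @scattered_eigen L q n s q1 n0 qL cardL nL sL delta x l sc.
have [N1|N1] := eqVneq (delta * pow_morph nL delta) 1.
  have [omega omegaN] := exists_not_fixed nL cardL2.
  have [x x0 ker] := norm1_kernel (barK nL cardL2) (sig_bar nL sL) omegaN delta0 N1.
  (* On the kernel vector every element of [K] is an eigenvalue, so [K] would embed in the field of
     order [q], although [n > 1]. *)
  have : (#|{: fixed_field (pow_morph nL)}| <= #|{: fixed_field (pow_morph qL)}|)%N.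
    apply: (@leq_card _ _ (fun a => insubd (0 : fixed_field (pow_morph qL)) (val a))) => a b /(congr1 val).
    rewrite !val_insubd /fixed_by /= !ifT; first exact: val_inj.
      by apply/eqP/(eigen x) => //; apply/ker/bar_val.
    by apply/eqP/(eigen x) => //; apply/ker/bar_val.
  rewrite (card_ground n0 qL cardL) (card_fixed nL cardL2) -[X in (_ <= X)%N]expn1 leq_exp2l //.
  by move: ns; lia.
have qs1 : (1 < q ^ s)%N by rewrite -{1}(expn0 q) ltn_exp2l.
have [|||x [l [x0 el bl]]] := eigen_exists_norm_neq1 (mL := sL) qs1 cardL2 q1 _ _ _ delta0 N1.
- rewrite -[RHS](card_ground n0 qL cardL) card_sig.
  by apply: eq_card => x; rewrite inE.
- by move=> x; apply: expr_fixed_coprime.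
- exact: large_exponent.
by case/eqP: bl; apply: expr_iter_fixed; apply: eigen el.
Qed.
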